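(* For every integer $d\geq1$, every $\eta\in[1/2,1)$ and every $\epsilon\in(0,1-\eta]$, there exist positive constants $c_3=c_3(d,\epsilon)$ and $C_3=C_3(d,\epsilon)$ such that, if $r=r(n)\in[C_3(\log n/n)^{1/d},c_3]$, then asymptotically almost surely $G_d(n,r)$ satisfies the following property: for every integer $L\in[c_3^{-1},2\eta n/(1+\eta)]$ and every vertex $v$, every $(\eta+\epsilon)$-subgraph of $G_d(n,r)$ contains a cycle of length $L$ containing $v$.
   Context: The random geometric graph $G_d(n,r)$ has vertex set $[n]$; each vertex $i$ is assigned a position $X_i$, where $X_1,\dots,X_n$ are independent uniform random points in $[0,1]^d$, and $ij$ is an edge iff $\lVert X_i-X_j\rVert\le r$ (Euclidean norm). For $\alpha\in[0,1]$, an $\alpha$-subgraph of $G$ is a subgraph $H\subseteq G$ with $V(H)=V(G)$ and $d_H(v)\geq\alpha d_G(v)$ for all $v$. A.a.s. means with probability tending to $1$ as $n\to\infty$; $\log$ is the natural logarithm. The length of a cycle is its number of edges. *)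

(* Defs.v *)
From HB Require Import structures.
From mathcomp Require Import all_boot all_order all_algebra.
From mathcomp Require Import all_classical all_reals all_analysis.
Import Order.TTheory GRing.Theory Num.Theory.
Import numFieldNormedType.Exports.

Set Implicit Arguments.
Unset Strict Implicit.
Unset Printing Implicit Defensive.

Local Open Scope classical_set_scope.
Local Open Scope ring_scope.

(* Throughout, a simple graph on [V] is a symmetric irreflexive [rel V]. *)

Definition degree (V : finType) (G : rel V) (v : V) : nat :=
  #|[set w | G v w]%SET|.

(* Irreflexivity of [H] follows from [subrel H G] when [G] is irreflexive;
   [H] is spanning because both graphs live on the whole type [V]. *)
Definition alpha_subgraph (R : realType) (alpha : R) (V : finType)
    (G H : rel V) : Prop :=
  [/\ symmetric H, subrel H G &
      forall v : V, alpha * (degree G v)%:R <= (degree H v)%:R].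

(* The bound [2 < size c] rules out the degenerate closed walks of length at
   most 2 that [ucycle] accepts. *)
Definition has_cycle_through (V : finType) (H : rel V) (L : nat) (v : V)
    : Prop :=
  exists c : seq V, [/\ ucycle H c, (2 < size c)%N, size c = L & v \in c].

(* The library norm on row vectors is the sup norm, hence this definition. *)
Definition euclidean_dist (R : realType) (d : nat) (x y : d.-tuple R) : R :=
  Num.sqrt (\sum_(j < d) (tnth x j - tnth y j) ^+ 2).

Definition geometric_graph (R : realType) (d n : nat)
    (x : 'I_n -> d.-tuple R) (r : R) : rel 'I_n :=
  [rel i j | (i != j) && (euclidean_dist (x i) (x j) <= r)].

(* The law of [X] is the restriction of d-dimensional Lebesgue measure to the
   unit cube, specified by its values on measurable rectangles. *)
Definition uniform_on_cube (R : realType) (disp : measure_display)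
    (T : measurableType disp) (P : probability T R) (d : nat)
    (X : {RV P >-> (d.-tuple R)}) : Prop :=
  forall A : 'I_d -> set R, (forall j, measurable (A j)) ->
    P [set w | forall j, A j (tnth (X w) j)] =
    (\prod_(j < d) lebesgue_measure (A j `&` `[0%R, 1%R]))%E.

Definition mutually_independent (R : realType) (disp disp' : measure_display)
    (T : measurableType disp) (T' : measurableType disp')
    (P : probability T R) (I : finType) (X : I -> {RV P >-> T'}) : Prop :=
  forall (J : {set I}) (B : I -> set T'), (forall i, measurable (B i)) ->
    P [set w | forall i, i \in J -> B i (X i w)] =
    (\prod_(i in J) P (X i @^-1` B i))%E.

(* Main.v *)
Require Import Defs.
From HB Require Import structures.
From mathcomp Require Import all_boot all_order all_algebra.
From mathcomp Require Import all_classical all_reals all_analysis.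
From mathcomp Require Import measurable_realfun.
From mathcomp Require Import ring lra zify.
From mathcomp.boot Require Import fintype finset.
Import Order.TTheory GRing.Theory Num.Theory.
Import numFieldNormedType.Exports.

(* Divide the cube into boxes of side 1/K, of order r but far smaller.  By a Chernoff
   bound every box contains about m = n/K^d points, and two points are certainly
   (resp. possibly) adjacent in G according to the distance of their boxes, the
   two neighbourhoods differing by a small proportion of boxes only.  The rest
   is deterministic.  Let H be an (eta+eps)-subgraph of G.
   1. Two vertices of H lying in nearby boxes have linearly many common
      neighbours, because each is adjacent to a proportion eta+eps > 1/2 of almost
      the same neighbourhood in G.
   2. H has a subgraph F of small maximum degree b+1 with
      sum_v deg_F(v) >= (2 a/(1+a) - small) b n, where a = eta + eps/2: take F
      maximising a sum of concave functions of the degrees, with derivative p(v)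
      at v; maximality gives p(u) + p(v) <= 0 on H \ F, and the degree condition
      on H then bounds sum_v p(v) from above.
   3. Label every vertex at random by (c, i), where c is a box drawn with
      probability proportional to its number of F-neighbours in c and i < K is
      uniform (this K is odd and unrelated to the grid).  The label classes then
      have almost perfect F-matchings between (c, c', i) and (c', c, i+1), and
      composing them gives disjoint F-paths on K vertices which start and end in
      the same box and cover more than a proportion 2 eta/(1+eta) of the vertices.
   4. A cycle is obtained from a closed walk in the adjacency graph of the boxes:
      stations (single vertices, and paths of step 3 inserted at a box that
      contains their end points) are linked through distinct common neighbours
      taken in a random reserve.  A path on 2j+1 vertices used as a station
      contributes 2j+2 to the length, so that truncating the paths gives all even
      lengths; for odd lengths the first station is an edge at v. *)

Set Implicit Arguments.
Unset Strict Implicit.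
Unset Printing Implicit Defensive.

Local Open Scope ring_scope.

(** * Concentration for product measures *)

(** The positions enter only through the number of points in each box, so the conclusion holds for
    every [H] at once and no union bound over subgraphs is made; the labels are chosen afterwards,
    for each [H] separately. The proportion 2 a/(1+a) comes from the case of a set S whose edges of
    H all lead to a disjoint set W. The degrees force |W| >= a |S|, a cycle leaves about |S| - |W|
    vertices uncovered, and this difference is at most (1-a)/(1+a) n. Drawing labels in proportion
    to degrees in [F], rather than in [H], is what makes matchings between label classes possible:
    up to a small term, the expected sizes of the classes of (c, c') and (c', c) are both
    proportional to the number of edges of [F] between the two boxes, [F] being symmetric. The
    constants are uniform in eta because the estimates use only 1/2 <= eta and eta + eps <= 1. *)

Section ProductMeasure.
Context {R : realType} {V L : finType}.
Implicit Types (w a : V -> L -> R) (s : {ffun V -> L}).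

Definition weight w s : R := \prod_v w v (s v).
Definition label_sum a s : R := \sum_v a v (s v).
Definition mean w a : R := \sum_v \sum_l w v l * a v l.

Lemma weight_ge0 w s : (forall v l, 0 <= w v l) -> 0 <= weight w s.
Proof. by move=> w0; apply: prodr_ge0. Qed.

Lemma sum_weight w : (forall v, \sum_l w v l = 1) -> \sum_s weight w s = 1.
Proof. by move=> w1; rewrite -bigA_distr_bigA big1. Qed.

(** Multiply by 1 - x: the left side becomes at most 1, the right side 1 + x^2 (1 - 2x), which is at
    least 1. *)
Lemma expR_le_quadratic (x : R) : `|x| <= 2^-1 -> expR x <= 1 + x + 2 * x ^+ 2.
Proof.
move=> hx; have [h1 h2] : - 2^-1 <= x /\ x <= 2^-1 by apply/andP; rewrite -ler_norml.
have h3 : 1 - x <= (expR x)^-1 by rewrite -expRN; exact: expR_ge1Dx.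
have h0 : 0 < expR x := expR_gt0 x.
have h4 : expR x * (1 - x) <= 1.
  by move: h3; rewrite -(ler_pM2l h0) mulfV // lt0r_neq0.
have h5 : 0 < 1 - x by lra.
rewrite -(ler_pM2r h5); apply: (le_trans h4).
have : 0 <= x ^+ 2 * (1 - 2 * x) by apply: mulr_ge0; [exact: sqr_ge0|lra].
rewrite !expr2; nra.
Qed.

(** Independence makes the expectation factor over the vertices; each factor is at most 1 + (lam + 2
    lam^2) E a(v), as a^2 <= a on [0,1]. *)
Lemma exp_moment w a (lam : R) :
  (forall v l, 0 <= w v l) -> (forall v, \sum_l w v l = 1) ->
  (forall v l, 0 <= a v l <= 1) -> `|lam| <= 2^-1 ->
  \sum_s weight w s * expR (lam * label_sum a s)
    <= expR ((lam + 2 * lam ^+ 2) * mean w a).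
Proof.
move=> w0 w1 a01 hlam.
under eq_bigr => s _.
  rewrite /label_sum mulr_sumr expR_sum -big_split /=; over.
rewrite -(bigA_distr_bigA (fun v l => w v l * expR (lam * a v l))) /=.
rewrite /mean mulr_sumr expR_sum; apply: ler_prod => v _; apply/andP; split.
  by apply: sumr_ge0 => l _; rewrite mulr_ge0 ?expR_ge0.
apply: le_trans (expR_ge1Dx _).
rewrite -{1}(w1 v) mulr_sumr -big_split /=; apply: ler_sum => l _.
rewrite mulrCA -[X in _ <= X + _]mulr1 -mulrDr ler_wpM2l //.
have /andP[a0 a1] := a01 v l.
apply: le_trans (expR_le_quadratic _) _.
  by rewrite normrM (ger0_norm a0) (le_trans _ hlam) // ler_piMr.
have h : lam ^+ 2 * (a v l * a v l) <= lam ^+ 2 * a v l.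
  by rewrite ler_wpM2l ?sqr_ge0 // ler_piMl.
by move: h; rewrite !expr2; lra.
Qed.

(** Markov's inequality for the exponential moment. Only the square of [lam] is prescribed, so that
    [t / (4 * B)] and its opposite give both tails; [t <= 2 * B] keeps |lam| <= 1/2. *)
Lemma upper_tail w a (B t lam : R) :
  (forall v l, 0 <= w v l) -> (forall v, \sum_l w v l = 1) ->
  (forall v l, 0 <= a v l <= 1) -> 0 < t <= 2 * B -> mean w a <= B ->
  lam ^+ 2 = (t / (4 * B)) ^+ 2 ->
  \sum_(s | t * (t / (4 * B)) < lam * (label_sum a s - mean w a)) weight w s
    <= expR (- (t ^+ 2 / (8 * B))).
Proof.
move=> w0 w1 a01 /andP[t0 tB] mB lamE.
have B0 : 0 < B by lra.
set z := t / (4 * B) in lamE *.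
have z0 : 0 < z by rewrite divr_gt0 //; lra.
have zh : z <= 2^-1 by rewrite ler_pdivrMr; lra.
have hlam : `|lam| <= 2^-1.
  have -> : `|lam| = z by apply: (@pexpIrn _ 2) => //; rewrite ?nnegrE ?normr_ge0 ?(ltW z0) // real_normK ?num_real.
  exact: zh.
apply: (@le_trans _ _ (\sum_s weight w s * expR (lam * label_sum a s) *
    expR (- (lam * mean w a) - t * z))).
  rewrite [leRHS](bigID (fun s => t * z < lam * (label_sum a s - mean w a))) /=.
  rewrite -[leLHS]addr0 lerD //; last first.
    by apply: sumr_ge0 => s _; rewrite !mulr_ge0 ?expR_ge0 ?weight_ge0.
  apply: ler_sum => s hs; rewrite -mulrA -expRD ler_peMr ?weight_ge0 //.
  by rewrite -expR0 ler_expR; move: hs; rewrite mulrBr; lra.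
rewrite -mulr_suml.
apply: (le_trans (ler_wpM2r (expR_ge0 _) (exp_moment w0 w1 a01 hlam))).
rewrite -expRD ler_expR lamE.
have e1 : t ^+ 2 / (8 * B) = t * z / 2 by rewrite /z expr2; field; lra.
have e2 : z * (4 * B) = t by rewrite /z mulfVK //; lra.
have m0 : 0 <= mean w a.
  by apply: sumr_ge0 => v _; apply: sumr_ge0 => l _; rewrite mulr_ge0 //; case/andP: (a01 v l).
rewrite e1.
have h : z ^+ 2 * mean w a <= z * t / 4.
  apply: (@le_trans _ _ (z ^+ 2 * B)); first by rewrite ler_wpM2l ?sqr_ge0.
  by rewrite -e2; rewrite expr2; lra.
nra.
Qed.

Lemma concentration (J : finType) w (a : J -> V -> L -> R) (B t : R) :
  (forall v l, 0 <= w v l) -> (forall v, \sum_l w v l = 1) ->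
  (forall j v l, 0 <= a j v l <= 1) -> 0 < t <= 2 * B ->
  (forall j, mean w (a j) <= B) ->
  1 - 2 * #|J|%:R * expR (- (t ^+ 2 / (8 * B))) <=
    \sum_(s | [forall j, `|label_sum (a j) s - mean w (a j)| <= t]) weight w s.
Proof.
move=> w0 w1 a01 tB mB.
have /andP[t0 tB'] := tB.
have B0 : 0 < B by lra.
set q := expR _.
pose good s := [forall j, `|label_sum (a j) s - mean w (a j)| <= t].
rewrite -{1}(sum_weight w1) (bigID good) /= -addrA gerDl subr_le0.
set z := t / (4 * B).
have z0 : 0 < z by rewrite divr_gt0 //; lra.
pose U (lam : R) j s := t * z < lam * (label_sum (a j) s - mean w (a j)).
apply: (@le_trans _ _ (\sum_j (\sum_(s | U z j s) weight w s
                             + \sum_(s | U (- z) j s) weight w s))).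
  rewrite big_split /= [X in _ <= X + _](exchange_big_dep xpredT) //=.
  rewrite [X in _ <= _ + X](exchange_big_dep xpredT) //= -big_split /=.
  rewrite big_mkcond /=; apply: ler_sum => s _.
  have p0 (P : pred J) : 0 <= \sum_(j | P j) weight w s.
    by apply: sumr_ge0 => j _; exact: weight_ge0.
  case: ifPn => [|_]; last by rewrite addr_ge0.
  rewrite /good negb_forall => /existsP[j]; rewrite -ltNge ltr_normr => /orP[h|h].
    rewrite (bigD1 j) /=; first by rewrite -addrA lerDl addr_ge0.
    by rewrite /U mulrC ltr_pM2l.
  rewrite addrC (bigD1 j) /=; first by rewrite -addrA lerDl addr_ge0.
  by rewrite /U mulrC mulNr -mulrN ltr_pM2l.
have -> : 2 * #|J|%:R * q = \sum_(j : J) (q + q).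
  by rewrite sumr_const -mulr_natl; ring.
apply: ler_sum => j _; apply: lerD.
  exact: upper_tail.
by apply: upper_tail => //; rewrite sqrrN.
Qed.

Lemma exists_concentrated (J : finType) w (a : J -> V -> L -> R) (B t : R) :
  (forall v l, 0 <= w v l) -> (forall v, \sum_l w v l = 1) ->
  (forall j v l, 0 <= a j v l <= 1) -> 0 < t <= 2 * B ->
  (forall j, mean w (a j) <= B) ->
  2 * #|J|%:R * expR (- (t ^+ 2 / (8 * B))) < 1 ->
  exists s, forall j, `|label_sum (a j) s - mean w (a j)| <= t.
Proof.
move=> w0 w1 a01 tB mB small.
case: (pickP (fun s => [forall j, `|label_sum (a j) s - mean w (a j)| <= t])) => [s /forallP|none].
  by exists s.
have := concentration w0 w1 a01 tB mB.
by rewrite big_pred0 //; lra.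
Qed.

End ProductMeasure.

(** * Spanning subgraphs of bounded degree *)

Section Potential.
Context {V : finType}.
Implicit Types (H F : rel V) (pr : nat -> int).

Lemma degree_sum F v : degree F v = (\sum_w F v w)%N.
Proof. by rewrite /degree -sum1_card big_mkcond /=; apply: eq_bigr => w _; rewrite inE; case: (F v w). Qed.

(** [pr k] is the gain from raising a degree from k to k + 1; the functions of the degrees are
    concave when [pr] is nonincreasing. *)
Definition potential pr (d : V -> nat) : int := \sum_v \sum_(k < d v) pr k.

Definition add_edge F (u v : V) : rel V :=
  [rel x y | F x y || ((x, y) \in [:: (u, v); (v, u)])].

Definition del_edge F (u v : V) : rel V :=
  [rel x y | F x y && ((x, y) \notin [:: (u, v); (v, u)])].

Lemma degree_add_edge F u v w : u != v -> ~~ F u v -> ~~ F v u ->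
  degree (add_edge F u v) w = (degree F w + (w == u) + (w == v))%N.
Proof.
move=> uv Fuv Fvu; rewrite !degree_sum -addnA.
have -> : ((w == u) + (w == v))%N = (\sum_z ((w, z) \in [:: (u, v); (v, u)]))%N.
  rewrite (eq_bigr (fun z => (w == u) * (z == v) + (w == v) * (z == u))%N); last first.
    move=> z _; rewrite !inE !xpair_eqE.
    by case: (eqVneq w u) => [->|_]; rewrite ?(negbTE uv) /=; case: (w == v); case: (z == v); case: (z == u).
  have one x : (\sum_(z : V) (z == x) = 1)%N.
    by rewrite (bigD1 x) //= eqxx big1 // => i /negbTE->.
  by rewrite big_split /= -!big_distrr /= !one !muln1.
rewrite -big_split /=; apply: eq_bigr => z _ /=.
rewrite /add_edge /= !inE !xpair_eqE; case: (boolP (_ && _ || _ && _)) => [|_]; last by rewrite orbF addn0.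
by case/orP => /andP[/eqP-> /eqP->]; rewrite ?(negbTE Fuv) ?(negbTE Fvu).
Qed.

Lemma potential_add pr (d d' : V -> nat) u v : u != v ->
  (forall w, d' w = (d w + (w == u) + (w == v))%N) ->
  potential pr d' = potential pr d + (pr (d u) + pr (d v)).
Proof.
move=> uv dE; rewrite /potential (bigD1 u) //= [in RHS](bigD1 u) //=.
rewrite (bigD1 v) /=; last by rewrite eq_sym.
rewrite [X in _ = _ + X + _](bigD1 v) /=; last by rewrite eq_sym.
rewrite !dE !eqxx (negbTE uv) eq_sym (negbTE uv) !addn0 !addn1 !big_ord_recr /=.
rewrite (eq_bigr (fun i => \sum_(k < d i) pr k)); last first.
  by move=> w /andP[wu wv]; rewrite dE (negbTE wu) (negbTE wv) !addn0.
by rewrite /=; ring.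
Qed.

Lemma exists_local_max H pr : symmetric H -> irreflexive H ->
  exists F : rel V, [/\ symmetric F, subrel F H,
    forall u v, H u v -> ~~ F u v -> pr (degree F u) + pr (degree F v) <= 0 &
    forall u v, F u v -> 0 <= pr (degree F u).-1 + pr (degree F v).-1].
Proof.
move=> Hs Hi.
(* Relations are encoded as sets of pairs, which form a finite type over which the potential has a
   maximiser. *)
pose rl (E : {set V * V}) : rel V := [rel x y | (x, y) \in E].
pose adm E := [forall x, forall y, (rl E x y == rl E y x) && (rl E x y ==> H x y)].
have admP E : reflect (symmetric (rl E) /\ subrel (rl E) H) (adm E).
  apply: (iffP forallP) => [h|[h1 h2] x].
    split=> x y; first by have /forallP/(_ y)/andP[/eqP] := h x.
    by have /forallP/(_ y)/andP[_ /implyP] := h x.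
  by apply/forallP => y; rewrite h1 eqxx; apply/implyP; rewrite h1; exact: h2.
have adm0 : adm set0 by apply/admP; split=> x y; rewrite /rl /= !inE.
pose Phi E := potential pr (degree (rl E)).
have rlK (F : rel V) : rl [set x | F x.1 x.2] =2 F by move=> x y; rewrite /rl /= inE.
have degK (F : rel V) : degree (rl [set x | F x.1 x.2]) =1 degree F.
  by move=> v; apply: eq_card => w; rewrite !inE rlK.
have [E /admP[Es EH] Emax] := @Order.TotalTheory.arg_maxP _ _ _ set0 adm Phi adm0.
have max_le F' : symmetric F' -> subrel F' H -> potential pr (degree F') <= Phi E.
  move=> F's F'H.
  have -> : potential pr (degree F') = Phi [set x | F' x.1 x.2].
    by apply: eq_bigr => v _; rewrite degK.
  by apply: Emax; apply/admP; split=> x y; rewrite !rlK //; exact: F'H.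
exists (rl E); split=> // u v.
  move=> Huv Euv.
  have uv : u != v by apply: contraTneq Huv => ->; rewrite Hi.
  have := max_le (add_edge (rl E) u v).
  rewrite (potential_add pr uv (fun w => degree_add_edge w uv Euv _)) ?(Es v u) //.
  rewrite /Phi gerDl; apply.
    move=> x y; rewrite /add_edge /= (Es x y); congr (_ || _).
    by rewrite !inE !xpair_eqE orbC; congr (_ || _); rewrite andbC.
  move=> x y /orP[/EH //|]; rewrite !inE !xpair_eqE.
  by case/orP=> /andP[/eqP-> /eqP->] //; rewrite Hs.
move=> Euv.
have uv : u != v by apply: contraTneq (EH _ _ Euv) => ->; rewrite Hi.
set F' := del_edge (rl E) u v.
have F'uv : ~~ F' u v by rewrite /F' /del_edge /= !inE eqxx /= andbF.
have F's : symmetric F'.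
  move=> x y; rewrite /F' /del_edge /= (Es x y); congr (_ && ~~ _).
  by rewrite !inE !xpair_eqE orbC; congr (_ || _); rewrite andbC.
have dE w : degree (rl E) w = (degree F' w + (w == u) + (w == v))%N.
  rewrite -(degree_add_edge w uv F'uv); last by rewrite F's.
  apply: eq_card => z; rewrite !inE /F' /add_edge /del_edge /=.
  rewrite !inE !xpair_eqE.
  have Evu : rl E v u by rewrite Es.
  case: (boolP (_ && _ || _ && _)) => [|_]; last by rewrite andbT orbF.
  by case/orP => /andP[/eqP-> /eqP->]; rewrite ?Euv ?Evu orbT.
have := max_le F' F's.
rewrite /Phi (potential_add pr uv dE) lerDl !dE !eqxx (negbTE uv) eq_sym (negbTE uv).
rewrite !addn0 !addn1 /=; apply.
by move=> x y /andP[/EH].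
Qed.

(* Equal to [T] up to [k = b - 2 T], then decreasing with slope -1 to [- T] at
   [k = b]: maximisers of the potential have degrees at most [b + 1], and a price
   below [T] certifies a degree above [b - 2 T]. *)
Definition price (T b : nat) (k : nat) : int := Order.min T%:Z (b%:Z - T%:Z - k%:Z).

Lemma priceP T b k :
  (price T b k = T%:Z /\ T%:Z <= b%:Z - T%:Z - k%:Z) \/
  (price T b k = b%:Z - T%:Z - k%:Z /\ b%:Z - T%:Z - k%:Z <= T%:Z).
Proof. by rewrite /price; case: leP => h; [left|right]; split=> //; exact: ltW. Qed.

(** A price changes by at most 1 per edge, so optimality under deletion gives p u + p v >= -2 on
    [F]; summed over ordered edges, the sum of d(v) p(v) is at least minus the sum of d(v). A vertex
    with p v < T has degree above b - 2T, hence (b - 2T)(T - p v) <= d(v)(T - p v), and summation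
    gives the last inequality. *)
Lemma exists_capped_subgraph H (T b : nat) : symmetric H -> irreflexive H -> (2 * T <= b)%N ->
  exists F : rel V, let p v := price T b (degree F v) in
  [/\ symmetric F, subrel F H, forall v, (degree F v <= b.+1)%N,
    forall v, - T%:Z - 1 <= p v <= T%:Z &
    forall u v, H u v -> ~~ F u v -> p u + p v <= 0] /\
    (b%:Z - 2 * T%:Z) * (T%:Z * #|V|%:Z - \sum_v p v) <= (T%:Z + 1) * \sum_v (degree F v)%:Z.
Proof.
move=> Hs Hi Tb; have [F [Fs FH Fadd Fdel]] := exists_local_max (price T b) Hs Hi.
have pT k : price T b k <= T%:Z by case: (priceP T b k) => -[-> ?]; lia.
have Fb v : (degree F v <= b.+1)%N.
  case: (posnP (degree F v)) => [->//|dv].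
  have /set0Pn[w] : [set w | F v w] != set0 by rewrite -card_gt0.
  rewrite inE => /Fdel; have := pT (degree F w).-1.
  case: (priceP T b (degree F v).-1) (priceP T b (degree F w).-1) => -[-> ?] [] [-> ?]; lia.
exists F => p; split; first (split=> //).
  by move=> v; have := Fb v; rewrite /p; case: (priceP T b (degree F v)) => -[-> ?]; lia.
set D := \sum_v (degree F v)%:Z.
have pF : - D <= \sum_v (degree F v)%:Z * p v.
  have dE (f : V -> int) : \sum_v (degree F v)%:Z * f v = \sum_v \sum_(w | F v w) f v.
    by apply: eq_bigr => v _; rewrite sumr_const -mulr_natl /degree cardsE natz.
  have swap : \sum_v \sum_(w | F v w) p v = \sum_v \sum_(w | F v w) p w.
    rewrite (exchange_big_dep xpredT) //=; apply: eq_bigr => v _.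
    by apply: eq_bigl => w; rewrite Fs.
  have h : \sum_v \sum_(w | F v w) (-2) <= \sum_v \sum_(w | F v w) (p v + p w).
    apply: ler_sum => v _; apply: ler_sum => w /Fdel.
    rewrite /p; case: (priceP T b (degree F v)) => -[-> ?];
    case: (priceP T b (degree F w)) => -[-> ?];
    case: (priceP T b (degree F v).-1) => -[-> ?];
    case: (priceP T b (degree F w).-1) => -[-> ?]; lia.
  have h2 : \sum_v \sum_(w | F v w) (p v + p w) = 2 * \sum_v (degree F v)%:Z * p v.
    under eq_bigr => v _ do rewrite big_split /=.
    by rewrite big_split /= -swap dE; ring.
  have h3 : \sum_v \sum_(w | F v w) (-2) = - (2 * D) :> int.
    by rewrite -dE -mulr_suml; ring.
  by move: h; rewrite h2 h3; lia.
have sumE : T%:Z * #|V|%:Z - \sum_v p v = \sum_v (T%:Z - p v).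
  by rewrite big_split /= sumr_const sumrN -mulr_natr natz.
rewrite sumE mulr_sumr.
apply: (@le_trans _ _ (\sum_v (degree F v)%:Z * (T%:Z - p v))).
  apply: ler_sum => v _; have := Fb v; rewrite /p => h.
  by case: (priceP T b (degree F v)) => -[-> ?]; nia.
under eq_bigr => v _ do rewrite mulrBr.
rewrite big_split /= sumrN -mulr_suml -/D.
by rewrite mulrDl mul1r [T%:Z * D]mulrC lerD2l lerNl.
Qed.

End Potential.

(** Layer-cake formula for [p] clipped to [-T, T]. *)
Lemma clip_sum (T : nat) (p : int) :
  \sum_(t < T) ((t.+1%:Z <= p)%R%:R - (p <= - t.+1%:Z)%R%:R) =
  (if T%:Z <= p then T%:Z else if p <= - T%:Z then - T%:Z else p) :> int.
Proof.
elim: T => [|T IH].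
  by rewrite big_ord0; case: ifP => // h; case: ifP => // h'; lia.
rewrite big_ord_recr /= IH.
case: (leP T.+1%:Z p) => h1; case: (leP p (- T.+1%:Z)) => h2;
  case: (leP T%:Z p) => h3; case: (leP p (- T%:Z)) => h4 /=; lia.
Qed.

(* The level set [t < p] sends its edges of [H] outside [F] into [p < - t], and
   each of its vertices outside [bad] has at least [a * D] of them; as the two
   sets are disjoint, their sizes differ by at most [(1 - a) / (1 + a) * #|V|]. *)
Lemma cover_bound (R : realFieldType) (V : finType) (G H F : rel V) (p : V -> int)
    (T : nat) (a D z : R) (bad : {set V}) :
  symmetric G -> subrel H G -> 0 <= a <= 1 -> 0 < D ->
  (forall v, - T%:Z - 1 <= p v <= T%:Z) ->
  (forall u v, H u v -> ~~ F u v -> p u + p v <= 0) ->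
  (forall u, u \notin bad -> a * D <= (degree H u)%:R - (degree F u)%:R) ->
  (forall v, (degree G v)%:R <= D) ->
  #|bad|%:R <= z * #|V|%:R ->
  (\sum_v p v)%:~R <= T%:R * (((1 - a) / (1 + a) + 2 * z) * #|V|%:R).
Proof.
move=> Gs HG /andP[a0 a1] D0 pT cover Hdeg Gdeg badz.
pose S (t : nat) := [set v | t.+1%:Z <= p v].
pose W (t : nat) := [set v | p v <= - t.+1%:Z].
have key t : a * (#|S t|%:R - #|bad|%:R) <= #|W t|%:R.
  rewrite -(ler_pM2r D0).
  apply: (@le_trans _ _ (\sum_(w in W t) (degree G w)%:R)); last first.
    by rewrite mulr_natl -sumr_const; apply: ler_sum.
  apply: (@le_trans _ _ (\sum_(u in S t :\: bad) \sum_(w in W t) (G w u)%:R)); last first.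
    rewrite exchange_big /=; apply: ler_sum => w _.
    rewrite degree_sum natr_sum [leRHS](bigID (mem (S t :\: bad))) /= lerDl.
    by apply: sumr_ge0.
  apply: (@le_trans _ _ (\sum_(u in S t :\: bad) a * D)).
    rewrite sumr_const mulrAC -[leRHS]mulr_natr ler_wpM2l ?mulr_ge0 ?(ltW D0) //.
    rewrite lerBlDr -natrD ler_nat -(cardsID bad (S t)) addnC leq_add2l.
    by rewrite subset_leq_card ?subsetIr.
  apply: ler_sum => u; rewrite inE => /andP[/Hdeg uH uS]; apply: (le_trans uH).
  rewrite !degree_sum !natr_sum -sumrB.
  rewrite [leRHS]big_mkcond /=; apply: ler_sum => w _.
  rewrite (Gs w u).
  case: (boolP (H u w)) => Huw; last first.
    by apply: (@le_trans _ _ 0); [rewrite sub0r oppr_le0|case: ifP].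
  rewrite (HG _ _ Huw).
  case: (boolP (F u w)) => Fuw; first by rewrite subrr; case: ifP.
  rewrite subr0 [w \in _]inE; have := cover _ _ Huw Fuw; move: uS; rewrite inE => h1 h2.
  by rewrite ifT //; lia.
have disj t : #|S t|%:R + #|W t|%:R <= #|V|%:R :> R.
  rewrite -natrD ler_nat -cardsUI -[leqRHS]addn0 leq_add ?max_card //.
  rewrite leqn0 cards_eq0 -subset0; apply/subsetP => v; rewrite !inE; lia.
have key2 t : #|S t|%:R - #|W t|%:R <= ((1 - a) / (1 + a) + 2 * z) * #|V|%:R.
  have := key t; have := disj t; move: badz.
  set s := #|S t|%:R; set w := #|W t|%:R; set n := #|V|%:R; set b := #|bad|%:R.
  have b0 : 0 <= b by exact: ler0n.
  move=> h1 h2 h3.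
  have a10 : 0 < 1 + a by lra.
  rewrite mulrDl mulrAC.
  have h4 : s * (1 + a) <= n + b by nra.
  have h5 : s <= (n + b) / (1 + a) by rewrite ler_pdivlMr.
  have h6 : (1 - a) * s <= (1 - a) * ((n + b) / (1 + a)) by apply: ler_wpM2l => //; lra.
  have h7 : (1 - a) * ((n + b) / (1 + a)) <= (1 - a) * n / (1 + a) + b.
    rewrite mulrA ler_pdivrMr // [leRHS]mulrDl mulfVK ?gt_eqF //; nra.
  nra.
apply: (@le_trans _ _ (\sum_(t < T) (#|S t|%:R - #|W t|%:R))); last first.
  by rewrite mulr_natl -[X in _ *+ X]card_ord -sumr_const; apply: ler_sum.
have -> : \sum_(t < T) (#|S t|%:R - #|W t|%:R) =
  (\sum_v \sum_(t < T) ((t.+1%:Z <= p v)%R%:R - (p v <= - t.+1%:Z)%R%:R))%:~R :> R.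
  rewrite exchange_big rmorph_sum /=; apply: eq_bigr => t _.
  rewrite big_split /= sumrN rmorphB /=; congr (_ - _).
    by rewrite -sum1_card natr_sum rmorph_sum big_mkcond /=; apply: eq_bigr => v _; rewrite inE; case: ifP.
  by rewrite -sum1_card natr_sum rmorph_sum big_mkcond /=; apply: eq_bigr => v _; rewrite inE; case: ifP.
(* The lowest possible value -T - 1 is clipped to -T, which only increases the sum. *)
rewrite ler_int; apply: ler_sum => v _; rewrite clip_sum.
have := pT v; case: ifP => h1; first lia.
case: ifP => h2; lia.
Qed.

(** * Matchings *)

Section Hall.
Context {T1 T2 : finType}.
Variable e : T1 -> T2 -> bool.

Definition nbhd (B : {set T2}) (S : {set T1}) : {set T2} :=
  [set y in B | [exists x in S, e x y]].

Lemma nbhdP (B : {set T2}) (S : {set T1}) y :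
  reflect (y \in B /\ exists2 x, x \in S & e x y) (y \in nbhd B S).
Proof.
rewrite inE; apply: (iffP andP) => -[yB].
  by case/existsP=> x /andP[xS exy]; split=> //; exists x.
by case=> x xS exy; split=> //; apply/existsP; exists x; rewrite xS.
Qed.

(** Induction on [#|A|]. If a nonempty proper subset S is tight, S is matched into its neighbourhood
    and the rest of A outside it. Otherwise every nonempty proper subset has a neighbour to spare,
    so a vertex [x0] and any neighbour of it can be matched and removed. [y0] is a default value. *)
Lemma hall (y0 : T2) (A : {set T1}) (B : {set T2}) :
  (forall S : {set T1}, S \subset A -> (#|S| <= #|nbhd B S|)%N) ->
  exists f : T1 -> T2, {in A, forall x, e x (f x) && (f x \in B)} /\ {in A &, injective f}.
Proof.
move: {2}#|A|.+1 (ltnSn #|A|) => n; elim: n A B => // n IH A B; rewrite ltnS => An hallA.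
have [->|[x0 x0A]] := set_0Vmem A.
  by exists (fun=> y0); split=> [x|x y]; rewrite inE.
case: (pickP (fun S : {set T1} => [&& S \proper A, S != set0 & #|nbhd B S| == #|S|])) =>
    [S /and3P[SA S0 /eqP tight]|notight].
  have SsA := proper_sub SA.
  have [f1 [f1e f1i]] : exists f : T1 -> T2,
      {in S, forall x, e x (f x) && (f x \in B)} /\ {in S &, injective f}.
    apply: IH => [|S' S'S]; first exact: leq_trans (proper_card SA) An.
    by apply: hallA; exact: subset_trans SsA.
  have [f2 [f2e f2i]] : exists f : T1 -> T2,
      {in A :\: S, forall x, e x (f x) && (f x \in B :\: nbhd B S)} /\
      {in A :\: S &, injective f}.
    apply: IH => [|S' S'AS].
      apply: leq_trans An; apply: proper_card; rewrite properE subsetDl /=.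
      apply: contra S0 => /subsetDP[_ dAS]; rewrite -subset0.
      by move: dAS; rewrite -setI_eq0 (setIidPr SsA) => /eqP->.
    have /andP[S'A dS'S] : (S' \subset A) && [disjoint S' & S] by rewrite -subsetD.
    have := hallA (S' :|: S); rewrite subUset S'A SsA => /(_ isT).
    rewrite cardsU (disjoint_setI0 dS'S) cards0 subn0.
    have -> : nbhd B (S' :|: S) = nbhd (B :\: nbhd B S) S' :|: nbhd B S.
      apply/setP => y; rewrite in_setU.
      apply/nbhdP/orP => [[yB [x]]|].
        rewrite in_setU => /orP[xS|xS] exy.
          case: (boolP (y \in nbhd B S)) => yN; [by right|left].
          by apply/nbhdP; rewrite in_setD yN yB; split=> //; exists x.
        by right; apply/nbhdP; split=> //; exists x.
      by case=> /nbhdP[]; [rewrite in_setD => /andP[_ yB]|move=> yB] => -[x xS exy];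
        split=> //; exists x; rewrite // in_setU xS ?orbT.
    move/leq_trans/(_ (leq_card_setU _ _).1); rewrite tight leq_add2r //.
  exists (fun x => if x \in S then f1 x else f2 x); split=> [x xA|x y xA yA].
    case: ifPn => xS; first exact: f1e.
    have := f2e x; rewrite !inE xS xA => /(_ isT) /andP[-> /andP[_ ->]] //.
  have crossed z z' : z \in S -> z' \in A -> z' \notin S -> f1 z = f2 z' -> False.
    move=> zS z'A z'S E; have := f2e z'; rewrite !inE z'S z'A => /(_ isT).
    case/and3P=> _; rewrite negb_and -E.
    have /andP[ez zB] := f1e _ zS; rewrite zB /=.
    by case/negP; apply/existsP; exists z; rewrite zS.
  case: ifPn => xS; case: ifPn => yS E.
  - exact: f1i.
  - by case: (crossed x y).
  - by case: (crossed y x).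
  - by apply: f2i => //; rewrite inE ?xS ?yS.
have /set0Pn[y /nbhdP[yB [x]]] : nbhd B [set x0] != set0.
  by rewrite -card_gt0 (leq_trans _ (hallA [set x0] _)) ?cards1 ?sub1set.
rewrite inE => /eqP-> ex0y {x}.
have [f [fe fi]] : exists f : T1 -> T2,
    {in A :\ x0, forall x, e x (f x) && (f x \in B :\ y)} /\ {in A :\ x0 &, injective f}.
  apply: IH => [|S SA]; first by apply: leq_trans An; rewrite [X in (_ < X)%N](cardsD1 x0) x0A.
  have [->|S0] := eqVneq S set0; first by rewrite cards0.
  have SpA : S \proper A.
    by apply: (sub_proper_trans SA); rewrite properD1.
  have := notight S; rewrite SpA S0 /= => /negbT neq.
  have lt : (#|S| < #|nbhd B S|)%N by rewrite ltn_neqAle eq_sym neq hallA // proper_sub.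
  have sub : nbhd B S :\ y \subset nbhd (B :\ y) S.
    apply/subsetP => z; rewrite in_setD1 => /andP[zy /nbhdP[zB hz]].
    by apply/nbhdP; rewrite in_setD1 zy.
  apply: leq_trans (subset_leq_card sub).
  by move: lt; rewrite (cardsD1 y); case: (y \in _) => //=; rewrite ?add1n ?add0n // => /ltnW.
exists (fun x => if x == x0 then y else f x); split=> [x xA|x z xA zA].
  case: eqP => [->|/eqP xx0]; first by rewrite ex0y.
  by have := fe x; rewrite !inE xx0 xA => /(_ isT) /andP[-> /andP[_ ->]].
have crossed u : u \in A -> u != x0 -> y = f u -> False.
  by move=> uA ux0 E; have := fe u; rewrite !inE ux0 uA -E eqxx /= andbF => /(_ isT).
case: eqP => [->|/eqP xx0]; case: eqP => [->|/eqP zx0] // E.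
- by case: (crossed z).
- by case: (crossed x).
- by apply: fi => //; rewrite !inE ?xx0 ?zx0.
Qed.

End Hall.

(** The fractional matching g / c is rounded to an integral one that is at least as large. All the
    weight lies in the rows outside S or in the columns of its neighbourhood N(S), so it is at most
    c (|A| - |S| + |N(S)|); the deficiency form of Hall's theorem attains the least of these
    bounds. *)
Lemma weighted_matching (R : realFieldType) (T : finType) (A B : {set T})
    (e : T -> T -> bool) (g : T -> T -> R) (c : R) :
  0 < c -> (forall u v, 0 <= g u v) -> (forall u v, g u v != 0 -> e u v) ->
  (forall u, u \in A -> \sum_(v in B) g u v <= c) ->
  (forall v, v \in B -> \sum_(u in A) g u v <= c) ->
  exists (D : {set T}) (f : T -> T),
    [/\ D \subset A, {in D, forall x, e x (f x) && (f x \in B)},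
        {in D &, injective f} &
        \sum_(u in A) \sum_(v in B) g u v <= c * #|D|%:R].
Proof.
move=> c0 g0 ge rows cols.
have [->|[a0 a0A]] := set_0Vmem A.
  by exists set0, id; split; rewrite ?sub0set // ?cards0 ?mulr0 ?big_set0 // => x; rewrite inE.
set W := \sum_(u in A) _.
have bound (S : {set T}) : S \subset A -> W <= c * (#|A|%:R - #|S|%:R + #|nbhd e B S|%:R).
  move=> SA; rewrite /W (big_setID S) /= (setIidPr SA) addrC mulrDr lerD //.
    rewrite -natrB ?subset_leq_card // -(cardsDS SA).
    rewrite mulr_natr -sumr_const; apply: ler_sum => u; rewrite inE => /andP[_ uA].
    exact: rows.
  rewrite exchange_big /= (big_setID (nbhd e B S)) /=.
  have NB : nbhd e B S \subset B by apply/subsetP => y /nbhdP[].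
  rewrite (setIidPr NB) [X in _ + X]big1 ?addr0; last first.
    move=> v; rewrite inE => /andP[vN vB]; apply: big1 => u uS; apply/eqP.
    by apply: contraNT vN => /ge euv; apply/nbhdP; split=> //; exists u.
  rewrite mulr_natr -sumr_const; apply: ler_sum => v /(subsetP NB) vB.
  apply: le_trans (cols v vB); rewrite [leRHS](big_setID S) /= (setIidPr SA) lerDl.
  by apply: sumr_ge0.
pose def := (\max_(S in powerset A) (#|S| - #|nbhd e B S|))%N.
have defE (S : {set T}) : S \subset A -> (#|S| <= #|nbhd e B S| + def)%N.
  move=> SA; rewrite -leq_subLR.
  by rewrite /def (bigD1 S) ?powersetE //= leq_maxl.
have defW : W <= c * (#|A|%:R - def%:R).
  have [|S] := @eq_bigmax_cond _ (mem (powerset A)) (fun S : {set T} => (#|S| - #|nbhd e B S|)%N).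
    by apply/card_gt0P; exists set0; rewrite powersetE sub0set.
  rewrite powersetE -/def => SA defS.
  case: (leqP #|S| #|nbhd e B S|) => h.
    have -> : def = 0%N by rewrite defS; apply/eqP.
    apply: (le_trans (bound _ (sub0set A))).
    have -> : nbhd e B set0 = set0.
      by apply/setP => y; rewrite in_set0; apply/negP => /nbhdP[_ [x]]; rewrite inE.
    by rewrite cards0 subr0 addr0.
  apply: (le_trans (bound S SA)); rewrite (ler_wpM2l (ltW c0)) //.
  rewrite defS natrB; last exact: ltnW.
  lra.
(* [def] extra vertices adjacent to everything absorb the deficiency; a vertex matched to one of
   them is left out of D. *)
pose e' (x : T) (y : T + 'I_def) := if y is inl z then e x z else true.
pose B' : {set T + 'I_def} := [set y | if y is inl z then z \in B else true].
have [S SA|f' [f'e f'i]] := @hall _ _ e' (inl a0) A B'.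
  have [->|[s0 s0S]] := set_0Vmem S; first by rewrite cards0.
  apply: (leq_trans (defE S SA)).
  have <- : #|(inl @: nbhd e B S : {set T + 'I_def}) :|: inr @: [set: 'I_def]| = (#|nbhd e B S| + def)%N.
    rewrite cardsU !card_imset //; try by move=> ? ? [].
    have -> : (inl @: nbhd e B S : {set T + 'I_def}) :&: inr @: [set: 'I_def] = set0.
      by apply/setP => y; rewrite !inE; apply/negbTE/negP => /andP[/imsetP[z _ ->] /imsetP[? _]].
    by rewrite cards0 subn0 cardsT card_ord.
  apply: subset_leq_card; apply/subsetP => y; rewrite inE => /orP[|] /imsetP[z hz ->].
    by case/nbhdP: hz => zB hz; apply/nbhdP; rewrite inE.
  by apply/nbhdP; rewrite inE; split=> //; exists s0.
pose D := [set x in A | if f' x is inl _ then true else false].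
pose f x := if f' x is inl z then z else a0.
exists D, f; split.
- by apply/subsetP => x; rewrite inE => /andP[].
- move=> x; rewrite inE /f => /andP[/f'e]; case: (f' x) => // z.
  by rewrite inE.
- move=> x y; rewrite !inE /f => /andP[xA hx] /andP[yA hy] E; apply: f'i => //.
  by case: (f' x) hx E => // ?; case: (f' y) hy => // ? _ _ ->.
- apply: (le_trans defW); rewrite (ler_wpM2l (ltW c0)) // lerBlDr -natrD ler_nat.
  rewrite -(cardsID D A) (setIidPr _); last by apply/subsetP => x; rewrite inE => /andP[].
  rewrite leq_add2l.
  have f'iD : {in A :\: D &, injective f'} by move=> x y /setDP[xA _] /setDP[yA _]; exact: f'i.
  rewrite -(card_in_imset f'iD) -[leqRHS]card_ord -(card_imset predT (@inr_inj T 'I_def)).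
  apply: subset_leq_card; apply/subsetP => y /imsetP[x]; rewrite !inE => /andP[hx xA] ->.
  by move: hx; rewrite xA; case: (f' x) => // o _; apply/imsetP; exists o.
Qed.

(** * Random labels and disjoint paths *)

Section SingleLabel.
Context {R : realType} {V L : finType}.
Implicit Types (P : pred V) (g : V -> R) (l : L).

Definition on_label P l g (v : V) (l' : L) : R := if P v && (l' == l) then g v else 0.

Lemma label_sum_on_label P l g (s : {ffun V -> L}) :
  label_sum (on_label P l g) s = \sum_(v | P v && (s v == l)) g v.
Proof. by rewrite /label_sum /on_label -big_mkcond. Qed.

Lemma mean_on_label (w : V -> L -> R) P l g :
  mean w (on_label P l g) = \sum_(v | P v) w v l * g v.
Proof.
rewrite /mean [RHS]big_mkcond /=; apply: eq_bigr => v _; rewrite /on_label.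
case: ifP => Pv /=; last by rewrite big1 // => l' _; rewrite mulr0.
rewrite (bigD1 l) //= eqxx big1 ?addr0 // => l' /negbTE->; exact: mulr0.
Qed.

Lemma on_label_01 P l g v l' : (forall v, 0 <= g v <= 1) -> 0 <= on_label P l g v l' <= 1.
Proof. by move=> h; rewrite /on_label; case: ifP => // _; rewrite lexx ler01. Qed.

End SingleLabel.

Section Labelling.
Context {R : realType} {V C : finType}.
Variables (cell : V -> C) (O : rel C) (F H : rel V) (b M k : nat) (m mu th : R).
Let K := k.*2.+1.
Hypotheses (FH : subrel F H) (Fsym : symmetric F) (Osym : symmetric O)
  (HO : forall u w, H u w -> O (cell u) (cell w)).
Hypotheses (b0 : (0 < b)%N) (Fb : forall v, (degree F v <= b)%N)
  (OM : forall c, (#|[set a | O c a]| <= M)%N) (M0 : (0 < M)%N).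
Hypotheses (mu0 : 0 < mu) (th0 : 0 < th) (th1 : 2 * th <= 1).

Definition share (u : V) (c : C) : R := #|[set w | F u w & cell w == c]|%:R / b%:R.
(* [pair_label c i]: layer [i] of the paths between the own cell and [c];
   [reserve _]: one of two sets of connecting vertices; last summand: unused. *)
Definition label : finType := (C * 'I_K + bool + unit)%type.
Definition pair_label (c : C) (i : 'I_K) : label := inl (inl (c, i)).
Definition reserve (i : bool) : label := inl (inr i).
(** Normalisation: with [sum_raw], the pair labels get total probability at most 1 - 2 th, and the
    remaining mass goes to the last summand of [label]. *)
Definition omega : R := (1 - 2 * th) / (1 + mu * M%:R).
(** The added [mu] keeps the weights away from 0, so that they can be divided out by [thin] and
    leave room for the concentration errors. *)
Definition raw (u : V) (c : C) : R := if O (cell u) c then share u c + mu else 0.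
Definition law (u : V) (l : label) : R :=
  match l with
  | inl (inl (c, _)) => omega / K%:R * raw u c
  | inl (inr _) => th
  | inr _ => 1 - 2 * th - omega * \sum_c raw u c
  end.

Lemma share_ge0 u c : 0 <= share u c.
Proof. by rewrite divr_ge0. Qed.

Lemma FO u w : F u w -> O (cell u) (cell w).
Proof. by move/FH/HO. Qed.

Lemma sum_share u : \sum_(c | O (cell u) c) share u c = (degree F u)%:R / b%:R.
Proof.
rewrite -mulr_suml -natr_sum; congr (_%:R / _).
rewrite /degree -[RHS]sum1_card (partition_big cell (fun c => O (cell u) c)) /=; last first.
  by move=> w; rewrite inE => /FO.
by apply: eq_bigr => c _; rewrite -sum1_card; apply: eq_bigl => w; rewrite !inE.
Qed.

Lemma sum_raw u : \sum_c raw u c <= 1 + mu * M%:R.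
Proof.
rewrite /raw -big_mkcond big_split /= sum_share lerD //.
  by rewrite ler_pdivrMr ?ltr0n // mul1r ler_nat.
rewrite sumr_const -[leLHS]mulr_natr ler_wpM2l ?(ltW mu0) // ler_nat.
by have := OM (cell u); rewrite cardsE.
Qed.

Lemma omega_ge0 : 0 <= omega.
Proof.
have h : 0 <= mu * M%:R by rewrite mulr_ge0 ?(ltW mu0).
by apply: divr_ge0; [rewrite subr_ge0|rewrite addr_ge0].
Qed.

Lemma omega_le1 : omega * (1 + mu * M%:R) <= 1.
Proof.
have h : 0 <= mu * M%:R by rewrite mulr_ge0 ?(ltW mu0).
rewrite /omega mulfVK; first by rewrite gerBl mulr_ge0 ?(ltW th0).
by rewrite gt_eqF //; lra.
Qed.

Lemma omega_le1' : omega <= 1.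
Proof.
apply: le_trans omega_le1; rewrite ler_peMr ?omega_ge0 //.
by rewrite lerDl mulr_ge0 ?(ltW mu0).
Qed.

Lemma raw_ge0 u c : 0 <= raw u c.
Proof. by rewrite /raw; case: ifP => // _; rewrite addr_ge0 ?share_ge0 ?(ltW mu0). Qed.

Lemma law_ge0 u l : 0 <= law u l.
Proof.
case: l => [[[c i]|_]|_] /=.
- by rewrite mulr_ge0 ?raw_ge0 // divr_ge0 // omega_ge0.
- exact: ltW.
- rewrite subr_ge0; apply: (le_trans (ler_wpM2l omega_ge0 (sum_raw u))).
  have h : 0 <= mu * M%:R by rewrite mulr_ge0 ?(ltW mu0).
  by rewrite /omega mulfVK // gt_eqF //; lra.
Qed.

Lemma law_sum u : \sum_l law u l = 1.
Proof.
rewrite big_sumType /= big_sumType /= big_bool /=.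
rewrite (big_pred1 tt) /=; last by case.
have -> : \sum_(p : C * 'I_K) law u (inl (inl p)) = omega * \sum_c raw u c.
  rewrite (eq_bigr (fun p => omega / K%:R * raw u p.1)); last by case.
  rewrite -(pair_bigA _ (fun c (_ : 'I_K) => omega / K%:R * raw u c)) /= mulr_sumr; apply: eq_bigr => c _; rewrite sumr_const card_ord -[LHS]mulr_natr.
  by rewrite mulrAC mulfVK // pnatr_eq0.
by ring.
Qed.

Lemma law_le1 u l : law u l <= 1.
Proof.
rewrite -(law_sum u) (bigD1 l) //= lerDl; apply: sumr_ge0 => l' _; exact: law_ge0.
Qed.

(* Weighting an edge [u v] of [F] by [thin] at both ends makes the expected
   weighted degrees in a label class the same at every vertex, up to [mu]. *)
Definition thin (u : V) (c : C) : R := mu / (share u c + mu).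

Lemma share_mu_gt0 u c : 0 < share u c + mu.
Proof. by rewrite ltr_wpDl ?share_ge0. Qed.

Lemma thin_01 u c : 0 <= thin u c <= 1.
Proof.
have h := share_mu_gt0 u c; rewrite divr_ge0 ?(ltW h) ?(ltW mu0) //=.
by rewrite ler_pdivrMr // mul1r lerDr share_ge0.
Qed.

Lemma raw_thin u c : raw u c * thin u c = if O (cell u) c then mu else 0.
Proof.
rewrite /raw /thin; case: ifP => _; last by rewrite mul0r.
by rewrite mulrCA mulfV ?mulr1 // gt_eqF // share_mu_gt0.
Qed.

(** Indexes the statistics under one union bound: thinned degrees into a label class, thinned and
    plain sizes of a class, common neighbours in one reserve, and vertices of a box in the other. *)
Definition event : finType := ((V * C * 'I_K + (C * C * 'I_K) * bool) + (V * V + C))%type.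

Definition event_law (j : event) : V -> label -> R :=
  match j with
  | inl (inl (u, c, i)) =>
      on_label (fun v => F u v && (cell v == c)) (pair_label (cell u) i) (fun v => thin v (cell u))
  | inl (inr (c, c', i, true)) => on_label (fun v => cell v == c) (pair_label c' i) (fun v => thin v c')
  | inl (inr (c, c', i, false)) => on_label (fun v => cell v == c) (pair_label c' i) (fun=> 1)
  | inr (inl (u, w)) => on_label (fun v => H u v && H w v) (reserve true) (fun=> 1)
  | inr (inr c) => on_label (fun v => cell v == c) (reserve false) (fun=> 1)
  end.

Lemma card_event : #|event| = (#|V| * #|C| * K + #|C| * #|C| * K * 2 + (#|V| * #|V| + #|C|))%N.
Proof. by rewrite !card_sum !card_prod card_bool card_ord. Qed.

Lemma event_law_01 j v l : 0 <= event_law j v l <= 1.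
Proof.
case: j => [[[[u c] i]|[[[c c'] i] []]]|[[u w]|c]]; apply: on_label_01 => z;
  by rewrite ?thin_01 // ler01 lexx.
Qed.

Hypothesis (cellm : forall c, #|[set u | cell u == c]|%:R <= 2 * m) (m0 : 0 < m).

(** Each statistic counts vertices of one box or neighbours in [H] of one vertex, and the latter lie
    in at most M boxes. *)
Lemma mean_event_le j : mean law (event_law j) <= 2 * m * M%:R.
Proof.
have one (P : pred V) l (g : V -> R) : (forall v, 0 <= g v <= 1) ->
    mean law (on_label P l g) <= #|[set v | P v]|%:R.
  move=> g01; rewrite mean_on_label cardsE -sum1_card natr_sum; apply: ler_sum => v _.
  have /andP[h0 h1] := g01 v; rewrite -[1%:R]mulr1; apply: ler_pM => //; first exact: law_ge0.
  exact: law_le1.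
have cM c : #|[set u | cell u == c]|%:R <= 2 * m * M%:R.
  apply: (le_trans (cellm c)); rewrite ler_peMr ?ler1n //.
  by rewrite mulr_ge0 ?(ltW m0).
have sub (A B : {set V}) : A \subset B -> #|B|%:R <= 2 * m * M%:R -> #|A|%:R <= 2 * m * M%:R.
  by move=> AB; apply: le_trans; rewrite ler_nat subset_leq_card.
case: j => [[[[u c] i]|[[[c c'] i] []]]|[[u w]|c]]; apply: (le_trans (one _ _ _ _));
  rewrite ?ler01 ?lexx //; try by move=> z; rewrite ?thin_01 // ler01 lexx.
  by apply: sub (cM c); apply/subsetP => v; rewrite !inE => /andP[].
apply: (@le_trans _ _ (\sum_(c | O (cell u) c) #|[set v | cell v == c]|%:R)).
  rewrite -natr_sum ler_nat.
  rewrite -[X in (X <= _)%N]sum1_card (partition_big cell (fun c => O (cell u) c)) /=; last first.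
    by move=> v; rewrite inE => /andP[/HO].
  apply: leq_sum => c _; rewrite -sum1_card big_mkcond [X in (_ <= X)%N]big_mkcond /=.
  by apply: leq_sum => v _; rewrite !inE; case: (cell v == c); rewrite ?andbF //; case: ifP.
apply: (@le_trans _ _ (\sum_(c | O (cell u) c) 2 * m)); first by apply: ler_sum.
rewrite sumr_const -[leLHS]mulr_natr ler_wpM2l ?mulr_ge0 ?(ltW m0) // ler_nat.
by have := OM (cell u); rewrite cardsE.
Qed.

(** In the first estimate, a neighbour v of u gets the label (cell u, i) with probability
    proportional to share + mu; the factor [thin] turns this into the constant omega/K mu, so the
    mean depends only on the number of neighbours. *)
Lemma good_labelling (t : R) : 0 < t <= 4 * m * M%:R ->
  2 * #|event|%:R * expR (- (t ^+ 2 / (16 * m * M%:R))) < 1 ->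
  exists s : {ffun V -> label},
  [/\ forall u c i, `|\sum_(v | F u v && (cell v == c) && (s v == pair_label (cell u) i)) thin v (cell u)
         - omega / K%:R * mu * (b%:R * share u c)| <= t,
      forall c c' i, \sum_(v | (cell v == c) && (s v == pair_label c' i)) thin v c'
         <= omega / K%:R * mu * #|[set v | cell v == c]|%:R + t,
      forall c c' i, O c c' -> `|#|[set v | (cell v == c) && (s v == pair_label c' i)]|%:R
         - omega / K%:R * \sum_(v | cell v == c) (share v c' + mu)| <= t,
      forall u w, th * #|[set v | H u v && H w v]|%:R - t
         <= #|[set v | H u v && H w v && (s v == reserve true)]|%:R &
      forall c, th * #|[set v | cell v == c]|%:R - t
         <= #|[set v | (cell v == c) && (s v == reserve false)]|%:R].
Proof.
move=> tB small.
have [||s hs] := exists_concentrated (a := event_law) (B := 2 * m * M%:R) (t := t) law_ge0 law_sum event_law_01 _ mean_event_le.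
- by move: tB; congr (_ < _ <= _); ring.
- by move: small; congr (_ * expR (- (_ / _)) < _); ring.
have lawthin v c i : law v (pair_label c i) * thin v c = omega / K%:R * (if O (cell v) c then mu else 0).
  by rewrite -raw_thin mulrA.
have card1 (P : pred V) : #|[set v | P v]|%:R = \sum_(v | P v) 1 :> R.
  by rewrite cardsE -sum1_card natr_sum.
exists s; split.
- move=> u c i; have := hs (inl (inl (u, c, i))).
  rewrite /= label_sum_on_label mean_on_label.
  congr (`|_ - _| <= t).
  rewrite (eq_bigr (fun=> omega / K%:R * mu)); last first.
    by move=> v /andP[Fuv _]; rewrite lawthin Osym FO.
  rewrite sumr_const -[LHS]mulr_natr; congr (_ * _).
  rewrite /share mulrCA mulfV ?mulr1 ?pnatr_eq0 -?lt0n // cardsE.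
  by congr (_%:R); apply: eq_card => v; rewrite !inE.
- move=> c c' i; have := hs (inl (inr (c, c', i, true))).
  rewrite /= label_sum_on_label mean_on_label ler_distl => /andP[_].
  move/le_trans; apply; rewrite lerD2r.
  rewrite card1 mulr_sumr; apply: ler_sum => v _; rewrite mulr1 lawthin.
  apply: ler_wpM2l; first by rewrite divr_ge0 ?omega_ge0.
  by case: (O _ _) => //; exact: ltW.
- move=> c c' i Occ'; have := hs (inl (inr (c, c', i, false))).
  rewrite /= label_sum_on_label mean_on_label card1 mulr_sumr.
  congr (`|_ - _| <= t); apply: eq_bigr => v /eqP vc.
  by rewrite /= mulr1 /raw vc Occ'.
- move=> u w; have := hs (inr (inl (u, w))).
  rewrite /= label_sum_on_label mean_on_label ler_distl => /andP[+ _].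
  by rewrite !card1 mulr_sumr.
- move=> c; have := hs (inr (inr c)).
  rewrite /= label_sum_on_label mean_on_label ler_distl => /andP[+ _].
  by rewrite !card1 mulr_sumr.
Qed.

End Labelling.

(** * Composition of matchings into disjoint paths *)

Section Chains.
Context {R : realType} {V C : finType}.
Variables (cell : V -> C) (O : rel C) (F : rel V) (k : nat).
Let K := k.*2.+1.
Variables (s : V -> option (C * 'I_K)) (sh : V -> C -> R) (mu A0 t e : R).
Hypotheses (Fsym : symmetric F) (sh0 : forall v c, 0 <= sh v c) (mu0 : 0 < mu)
  (A00 : 0 < A0) (tA0 : t <= A0 * mu).
Let thin v c : R := mu / (sh v c + mu).
Hypotheses
  (degs : forall u c i, `|\sum_(v | F u v && (cell v == c) && (s v == Some (cell u, i))) thin v (cell u)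
     - A0 * sh u c| <= t)
  (losses : forall c c' i, \sum_(v | (cell v == c) && (s v == Some (c', i))) thin v c' <= e).

Definition zone (c c' : C) (i : 'I_K) : {set V} := [set v | (cell v == c) && (s v == Some (c', i))].

Lemma thin_share v c : thin v c * (sh v c + mu) = mu.
Proof. by rewrite /thin mulfVK // gt_eqF // ltr_wpDl. Qed.

Lemma thin_ge0 v c : 0 <= thin v c.
Proof. by rewrite divr_ge0 ?addr_ge0 ?(ltW mu0). Qed.

(** Give the edge u v the weight thin u c' times thin v c. By thin (sh + mu) = mu, and since the
    error t is at most A0 mu, the weight at u lies between A0 mu (1 - 2 thin) and A0 mu. A matching
    of size at least total weight / (A0 mu) then misses at most twice the sum of [thin] over the
    class. *)
Lemma zone_matching c c' i i' : exists (D : {set V}) (f : V -> V),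
  [/\ D \subset zone c c' i, {in D, forall x, F x (f x) && (f x \in zone c' c i')},
      {in D &, injective f} & #|zone c c' i|%:R - 2 * e <= #|D|%:R].
Proof.
set A := zone c c' i; set B := zone c' c i'.
pose g u v : R := if F u v && (u \in A) && (v \in B) then thin u c' * thin v c else 0.
have g0 u v : 0 <= g u v by rewrite /g; case: ifP => // _; rewrite mulr_ge0 ?thin_ge0.
have rowE u : u \in A -> \sum_(v in B) g u v = thin u c' *
    \sum_(v | F u v && (cell v == c') && (s v == Some (cell u, i'))) thin v (cell u).
  move=> uA; have /andP[/eqP uc _] : (cell u == c) && (s u == Some (c', i)) by move: uA; rewrite inE.
  rewrite mulr_sumr big_mkcond [RHS]big_mkcond /=; apply: eq_bigr => v _.
  by rewrite /g uA andbT uc inE -andbA; case: (F u v); case: (_ && _).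
have colE v : v \in B -> \sum_(u in A) g u v = thin v c *
    \sum_(u | F v u && (cell u == c) && (s u == Some (cell v, i))) thin u (cell v).
  move=> vB; have /andP[/eqP vc _] : (cell v == c') && (s v == Some (c, i')) by move: vB; rewrite inE.
  rewrite mulr_sumr big_mkcond [RHS]big_mkcond /=; apply: eq_bigr => u _.
  rewrite /g vB andbT vc Fsym inE -andbA mulrC.
  by case: (F v u); case: (_ && _).
have sumle v a : thin v a * (A0 * sh v a + t) <= A0 * mu.
  apply: (@le_trans _ _ (thin v a * (A0 * sh v a + A0 * mu))).
    by rewrite ler_wpM2l ?thin_ge0 // lerD2l.
  by rewrite -mulrDr mulrCA thin_share.
have cmu : 0 < A0 * mu by rewrite mulr_gt0.
have [|||D [f [DA fB fi tot]]] := @weighted_matching R V A B F g (A0 * mu) cmu g0.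
- by move=> u v; rewrite /g; case: (F u v); rewrite //= eqxx.
- move=> u uA; rewrite rowE //; apply: le_trans (sumle u c').
  rewrite ler_wpM2l ?thin_ge0 //; have := degs u c' i'.
  by rewrite ler_distl => /andP[_].
- move=> v vB; rewrite colE //; apply: le_trans (sumle v c).
  rewrite ler_wpM2l ?thin_ge0 //; have := degs v c i.
  by rewrite ler_distl => /andP[_].
exists D, f; split=> //.
rewrite -(ler_pM2l cmu); apply: le_trans tot.
apply: (@le_trans _ _ (\sum_(u in A) A0 * mu * (1 - 2 * thin u c'))).
  rewrite -mulr_sumr ler_wpM2l ?(ltW cmu) // big_split /= sumr_const lerD2l.
  rewrite sumrN lerN2 -mulr_sumr ler_wpM2l //.
  have := losses c c' i; congr (_ <= _).
  by apply: eq_bigl => v; rewrite inE.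
apply: ler_sum => u uA; rewrite rowE //.
apply: (@le_trans _ _ (thin u c' * (A0 * sh u c' - A0 * mu))).
  have e1 : thin u c' * sh u c' = mu - thin u c' * mu by apply/eqP; rewrite eq_sym subr_eq -mulrDr thin_share.
  by rewrite [leRHS]mulrBr (mulrCA _ A0 (sh u c')) e1 le_eqVlt; apply/orP; left; apply/eqP; ring.
rewrite ler_wpM2l ?thin_ge0 //; have := degs u c' i'.
rewrite ler_distl => /andP[h _]; apply: le_trans h.
by rewrite lerD2l lerN2.
Qed.

(** Position i of a path carries layer i, so positions in different layers never coincide. Within a
    layer, the box and the label determine (c, c'), and injectivity of the matchings leads back to
    equal starting points. Each step loses at most 2e vertices of every class. *)
Lemma exists_chains : exists (st : {set V}) (nxt : V -> V),
  [/\ forall u j, u \in st -> (j.+1 < K)%N -> F (iter j nxt u) (iter j.+1 nxt u),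
      forall u j, u \in st -> (j.*2 < K)%N -> cell (iter j.*2 nxt u) = cell u,
      forall u u' i j, u \in st -> u' \in st -> (i < K)%N -> (j < K)%N ->
        iter i nxt u = iter j nxt u' -> u = u' /\ i = j,
      forall u j, u \in st -> (j < K)%N -> s (iter j nxt u) != None &
      forall u, u \in st -> exists2 c, O (cell u) c & s u = Some (c, ord0)] /\
  \sum_c \sum_(c' | O c c') (#|zone c c' ord0|%:R - K%:R * (2 * e)) <= #|st|%:R.
Proof.
(* At the last layer [inord] falls back to layer 0, so every layer has a matching. *)
have /choice[Df DfP] : forall q : C * C * 'I_K, exists Df : {set V} * (V -> V),
   [/\ Df.1 \subset zone q.1.1 q.1.2 q.2,
      {in Df.1, forall x, F x (Df.2 x) && (Df.2 x \in zone q.1.2 q.1.1 (inord q.2.+1))},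
      {in Df.1 &, injective Df.2} & #|zone q.1.1 q.1.2 q.2|%:R - 2 * e <= #|Df.1|%:R].
  by move=> [[c c'] i] /=; have [D [f h]] := zone_matching c c' i (inord i.+1); exists (D, f).
pose D c c' i := (Df (c, c', i)).1.
pose nxt u := if s u is Some (c', i) then (Df (cell u, c', i)).2 u else u.
(* The first n iterates of u each lie in the domain of the matching of their own class. The boxes
   along the way alternate between c and c', which [par] records. *)
pose alive n u := [forall j : 'I_n, if s (iter j nxt u) is Some (c', i) then
   iter j nxt u \in D (cell (iter j nxt u)) c' i else false].
pose par (n : nat) (c c' : C) := if odd n then c' else c.
have zoneP c c' i u : u \in zone c c' i -> cell u = c /\ s u = Some (c', i).
  by rewrite inE => /andP[/eqP-> /eqP->].
have aliveS n u : alive n.+1 u = alive n u && (if s (iter n nxt u) is Some (c', i) then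
   iter n nxt u \in D (cell (iter n nxt u)) c' i else false).
  apply/forallP/andP => [h|[/forallP h1 h2] j].
    split; last exact: (h ord_max).
    by apply/forallP => j; exact: (h (widen_ord (leqnSn n) j)).
  case: (ltnP j n) => jn; first exact: (h1 (Ordinal jn)).
  by have -> : j = n :> nat by apply/eqP; rewrite eqn_leq jn -ltnS ltn_ord.
have stepP c c' i u : u \in D c c' i ->
    F u (nxt u) /\ nxt u \in zone c' c (inord i.+1).
  have [DA fB _ _] := DfP (c, c', i); move=> uD.
  have [uc su] := zoneP _ _ _ _ (subsetP DA _ uD).
  by have := fB u uD; rewrite /nxt su uc => /andP[].
have traj c c' u n : u \in zone c c' ord0 -> (n < K)%N -> alive n u ->
    iter n nxt u \in zone (par n c c') (par n c' c) (inord n).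
  move=> uz; elim: n => [|n IH] nK; first by rewrite /par /= (_ : inord 0 = ord0) //; apply: val_inj; rewrite /= inordK.
  rewrite aliveS => /andP[/(IH (ltnW nK)) z].
  have [zc zs] := zoneP _ _ _ _ z; rewrite zs zc => /stepP[_].
  rewrite inordK ?(ltnW nK) // /par /=.
  by case: (odd n).
have iD c c' u n : u \in zone c c' ord0 -> (n < K)%N -> alive n.+1 u ->
    iter n nxt u \in D (par n c c') (par n c' c) (inord n).
  move=> uz nK; rewrite aliveS => /andP[al].
  by have [zc zs] := zoneP _ _ _ _ (traj _ _ _ _ uz nK al); rewrite zs zc.
have inj c c' u u' n : u \in zone c c' ord0 -> u' \in zone c c' ord0 -> (n < K)%N ->
    alive n u -> alive n u' -> iter n nxt u = iter n nxt u' -> u = u'.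
  move=> uz u'z; elim: n => // n IH nK al al' /= E.
  have uD := iD _ _ _ _ uz (ltnW nK) al; have u'D := iD _ _ _ _ u'z (ltnW nK) al'.
  move: al al'; rewrite !aliveS => /andP[al _] /andP[al' _].
  apply: (IH (ltnW nK) al al').
  have [DA _ fi _] := DfP (par n c c', par n c' c, inord n).
  apply: fi => //.
  have [zc zs] := zoneP _ _ _ _ (subsetP DA _ uD).
  have [zc' zs'] := zoneP _ _ _ _ (subsetP DA _ u'D).
  by move: E; rewrite /nxt zs zs' zc zc'.
pose S c c' n := [set u in zone c c' ord0 | alive n u].
have SE c c' n u : (u \in S c c' n) = (u \in zone c c' ord0) && alive n u by rewrite in_set.
have SS c c' n : (n < K)%N -> #|S c c' n|%:R - 2 * e <= #|S c c' n.+1|%:R.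
  move=> nK; set Z := zone (par n c c') (par n c' c) (inord n).
  have [DA fB fi big] := DfP (par n c c', par n c' c, inord n).
  have : (#|S c c' n :\: S c c' n.+1| <= #|Z :\: D (par n c c') (par n c' c) (inord n)|)%N.
    have iinj : {in S c c' n :\: S c c' n.+1 &, injective (iter n nxt)}.
      move=> u u' /setDP[+ _] /setDP[+ _]; rewrite !SE => /andP[uz al] /andP[u'z al'].
      exact: (inj c c' u u' n uz u'z nK al al').
    rewrite -(card_in_imset iinj); apply: subset_leq_card; apply/subsetP => x /imsetP[u].
    rewrite in_setD !SE => /andP[na /andP[uz al]] ->.
    have z := traj _ _ _ _ uz nK al; rewrite in_setD z andbT.
    move: na; rewrite uz /= aliveS al /=; have [zc zs] := zoneP _ _ _ _ z.
    by rewrite zs zc.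
  have Ssub : S c c' n.+1 \subset S c c' n.
    by apply/subsetP => u; rewrite !SE aliveS => /and3P[-> -> _].
  rewrite !cardsDS // leq_subLR => h.
  have h2 : (#|S c c' n|%:R : R) + #|D (par n c c') (par n c' c) (inord n)|%:R <= #|S c c' n.+1|%:R + #|Z|%:R.
    have DZ := subset_leq_card DA; rewrite /= -/Z in DZ.
    by rewrite -!natrD ler_nat -(subnK DZ) addnA leq_add2r.
  by move: big h2; rewrite /= -/Z /D; lra.
have Sbig c c' n : (n <= K)%N -> #|zone c c' ord0|%:R - n%:R * (2 * e) <= #|S c c' n|%:R.
  elim: n => [|n IH] nK.
    rewrite mul0r subr0 ler_nat; apply: subset_leq_card; apply/subsetP => u uz.
    by rewrite SE uz; apply/forallP => -[].
  have := IH (ltnW nK); have := SS c c' n nK; rewrite -[n.+1]addn1 natrD; lra.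
exists [set u | if s u is Some (c', i) then (i == ord0) && O (cell u) c' && alive K u else false], nxt.
have stP u : u \in [set u | if s u is Some (c', i) then (i == ord0) && O (cell u) c' && alive K u else false] ->
    exists c', [/\ u \in zone (cell u) c' ord0, O (cell u) c' & forall n, (n <= K)%N -> alive n u].
  rewrite inE; case E: (s u) => [[c' i]|//] /andP[/andP[/eqP i0 Oc] al].
  exists c'; split=> //; first by rewrite inE eqxx E i0 eqxx.
  move=> n nK; apply/forallP => j.
  by have /forallP/(_ (widen_ord nK j)) := al.
split; first split.
- move=> u j /stP[c' [uz _ al]] jK.
  have [] := stepP _ _ _ _ (iD _ _ _ _ uz (ltnW jK) (al _ (ltnW jK))).
  by [].
- move=> u j /stP[c' [uz _ al]] jK.
  have [-> _] := zoneP _ _ _ _ (traj _ _ _ _ uz jK (al _ (ltnW jK))).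
  by rewrite /par odd_double.
- move=> u u' i j /stP[c [uz _ al]] /stP[c' [u'z _ al']] iK jK E.
  have z := traj _ _ _ _ uz iK (al _ (ltnW iK)).
  have z' := traj _ _ _ _ u'z jK (al' _ (ltnW jK)).
  have [zc zs] := zoneP _ _ _ _ z; have [zc' zs'] := zoneP _ _ _ _ z'.
  move: zc zs; rewrite E zc' zs' => hc [h1 h2].
  have ij : i = j by rewrite -(inordK iK) -(inordK jK) h2.
  split=> //; subst j.
  move: hc h1; rewrite /par => hc h1.
  have [cc cc'] : cell u = cell u' /\ c = c' by case: (odd i) hc h1.
  by apply: (inj (cell u) c u u' i) => //; [rewrite cc cc'|apply: al; exact: ltnW|apply: al'; exact: ltnW].
- move=> u j /stP[c' [uz _ al]] jK.
  by have [_ ->] := zoneP _ _ _ _ (traj _ _ _ _ uz jK (al _ (ltnW jK))).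
- move=> u /stP[c' [uz Oc _]]; exists c' => //.
  by have [] := zoneP _ _ _ _ uz.
apply: (@le_trans _ _ (\sum_c \sum_(c' | O c c') #|S c c' K|%:R)).
  by apply: ler_sum => c _; apply: ler_sum => c' _; exact: Sbig.
have -> : \sum_c \sum_(c' | O c c') #|S c c' K|%:R = (\sum_c \sum_(c' | O c c') #|S c c' K|)%:R :> R.
  by rewrite natr_sum; apply: eq_bigr => c _; rewrite natr_sum.
rewrite ler_nat pair_big_dep /=.
set st := [set _ | _]; pose q u := (cell u, if s u is Some (c', _) then c' else cell u).
rewrite -[X in (_ <= X)%N]sum1_card (partition_big q (fun p : C * C => O p.1 p.2)) /=; last first.
  by move=> u; rewrite /q inE; case: (s u) => [[c' i]|//] /andP[/andP[_ ->]].
apply: leq_sum => -[c c'] /= Occ'; rewrite -sum1_card big_mkcond [X in (_ <= X)%N]big_mkcond /=.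
apply: leq_sum => u _; case: ifP => //; rewrite SE => /andP[uz al].
have [uc us] := zoneP _ _ _ _ uz.
by rewrite inE /q us uc Occ' al !eqxx.
Qed.

End Chains.

(** * Assembling a cycle *)

(** Greedy choice: a set is larger than the number of sets meeting it, so representatives chosen
    earlier cannot exhaust it. *)
Lemma distinct_representatives (T : finType) (I : eqType) (A : I -> {set T}) (s : seq I) :
  (forall i, i \in s -> (count (fun j => A j :&: A i != set0) s < #|A i|)%N) ->
  exists xs : seq T, [/\ uniq xs, size xs = size s & all2 (fun i x => x \in A i) s xs].
Proof.
elim: s => [|i s IH] cnt; first by exists [::].
have [j js|xs [uxs sxs axs]] := IH.
  apply: leq_ltn_trans (cnt j _); last by rewrite inE js orbT.
  by rewrite /= leq_addl.
have cle : (count (mem (A i)) xs <= count (fun j => A j :&: A i != set0) s)%N.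
  elim: s xs axs {IH cnt uxs sxs} => [|j s IH] [|x xs] //= /andP[xj /IH h].
  apply: leq_add => //; case: (boolP (x \in A i)) => // xi.
  by rewrite lt0b; apply/set0Pn; exists x; rewrite inE xj.
have [x xA xxs] : exists2 x, x \in A i & x \notin xs.
  apply/exists_inP; rewrite -[[exists _ in _, _]]negbK negb_exists_in; apply/negP => /forall_inP allin.
  have := cnt i (mem_head _ _); rewrite /= ltnNge => /negP; apply.
  apply: leq_trans (leq_addl _ _); apply: leq_trans cle.
  rewrite -size_filter -(card_uniqP (filter_uniq _ uxs)).
  apply: subset_leq_card; apply/subsetP => x xA; rewrite mem_filter.
  by apply/andP; split=> //; have := allin x xA; rewrite negbK.
exists (x :: xs); split=> /=; first by rewrite xxs.
  by rewrite sxs.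
by rewrite xA axs.
Qed.

(** * Closed walks with few visits to each box *)

Section ClosedWalks.
Context {C : finType}.
Variable adj : rel C.
Hypotheses (adjxx : reflexive adj) (adjC : symmetric adj) (adj_conn : forall a b, connect adj a b).

(** The walk grows by detours p, q, p to a new cell q. A detour adds one visit to p and one to q,
    both adjacent to q; so visits to a cell are charged to its visited neighbours, and a degree
    bounds them rather than the number of cells. *)
Lemma even_closed_walk (c0 : C) (i : nat) : (i < #|C|)%N ->
  exists (w : seq C) (vis : {set C}),
    [/\ path adj c0 w, last c0 w = c0, size w = i.*2, #|vis| = i.+1 & c0 \in vis] /\
    (forall c, c \in vis -> c \in c0 :: w) /\
    (forall c, (count_mem c w <= #|[set c' in vis | adj c c' & c' != c0]|)%N).
Proof.
elim: i => [|i IH] iC.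
  exists [::], [set c0]; split; first by split; rewrite ?cards1 ?set11.
  by split=> c; rewrite // !inE.
have [w [vis [[pw lw sw cv c0v] [vw cw]]]] := IH (ltnW iC).
have [p [q [pv qv pq]]] : exists p q, [/\ p \in vis, q \notin vis & adj p q].
  have [z zv] : exists z, z \notin vis.
    apply/existsP; rewrite -negb_forall; apply: contraL iC => /forallP allv.
    by rewrite -leqNgt -cv subset_leq_card //; apply/subsetP => z _; exact: allv.
  have /connectP[pp] := adj_conn c0 z; elim: pp c0 c0v {IH pw lw cw vw} => [|y pp IHp] c1 c1v /=.
    by move=> _ zE; rewrite zE c1v in zv.
  case/andP => c1y; case: (boolP (y \in vis)) => [yv|yv _ _]; first exact: IHp.
  by exists c1, y.
have pw0 := vw p pv.
case/splitPl: {w} pw0 pw lw sw vw cw => p1 p2 lp.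
rewrite cat_path last_cat lp size_cat => /andP[pp1 pp2] lw sw vw cw.
have qc0 : q != c0 by apply: contraNneq qv => ->.
exists (p1 ++ q :: p :: p2), (q |: vis); split; first split.
- by rewrite cat_path pp1 lp /= pq adjC pq.
- by rewrite last_cat /=.
- by rewrite size_cat /= !addnS sw doubleS.
- by rewrite cardsU1 qv cv.
- by rewrite inE c0v orbT.
split=> [c|c].
  rewrite !inE mem_cat !inE => /orP[->|/vw]; first by rewrite !orbT.
  by rewrite inE mem_cat => /or3P[->|->|->]; rewrite ?orbT.
rewrite count_cat /= addnCA [X in (_ + X)%N]addnCA -count_cat.
have -> : [set c' in q |: vis | adj c c' & c' != c0] =
  (if adj c q then q |: [set c' in vis | adj c c' & c' != c0] else [set c' in vis | adj c c' & c' != c0]).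
  case: ifP => cq; apply/setP => z; rewrite !inE; case: (eqVneq z q) => [->|_] //=.
    by rewrite cq qc0.
  by rewrite cq (negbTE qv).
have := cw c; case: ifP => cq.
  rewrite cardsU1 !inE (negbTE qv) /= addnA => h.
  apply: (@leq_trans (1 + count_mem c (p1 ++ p2))); last by rewrite leq_add2l.
  rewrite leq_add2r; case: (eqVneq q c) => [<-|_] //=; last by case: (p == c).
  by case: eqP => // pqE; rewrite pqE (negbTE qv) in pv.
move=> h; have -> : (q == c) = false by apply: contraFF cq => /eqP->.
have -> : (p == c) = false by apply: contraFF cq => /eqP<-.
exact: h.
Qed.

(** An odd length is obtained by one loop at [c0]. *)
Lemma closed_walk (c0 : C) (h : nat) : (h <= (#|C|.-1).*2.+1)%N ->
  exists w : seq C,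
    [/\ path adj c0 w, last c0 w = c0, size w = h,
       (forall c, (count_mem c w <= #|[set c' | adj c c']|.+1)%N) &
       (h = (#|C|.-1).*2 -> forall c, c \in c0 :: w)].
Proof.
move=> hC.
have C0 : (0 < #|C|)%N by apply/card_gt0P; exists c0.
have iC : (h./2 < #|C|)%N by move: hC C0; lia.
have [w [vis [[pw lw sw cv _] [vw cw]]]] := even_closed_walk c0 iC.
have cw' c : (count_mem c w <= #|[set c' | adj c c']|)%N.
  apply: (leq_trans (cw c)); apply: subset_leq_card; apply/subsetP => z.
  by rewrite !inE => /and3P[].
case: (boolP (odd h)) => oh.
  exists (rcons w c0); split.
  - by rewrite rcons_path pw lw adjxx.
  - by rewrite last_rcons.
  - by rewrite size_rcons sw -[RHS]odd_double_half oh.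
  - move=> c; rewrite -cats1 count_cat /= addn0 -[X in (_ <= X)%N]addn1.
    by apply: leq_add => //; case: (_ == _).
  - by move=> hE; rewrite hE odd_double in oh.
have hE : h = (h./2).*2 by rewrite -[LHS]odd_double_half (negbTE oh).
exists w; split=> //; first by rewrite sw -hE.
  by move=> c; apply: (leq_trans (cw' c)).
move=> hC' c; apply: vw.
have : vis == [set: C] by rewrite eqEcard subsetT cardsT cv hC' doubleK prednK ?leqnn.
by move/eqP->; rewrite inE.
Qed.

End ClosedWalks.

Lemma leq_card_bigcup (I T : finType) (P : {set I}) (F : I -> {set T}) :
  (#|\bigcup_(i in P) F i| <= \sum_(i in P) #|F i|)%N.
Proof.
elim/big_rec2: _ => [|i n A _ h]; first by rewrite cards0.
by apply: leq_trans (leq_card_setU _ _).1 _; rewrite leq_add2l.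
Qed.

(** * From cyclic sequences of stations to cycles *)

Section Stations.
Context {V C : finType}.
Variables (cell : V -> C) (adj : rel C).
Implicit Types (s t : V * seq V) (S : seq (V * seq V)).

(* A station [s] is the nonempty path [s.1 :: s.2]. *)
Definition verts s : seq V := s.1 :: s.2.
Definition exit s : V := last s.1 s.2.
Definition linkable s t : bool := adj (cell (exit s)) (cell t.1).

Lemma insert_station S s t : cycle linkable S -> t \in S -> reflexive adj ->
  cell s.1 = cell (exit t) -> cell (exit s) = cell (exit t) ->
  exists S', cycle linkable S' /\ perm_eq S' (s :: S).
Proof.
move=> cS tS adjxx s1 s2; have [i S1 rS] := rot_to tS.
exists (t :: s :: S1); split.
  have : cycle linkable (t :: S1) by rewrite -rS rot_cycle.
  rewrite /= {2}/linkable s1 adjxx /=.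
  by case: S1 {rS} => [|y S1] /=; rewrite /linkable s2.
rewrite -[_ :: _ :: _]/([:: t] ++ [:: s] ++ S1) perm_catCA /= perm_cons -rS.
by rewrite perm_rot.
Qed.

Lemma insert_stations S ps : cycle linkable S -> reflexive adj ->
  (forall s, s \in ps -> exists2 t, t \in S & cell s.1 = cell (exit t) /\ cell (exit s) = cell (exit t)) ->
  exists S', cycle linkable S' /\ perm_eq S' (ps ++ S).
Proof.
move=> cS adjxx; elim: ps => [|s ps IH] hps; first by exists S.
have [|S1 [cS1 pS1]] := IH; first by move=> t tps; apply: hps; rewrite inE tps orbT.
have [t tS [e1 e2]] := hps s (mem_head _ _).
have tS1 : t \in S1 by rewrite (perm_mem pS1) mem_cat tS orbT.
have [S' [cS' pS']] := insert_station cS1 tS1 adjxx e1 e2.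
by exists S'; split=> //; rewrite (perm_trans pS') //= perm_cons.
Qed.

(** The vertices of the cycle after [s.1], a linking vertex being placed after each station; meant
    for [size xs = (size S).+1]. *)
Fixpoint weave s S (xs : seq V) : seq V :=
  match S, xs with
  | t :: S', x :: xs' => s.2 ++ x :: t.1 :: weave t S' xs'
  | _, x :: _ => s.2 ++ [:: x]
  | _, _ => s.2
  end.

Lemma perm_weave s S xs : size xs = (size S).+1 ->
  perm_eq (s.1 :: weave s S xs) (flatten (map verts (s :: S)) ++ xs).
Proof.
elim: S s xs => [|t S IH] s [|x xs] //= [sx].
  by case: xs sx => // _; rewrite cats0 perm_cons.
apply/permP => a; have /permP/(_ a) := IH t xs sx.
by rewrite /= !count_cat /= !count_cat /=; lia.
Qed.

Lemma path_weave (H : rel V) s S xs t0 :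
  (forall t, t \in s :: S -> path H t.1 t.2) ->
  all2 (fun (q : (V * seq V) * (V * seq V)) x => H (exit q.1) x && H x q.2.1)
       (zip (s :: S) (rcons S t0)) xs ->
  path H s.1 (rcons (weave s S xs) t0.1).
Proof.
elim: S s xs => [|t S IH] s [|x xs] //= pS.
  case: xs => [|? ?]; rewrite ?andbF // andbT => /andP[h1 h2].
  by rewrite rcons_cat cat_path pS ?mem_head //= h1 h2.
case/andP => /andP[h1 h2] h3.
rewrite rcons_cat cat_path pS ?mem_head //= h1 h2 /=.
by apply: IH => // u uS; apply: pS; rewrite inE uS orbT.
Qed.

Lemma zip_path_linked (T : eqType) (e : rel T) (x y : T) (p : seq T) q :
  path e x (rcons p y) -> q \in zip (x :: p) (rcons p y) -> e q.1 q.2.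
Proof.
elim: p x => [|z p IH] x /=; first by rewrite andbT inE => h /eqP->.
by case/andP => h1 h2; rewrite inE => /orP[/eqP->//|]; exact: IH.
Qed.

(** Two links can compete for a vertex only if the exits of their stations lie in boxes with a
    common O-neighbour. A box has at most M * M such partners, each holding at most B exits, so
    distinct links can be chosen greedily. *)
Lemma assemble_cycle (H : rel V) (O : rel C) (R : {set V}) (M B : nat) S :
  symmetric H -> (forall u w, H u w -> O (cell u) (cell w)) ->
  (forall c, #|[set a | O c a]| <= M)%N -> (forall c, #|[set a | O a c]| <= M)%N ->
  S != [::] -> cycle linkable S -> uniq (flatten (map verts S)) ->
  (forall s, s \in S -> path H s.1 s.2) ->
  (forall u, u \in flatten (map verts S) -> u \notin R) ->
  (forall c, count (fun s => cell (exit s) == c) S <= B)%N ->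
  (forall u w, adj (cell u) (cell w) ->
     (M * M * B < #|[set x in R | H u x && H w x]|)%N) ->
  exists c : seq V, [/\ ucycle H c, size c = (size (flatten (map verts S)) + size S)%N &
    {subset flatten (map verts S) <= c}].
Proof.
move=> Hs HO OM1 OM2; case: S => // s S _ cS uS pS SR cB big.
pose A (q : (V * seq V) * (V * seq V)) := [set x in R | H (exit q.1) x && H x q.2.1].
have [q qS|xs [uxs sxs axs]] := @distinct_representatives _ _ A (zip (s :: S) (rcons S s)).
  have adjq := zip_path_linked cS qS.
  apply: (@leq_ltn_trans (M * M * B)); last first.
    apply: (leq_trans (big _ _ adjq)); apply: subset_leq_card.
    by apply/subsetP => x; rewrite !inE [H x _]Hs.
  pose far := [set a | [exists b, O a b && O (cell (exit q.1)) b]].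
  have farM : (#|far| <= M * M)%N.
    have -> : far = \bigcup_(b in [set b | O (cell (exit q.1)) b]) [set a | O a b].
      apply/setP => a; rewrite !inE; apply/existsP/bigcupP => [[b /andP[h1 h2]]|[b]].
        by exists b; rewrite inE.
      by rewrite !inE => h1 h2; exists b; rewrite h1 h2.
    apply: (leq_trans (leq_card_bigcup _ _)).
    apply: (@leq_trans (\sum_(b in [set b | O (cell (exit q.1)) b]) M)); first exact: leq_sum.
    by rewrite sum_nat_const leq_mul2r OM1 orbT.
  apply: (@leq_trans (count (fun t => cell (exit t) \in far) (s :: S))).
    have -> : count (fun t => cell (exit t) \in far) (s :: S) =
        count (fun q' => cell (exit q'.1) \in far) (zip (s :: S) (rcons S s)).
      rewrite -[in LHS](@unzip1_zip _ _ (s :: S) (rcons S s)) ?size_rcons //.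
      by rewrite /unzip1 count_map.
    apply: sub_count => q' /set0Pn[x]; rewrite !inE => /andP[/and3P[_ h1 _] /and3P[_ h2 _]].
    by apply/existsP; exists (cell x); rewrite !HO.
  have -> : count (fun t => cell (exit t) \in far) (s :: S) =
      (\sum_(c in far) count (fun t => cell (exit t) == c) (s :: S))%N.
    elim: (s :: S) => [|t S' IH] /=; first by rewrite big1.
    rewrite big_split /= IH; congr (_ + _)%N.
    case: (boolP (cell (exit t) \in far)) => h.
      rewrite (bigD1 (cell (exit t))) //= eqxx big1 // => c /andP[_ hc].
      by rewrite eq_sym (negbTE hc).
    by rewrite big1 // => c cf; case: eqP => // E; rewrite E cf in h.
  apply: (@leq_trans (\sum_(c in far) B)); first exact: leq_sum.
  by rewrite sum_nat_const leq_mul2r farM orbT.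
have sx : size xs = (size S).+1.
  by rewrite sxs size_zip size_rcons /= minnn.
have pw := perm_weave s sx.
exists (s.1 :: weave s S xs); split.
- rewrite /ucycle; apply/andP; split.
    apply: path_weave => //.
    move: axs; elim: (zip _ _) xs {sx sxs uxs pw} => [|q Q IH] [|y ys] //= /andP[yq /IH ->].
    by move: yq; rewrite inE => /and3P[_ -> ->].
  rewrite (perm_uniq pw) cat_uniq uS uxs andbT /=; apply/hasPn => x xxs.
  apply/negP => /SR; rewrite -[xs](unzip2_zip (s := zip (s :: S) (rcons S s))) ?sxs // in xxs.
  move: axs xxs; elim: (zip _ _) xs {pw sx sxs uxs} => [|q Q IH] [|y ys] //= /andP[yq hQ].
  rewrite inE => /orP[/eqP->|]; last exact: IH.
  by move: yq; rewrite inE => /andP[->].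
- by rewrite (perm_size pw) size_cat sx.
- by move=> u uS'; rewrite (perm_mem pw) mem_cat uS'.
Qed.

End Stations.

Lemma distribute (T : eqType) (us : seq T) (k h : nat) : uniq us -> (h <= k * size us)%N ->
  exists f : T -> nat, (forall u, f u <= k)%N /\ (\sum_(u <- us) f u = h)%N.
Proof.
elim: us h => [|u us IH] h /=.
  by rewrite muln0 leqn0 => _ /eqP->; exists (fun=> 0%N); rewrite big_nil.
case/andP => uus unus hk.
have [|f [fk fs]] := IH (h - minn h k)%N unus; first by lia.
exists (fun z => if z == u then minn h k else f z); split=> [z|].
  by case: ifP => _ //; exact: geq_minr.
rewrite big_cons eqxx big_seq (eq_bigr f) -?big_seq ?fs; first by lia.
by move=> z zus; case: eqP => // zu; rewrite zu (negbTE uus) in zus.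
Qed.

Lemma uniq_flatten_map (T1 T2 : eqType) (g : T1 -> seq T2) (us : seq T1) : uniq us ->
  {in us, forall u, uniq (g u)} ->
  (forall u u' x, u \in us -> u' \in us -> x \in g u -> x \in g u' -> u = u') ->
  uniq (flatten (map g us)).
Proof.
elim: us => //= u us IH /andP[uus unus] ug dis.
rewrite cat_uniq ug ?mem_head //= IH ?andbT //.
- apply/hasPn => x /flatten_mapP[u' u'us xu']; apply/negP => xu.
  have E : u = u' by apply: (dis _ _ x); rewrite ?inE ?eqxx // u'us orbT.
  by rewrite E u'us in uus.
- by move=> z zus; apply: ug; rewrite inE zus orbT.
- by move=> z z' x zus z'us; apply: dis; rewrite inE ?zus ?z'us orbT.
Qed.

Lemma path_traject (T : Type) (e : rel T) (f : T -> T) (u : T) (n : nat) :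
  (forall j, (j < n)%N -> e (iter j f u) (iter j.+1 f u)) -> path e u (traject f (f u) n).
Proof.
elim: n u => //= n IH u h; rewrite (h 0%N) //=; apply: IH => j jn.
by have := h j.+1 jn; rewrite !iterSr.
Qed.

(** * Cycles through a given vertex with a given length *)

Section CycleOfLength.
Context {V C : finType}.
Variables (cell : V -> C) (adj O : rel C) (H : rel V).
Variables (R1 R2 st : {set V}) (nxt : V -> V) (k l0 M B1 : nat).
Let K := k.*2.+1.
Hypotheses (adjxx : reflexive adj) (adjC : symmetric adj)
  (adj_conn : forall a b, connect adj a b) (adjO : subrel adj O).
Hypotheses (HC : symmetric H) (Hirr : irreflexive H)
  (HO : forall u w, H u w -> O (cell u) (cell w))
  (OM1 : forall c, (#|[set a | O c a]| <= M)%N) (OM2 : forall c, (#|[set a | O a c]| <= M)%N).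
Hypothesis short_path : forall a b, O a b ->
  exists p, [/\ path adj a p, last a p = b & (size p <= l0)%N].
Hypotheses
  (st_edge : forall u j, u \in st -> (j.+1 < K)%N -> H (iter j nxt u) (iter j.+1 nxt u))
  (st_cell : forall u j, u \in st -> (j.*2 < K)%N -> cell (iter j.*2 nxt u) = cell u)
  (st_inj : forall u u' i j, u \in st -> u' \in st -> (i < K)%N -> (j < K)%N ->
     iter i nxt u = iter j nxt u' -> u = u' /\ i = j)
  (st_R : forall u j, u \in st -> (j < K)%N -> iter j nxt u \notin R1 :|: R2)
  (R12 : [disjoint R1 & R2])
  (st_count : forall c, (#|[set u in st | cell u == c]| <= B1)%N)
  (R2_big : forall c, (l0 + M + 3 < #|[set x in R2 | cell x == c]|)%N)
  (R1_big : forall u w, adj (cell u) (cell w) ->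
     (M * M * (B1 + l0 + M + 2) + 2 < #|[set x in R1 | H u x && H w x]|)%N).

(** [h] is the length left to spend, in units of 2: a single vertex and its link cost one unit. For
    odd L the edge v a costs 3 with its link, and [p] leads from the box of a back to that of v. *)
Lemma starting_station (v : V) (L : nat) : (l0.*2 + 4 <= L)%N ->
  exists (s0 : V * seq V) (p : seq C) (h : nat),
    [/\ s0.1 = v, path H v s0.2, uniq (verts s0) & (size s0.2 <= 1)%N] /\
    [/\ path adj (cell (exit s0)) p, last (cell (exit s0)) p = cell v, (size p <= l0)%N &
        L = ((size s0.2).+2 + (size p).*2 + h.*2)%N].
Proof.
move=> Lbig; case: (boolP (odd L)) => oL; last first.
  exists (v, [::]), [::], (L./2.-1); split; split=> //=.
  by have := odd_double_half L; rewrite (negbTE oL); lia.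
have [a Hva] : exists a, H v a.
  have /(leq_ltn_trans (leq0n _)) := R1_big (adjxx (cell v)).
  by case/card_gt0P => a; rewrite inE andbb => /andP[_ Hva]; exists a.
have [p [pp lp sp]] := short_path (HO (etrans (HC a v) Hva)).
exists (v, [:: a]), p, ((L - 3 - (size p).*2)./2); split; split=> //=.
- by rewrite Hva.
- by rewrite inE andbT; apply: contraTneq Hva => ->; rewrite Hirr.
- have := odd_double_half L; have := odd_double_half (L - 3 - (size p).*2).
  by rewrite !oddB ?odd_double ?oL /=; lia.
Qed.

Lemma pick_singles (X : seq V) (cs : seq C) : (size X <= 2)%N ->
  (forall c, (count_mem c cs <= l0 + M + 1)%N) ->
  exists xs : seq V, [/\ uniq xs, map cell xs = cs & forall x, x \in xs -> x \in R2 /\ x \notin X].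
Proof.
move=> X2 cnt.
pose A c := [set x in R2 | cell x == c] :\: [set x in X].
have [c ccs|xs [uxs sxs axs]] := @distinct_representatives _ _ A cs.
  apply: (@leq_ltn_trans (count_mem c cs)).
    apply: sub_count => c' /set0Pn[x]; rewrite !inE.
    by case/andP => /and3P[_ _ /eqP<-] /and3P[_ _ /eqP<-].
  apply: (leq_ltn_trans (cnt c)).
  have := R2_big c; rewrite -(cardsID [set x in X] [set x in R2 | cell x == c]).
  have : (#|[set x in R2 | cell x == c] :&: [set x in X]| <= 2)%N.
    apply: leq_trans X2; apply: leq_trans (card_size X).
    by apply: subset_leq_card; apply/subsetP => x; rewrite !inE => /andP[].
  by rewrite /A; lia.
exists xs; split=> //.
  elim: cs xs axs {cnt uxs sxs} => [|c cs IH] [|x xs] //= /andP[+ /IH->].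
  by rewrite !inE => /and3P[_ _ /eqP->].
move=> x; elim: cs xs axs {cnt uxs sxs} => [|c cs IH] [|y xs] //= /andP[yA h].
rewrite inE => /orP[/eqP->|]; last exact: IH.
by move: yA; rewrite !inE => /and3P[-> ->].
Qed.

Lemma path_singles (s : V * seq V) (xs : seq V) t :
  path adj (cell (exit s)) (rcons (map cell xs) (cell t.1)) ->
  path (linkable cell adj) s (rcons [seq (x, [::]) | x <- xs] t).
Proof.
elim: xs s => [|x xs IH] s //=.
by case/andP => h1 h2; rewrite /linkable h1; apply: IH.
Qed.

Lemma cycle_of_length (v : V) (L : nat) :
  (l0.*2 + 4 <= L)%N -> (L <= K * (#|st| - 2))%N -> has_cycle_through H L v.
Proof.
move=> Lmin Lmax.
have [s0 [p [h [[s0v ps0 us0 s01] [pp lp sp LE]]]]] := starting_station v Lmin.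
(* The paths are disjoint and [s0] has at most two vertices, so at most two paths are discarded. *)
pose st' := [set u in st | [forall j : 'I_K, iter j nxt u \notin verts s0]].
have st'2 : (#|st| - 2 <= #|st'|)%N.
  rewrite leq_subLR -(cardsID st' st) addnC leq_add //; last by rewrite subset_leq_card ?subsetIr.
  apply: (@leq_trans #|\bigcup_(x in [set x in verts s0]) [set u in st | [exists j : 'I_K, iter j nxt u == x]]|).
    apply: subset_leq_card; apply/subsetP => u; rewrite !inE => /andP[+ ust].
    rewrite ust /= negb_forall => /existsP[j]; rewrite negbK => jx.
    apply/bigcupP; exists (iter j nxt u); rewrite inE // ust.
    by apply/existsP; exists j.
  apply: (leq_trans (leq_card_bigcup _ _)).
  apply: (@leq_trans (\sum_(x in [set x in verts s0]) 1)%N).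
    apply: leq_sum => x _; apply/card_le1_eqP => u u'.
    rewrite !inE => /andP[ust /existsP[i /eqP iE]] /andP[u'st /existsP[j /eqP jE]].
    by have [] := @st_inj u u' i j ust u'st (ltn_ord i) (ltn_ord j) (etrans iE (esym jE)).
  rewrite sum1_card; apply: (@leq_trans (size (verts s0))); last by rewrite /= ltnS.
  by apply: leq_trans (card_size (verts s0)); rewrite cardsE.
(* The walk takes all it can from the budget. Something is left for the paths only if the walk
   visits every box, and then each path finds a station in its own box. *)
pose hw := minn h (#|C|.-1).*2.
have [|w [pw lw sw cw vw]] := closed_walk adjxx adjC adj_conn (cell v) (h := hw).
  by apply: (leq_trans (geq_minr _ _)).
have cM c : (#|[set c' | adj c c']| <= M)%N.
  apply: leq_trans (OM1 c); apply: subset_leq_card; apply/subsetP => z; rewrite !inE.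
  exact: adjO.
have cntw c : (count_mem c (p ++ w) <= l0 + M + 1)%N.
  rewrite count_cat -addnA; apply: leq_add; first exact: leq_trans (count_size _ _) sp.
  by apply: (leq_trans (cw c)); rewrite addn1 ltnS.
have [|xs [uxs xsE xsR]] := pick_singles (X := verts s0) _ cntw; first by rewrite /= ltnS.
have sxs : size xs = (size p + hw)%N by rewrite -(size_map cell) xsE size_cat sw.
pose S0 := s0 :: [seq (x, [::] : seq V) | x <- xs].
have cS0 : cycle (linkable cell adj) S0.
  apply: path_singles; rewrite s0v xsE rcons_path cat_path pp lp pw /=.
  by rewrite last_cat lp lw adjxx.
(* The path from u is cut to 2 f(u) - 1 vertices, and so costs f(u) units with its link; f(u) = k +
   1 takes the whole path and f(u) = 0 omits it. An odd number of vertices makes it end in its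
   initial box. *)
have [f [fk fs]] : exists f : V -> nat, (forall u, f u <= k.+1)%N /\
    (\sum_(u <- enum st') f u = h - hw)%N.
  apply: distribute; first exact: enum_uniq.
  rewrite -cardE; move: Lmax; rewrite /K LE; move: st'2.
  by set a := #|st'|; set b := #|st|; clearbody a b hw; clear; nia.
pose us := [seq u <- enum st' | (0 < f u)%N].
pose pc u : V * seq V := (u, traject nxt (nxt u) ((f u).*2 - 2)).
have usP u : u \in us -> [/\ u \in st, (0 < f u)%N & forall j, (j < K)%N -> iter j nxt u \notin verts s0].
  rewrite mem_filter mem_enum inE => /and3P[f0 ust /forallP hj]; split=> // j jK.
  exact: (hj (Ordinal jK)).
have pcE u : (0 < f u)%N -> verts (pc u) = traject nxt u ((f u).*2.-1).
  by rewrite /verts /pc /=; case: (f u) => // n _; rewrite doubleS subn2 /=.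
have fK3 u : (0 < f u)%N ->
    [/\ ((f u).*2.-1 <= K)%N, ((f u).*2 - 2 < K)%N & ((f u).-1.*2 < K)%N].
  by have := fk u; rewrite /K; clear; split; lia.
have fK u : (0 < f u)%N -> ((f u).*2.-1 <= K)%N by case/fK3.
have pcP u x : u \in us -> x \in verts (pc u) -> exists2 j, (j < K)%N & x = iter j nxt u.
  move=> /usP[_ f0 _]; rewrite pcE // => /trajectP[j jf ->].
  by exists j => //; exact: leq_trans (fK _ f0).
have exitE u : u \in us -> cell (exit (pc u)) = cell u.
  move=> /usP[ust f0 _]; rewrite /exit /pc /=.
  have -> : last u (traject nxt (nxt u) ((f u).*2 - 2)) = iter ((f u).-1).*2 nxt u.
    by case: (f u) f0 => // n _; rewrite doubleS subn2 /= last_traject.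
  by apply: st_cell => //; case: (fK3 u f0).
have [s|S' [cS' pS']] := insert_stations (ps := map pc us) cS0 adjxx.
  case/mapP => u uus ->; rewrite exitE //=.
  have hC : hw = (#|C|.-1).*2.
    have [ust f0 _] := usP _ uus.
    have : (0 < h - hw)%N.
      rewrite -fs (big_rem u) /=; first by rewrite addn_gt0 f0.
      by move: uus; rewrite mem_filter => /andP[].
    by rewrite /hw /minn; case: ifP => //; rewrite subnn.
  have : cell u \in cell (exit s0) :: map cell xs.
    rewrite xsE -cat_cons mem_cat; have := vw hC (cell u); rewrite inE => /orP[/eqP->|->]; last by rewrite orbT.
    by rewrite -lp mem_last.
  rewrite inE => /orP[/eqP->|/mapP[x xxs ->]]; first by exists s0; rewrite ?mem_head.
  by exists (x, [::]) => //; rewrite inE map_f ?orbT.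
have flatS0 : flatten (map verts S0) = verts s0 ++ xs.
  by rewrite /= -map_comp; congr (_ :: _ ++ _); elim: (xs) => //= x l ->.
have pflat : perm_eq (flatten (map verts S')) (flatten (map verts (map pc us)) ++ verts s0 ++ xs).
  by rewrite -flatS0 -flatten_cat -map_cat; apply: perm_flatten; exact: perm_map.
have memP u : u \in flatten (map verts (map pc us)) -> exists u' j, [/\ u' \in us, (j < K)%N & u = iter j nxt u'].
  rewrite -map_comp => /flatten_mapP[u' u'us /(pcP _ _ u'us)[j jK ->]].
  by exists u', j.
pose R := R1 :\: [set x in verts s0].
have S'0 : S' != [::] by rewrite -size_eq0 (perm_size pS') size_cat addnS.
have uflat : uniq (flatten (map verts S')).
  rewrite (perm_uniq pflat) cat_uniq; apply/and3P; split.
  - rewrite -map_comp; apply: uniq_flatten_map; first by rewrite filter_uniq ?enum_uniq.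
      move=> u uus; have [ust f0 _] := usP _ uus.
      rewrite -[uniq _]/(uniq (verts (pc u))) pcE //.
      apply/(uniqP u) => a b; rewrite !inE size_traject => ha hb.
      rewrite !nth_traject // => E.
      by have [] := st_inj ust ust (leq_trans ha (fK _ f0)) (leq_trans hb (fK _ f0)) E.
    move=> u u' x uus u'us /(pcP _ _ uus)[a ha ->] /(pcP _ _ u'us)[b hb E].
    have [ust _ _] := usP _ uus; have [u'st _ _] := usP _ u'us.
    by have [] := st_inj ust u'st ha hb E.
  - apply/hasPn => x xin; apply/negP => /memP[u [a [/usP[ust f0 hs0] aK xE]]].
    move: xin; rewrite mem_cat xE (negbTE (hs0 _ aK)) /= => /xsR[xR2 _].
    by have := st_R ust aK; rewrite inE xR2 orbT.
  - rewrite cat_uniq us0 uxs andbT; apply/hasPn => x /xsR[_].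
    by [].
have pathS' s : s \in S' -> path H s.1 s.2.
  rewrite (perm_mem pS') mem_cat inE => /or3P[|/eqP->|].
  - case/mapP => u /usP[ust f0 _] -> /=.
    apply: path_traject => a ha; apply: st_edge => //.
    by apply: leq_ltn_trans ha _; case: (fK3 _ f0).
  - by rewrite s0v.
  - by case/mapP => x _ ->.
have SR u : u \in flatten (map verts S') -> u \notin R.
  rewrite (perm_mem pflat) mem_cat mem_cat => /or3P[/memP[u' [a [/usP[ust _ _] aK ->]]]|us0'|/xsR[uR2 _]].
  - by have := st_R ust aK; rewrite !inE negb_or => /andP[/negbTE-> _]; rewrite andbF.
  - by rewrite !inE; move: us0'; rewrite inE => ->.
  - have := disjointFl R12 uR2; by rewrite !inE => ->; rewrite andbF.
have cntS' c : (count (fun s => cell (exit s) == c) S' <= B1 + l0 + M + 2)%N.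
  rewrite (permP pS') count_cat count_map -!addnA; apply: leq_add.
    apply: leq_trans (st_count c).
    rewrite (eq_in_count (a2 := fun u => cell u == c)); last by move=> u /exitE /= ->.
    rewrite -size_filter -(card_uniqP (filter_uniq _ (filter_uniq _ (enum_uniq _)))).
    apply: subset_leq_card; apply/subsetP => u; rewrite mem_filter !inE.
    by case/andP => -> /usP[->].
  rewrite /= count_map; have := cntw c; rewrite -xsE count_map.
  rewrite (eq_count (a2 := fun s : V => cell (exit (s, [::])) == c)) //.
  by case: (cell (exit s0) == c); clear; lia.
have bigR u w' : adj (cell u) (cell w') ->
    (M * M * (B1 + l0 + M + 2) < #|[set x in R | H u x && H w' x]|)%N.
  move=> /R1_big; rewrite -(cardsID [set x in verts s0] [set x in R1 | _]) => hb.
  have h2 : (#|[set x in R1 | H u x && H w' x] :&: [set x in verts s0]| <= 2)%N.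
    apply: (@leq_trans #|[set x in verts s0]|); first by rewrite subset_leq_card ?subsetIr.
    by rewrite cardsE; apply: leq_trans (card_size _) _; rewrite /= ltnS.
  have -> : [set x in R | H u x && H w' x] = [set x in R1 | H u x && H w' x] :\: [set x in verts s0].
    by apply/setP => x; rewrite !inE -!andbA.
  by move: hb h2; set a := #|_ :&: _|; set b := #|_ :\: _|; clear; lia.
have [c [hc sc subc]] := assemble_cycle HC HO OM1 OM2 S'0 cS' uflat pathS' SR cntS' bigR.
have cL : size c = L.
  rewrite sc (perm_size pflat) (perm_size pS') !size_cat /= !size_map sxs LE.
  have : (size (flatten (map verts (map pc us))) + size us = (h - hw).*2)%N.
    rewrite -fs -map_comp /us; elim: (enum st') => [|u l IH] /=; first by rewrite big_nil.
    rewrite big_cons; case: ifP => f0 /=; last by rewrite IH; move: f0; clear; lia.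
    by rewrite size_cat /= size_traject; move: IH f0; clear; lia.
  have : (hw <= h)%N by exact: geq_minl.
  by clear; lia.
exists c; split=> //; first by rewrite cL; move: Lmin; clear; lia.
by apply: subc; rewrite (perm_mem pflat) !mem_cat inE -s0v eqxx orbT.
Qed.

End CycleOfLength.

(** * Robust cycles in tessellated graphs *)

(** Here x stands for m times a number of inner boxes: the left side bounds a times the maximum
    degree of G, the right side bounds below the edges of H outside F at a vertex. The gain eps/2
    outweighs several errors of relative size eps/100. *)
Lemma degree_surplus (R : realFieldType) (eps eta m x : R) :
  0 < eps -> eps <= 2^-1 -> 2^-1 <= eta -> eta + eps <= 1 -> 400 <= eps * m -> m <= x ->
  (eta + eps / 2) * ((1 + eps / 100) * ((1 + eps / 100) * x)) <=
    (eta + eps) * ((1 - eps / 100) * x - 1) - (eps / 100 * m + 1).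
Proof.
move=> e0 e3 e2 e1 mb mx.
have m0 : 0 < m by nra.
have x0 : 0 < x by lra.
have ex : eps * m <= eps * x by rewrite ler_pM2l.
set a := eta + eps / 2.
have k1 : a * (1 + eps / 100) ^+ 2 <= a + 3 * (eps / 100).
  by clear -e0 e1 e2 e3; rewrite expr2 /a; nra.
have k2 : a + eps / 2 - eps / 100 <= (eta + eps) * (1 - eps / 100).
  by clear -e0 e1 e2 e3; rewrite /a; nra.
have k3 := ler_wpM2l (ltW x0) k1; have k4 := ler_wpM2l (ltW x0) k2.
rewrite !mulrA -[a * _ * _]mulrA -expr2 [leLHS]mulrC.
apply: (le_trans k3).
have -> : (eta + eps) * ((1 - eps / 100) * x - 1) = x * ((eta + eps) * (1 - eps / 100)) - (eta + eps) by ring.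
clearbody a; move: k4 ex mb e1; clear.
by set u := x * ((eta + eps) * _); lra.
Qed.

Lemma bad_fraction (R : realFieldType) (eps q : R) : 0 < eps -> eps <= 2^-1 -> 0 <= q ->
  (1 + eps / 100) * (eps / 100) * q <= eps / 50 * (1 - eps / 100) * q.
Proof. by move=> e0 e1 q0; apply: ler_wpM2r => //; nra. Qed.

(** * Degrees, common neighbours and the capped subgraph in a tessellation *)

Section Cells.
Context {R : realType} {V C : finType}.
Variables (cell : V -> C) (adj I O : rel C) (G H : rel V) (m eps eta : R).
Hypotheses (adjxx : reflexive adj) (adjC : symmetric adj).
Hypotheses (Gsym : symmetric G) (Girr : irreflexive G)
  (GO : forall u w c, adj (cell u) c -> G u w -> O c (cell w))
  (IG : forall u w c, u != w -> adj (cell u) c -> I c (cell w) -> G u w).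
Hypothesis cell_card : forall c,
  (1 - eps / 100) * m <= #|[set u | cell u == c]|%:R <= (1 + eps / 100) * m.
Hypothesis OI : forall c, #|[set a | O c a]|%:R <= (1 + eps / 100) * #|[set a | I c a]|%:R :> R.
Hypothesis adjO : subrel adj O.
Hypothesis GH : alpha_subgraph (eta + eps) G H.
Hypotheses (eps0 : 0 < eps) (eta2 : 2^-1 <= eta) (eta1 : eta + eps <= 1).

Lemma card_cells (P : pred C) :
  (1 - eps / 100) * m * #|[set c | P c]|%:R <= #|[set u | P (cell u)]|%:R
    <= (1 + eps / 100) * m * #|[set c | P c]|%:R.
Proof.
have -> : #|[set u | P (cell u)]|%:R = \sum_(c in [set c | P c]) #|[set u | cell u == c]|%:R :> R.
  rewrite -[in LHS]sum1_card (partition_big cell (mem [set c | P c])) /=; last by move=> u; rewrite !inE.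
  rewrite natr_sum; apply: eq_bigr => c; rewrite inE => Pc.
  rewrite -sum1_card; congr (_%:R); apply: eq_bigl => u; rewrite !inE.
  by case: eqP => [->|]; rewrite ?andbF // Pc.
by rewrite !mulr_natr -!sumr_const; apply/andP; split; apply: ler_sum => c _; have /andP[] := cell_card c.
Qed.

Lemma inner_card_gt0 c : (0 < #|[set a | I c a]|)%N.
Proof.
rewrite -(ltr_nat R); have : 0 < #|[set a | O c a]|%:R :> R.
  by rewrite ltr0n; apply/card_gt0P; exists c; rewrite inE adjO.
move/lt_le_trans/(_ (OI c)); rewrite pmulr_rgt0 //.
by have := eps0; lra.
Qed.

Lemma degree_ge u c : adj (cell u) c ->
  (1 - eps / 100) * m * #|[set a | I c a]|%:R - 1 <= (degree G u)%:R.
Proof.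
move=> uc; have /andP[h _] := card_cells (I c).
rewrite lerBlDr (le_trans h) // natr1 ler_nat.
have : [set x | I c (cell x)] \subset u |: [set w | G u w].
  apply/subsetP => x; rewrite !inE => Icx; case: (eqVneq x u) => //= xu.
  by apply: IG Icx; rewrite // eq_sym.
by move/subset_leq_card/leq_trans; apply; rewrite cardsU1 -add1n leq_add ?leq_b1.
Qed.

Lemma degree_le u c : adj (cell u) c -> (degree G u)%:R <= (1 + eps / 100) * m * #|[set a | O c a]|%:R.
Proof.
move=> uc; have /andP[_ h] := card_cells (O c).
apply: le_trans h; rewrite ler_nat; apply: subset_leq_card; apply/subsetP => x; rewrite !inE.
exact: GO.
Qed.

(** Both neighbourhoods lie in the boxes O-related to [cell w], which hold at most (1 + eps/100)^2 m
    i vertices for i inner boxes, while each has at least (1/2 + eps)((1 - eps/100) m i - 1)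
    elements; inclusion-exclusion leaves eps m. *)
Lemma common_neighbours u w : 400 <= eps * m -> adj (cell u) (cell w) ->
  eps * m <= #|[set x | H u x && H w x]|%:R.
Proof.
move=> mbig uw; have [Hs HG Hd] := GH.
set c := cell w; set i := #|[set a | I c a]|%:R : R.
have cc : adj (cell w) c := adjxx c.
have i1 : 1 <= i by rewrite ler1n inner_card_gt0.
have := degree_ge uw; have := degree_ge cc; rewrite -/i => gw gu.
have := Hd u; have := Hd w => hw hu.
have /andP[_ hO] := card_cells (O c).
have hU : (degree H u + degree H w <= #|[set x | O c (cell x)]| + #|[set x | H u x && H w x]|)%N.
  rewrite /degree -cardsUI; apply: leq_add.
    apply: subset_leq_card; apply/subsetP => x; rewrite !inE => /orP[] /HG; exact: GO.
  by apply: subset_leq_card; apply/subsetP => x; rewrite !inE.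
move: hU; rewrite -(ler_nat R) !natrD => hU.
have := OI c; rewrite -/i => oi.
have e0 := eps0; have e1 := eta1; have e2 := eta2.
have m0 : 0 < m by nra.
have e3 : eps <= 2^-1 by lra.
have m8 : 800 <= m by nra.
have im : m <= m * i by rewrite ler_peMr // ltW.
have big : 0 <= (1 - eps / 100) * m * i - 1 by rewrite -mulrA; nra.
have om : (1 + eps / 100) * m * #|[set a | O c a]|%:R <= (1 + eps / 100) * m * ((1 + eps / 100) * i).
  by rewrite ler_wpM2l // mulr_ge0 ?(ltW m0) //; lra.
have gu' : (2^-1 + eps) * ((1 - eps / 100) * m * i - 1) <= (degree H u)%:R.
  apply: le_trans hu; apply: (@le_trans _ _ ((eta + eps) * ((1 - eps / 100) * m * i - 1))).
    by rewrite ler_wpM2r ?lerD2r.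
  by rewrite ler_wpM2l //; lra.
have gw' : (2^-1 + eps) * ((1 - eps / 100) * m * i - 1) <= (degree H w)%:R.
  apply: le_trans hw; apply: (@le_trans _ _ ((eta + eps) * ((1 - eps / 100) * m * i - 1))).
    by rewrite ler_wpM2r ?lerD2r.
  by rewrite ler_wpM2l //; lra.
set y := m * i.
have ym : m <= y by rewrite /y ler_peMr // ltW.
have k1 : 2 * ((2^-1 + eps) * ((1 - eps / 100) * y - 1)) - (1 + eps / 100) ^+ 2 * y <= #|[set x | H u x && H w x]|%:R.
  rewrite /y; move: gu' gw' om hU hO; rewrite expr2; lra.
apply: le_trans k1.
have ey : eps * m <= eps * y by rewrite ler_pM2l.
have e4 : eps * (eps * y) <= 2^-1 * (eps * y).
  by apply: ler_wpM2r; [nra|lra].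
rewrite expr2; nra.
Qed.

Variable bulk : {set C}.
Hypotheses (bulk_card : #|~: bulk|%:R <= eps / 100 * #|C|%:R :> R)
  (bulk_max : forall c c', c \in bulk -> (#|[set a | O c' a]| <= #|[set a | O c a]|)%N)
  (C0 : (0 < #|C|)%N) (mbig : 400 <= eps * m).

Lemma eps_le_half : eps <= 2^-1.
Proof. by move: eta1 eta2; lra. Qed.

Lemma m_gt0 : 0 < m.
Proof. by move: eps0 mbig; nra. Qed.

Lemma cells_card : (1 - eps / 100) * m * #|C|%:R <= #|V|%:R.
Proof.
have cE (T : finType) (P : pred T) : P =1 predT -> #|[set x | P x]| = #|T|.
  by move=> h; rewrite -[RHS]cardsT; apply: eq_card => x; rewrite !inE h.
by have /andP[+ _] := card_cells predT; rewrite (cE C) // (cE V).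
Qed.

Lemma sub_irr : irreflexive H.
Proof. by have [_ HG _] := GH; move=> x; apply/negP => /HG; rewrite Girr. Qed.

Lemma bulk_neq0 : exists c, c \in bulk.
Proof.
apply/existsP; rewrite -[[exists _, _]]negbK negb_exists; apply/negP => /forallP none.
have E : ~: bulk = setT by apply/setP => c; rewrite !inE; exact: none.
have := bulk_card; rewrite E cardsT leNgt => /negP; apply.
by rewrite gtr_pMl ?ltr0n //; move: eps_le_half; lra.
Qed.

Lemma nonbulk_card : #|[set u | cell u \notin bulk]|%:R <= eps / 50 * #|V|%:R :> R.
Proof.
have /andP[_ h] := card_cells [pred c | c \notin bulk].
have m0 := m_gt0; have e0 := eps0; have e3 := eps_le_half.
apply: (le_trans h).
have -> : [set c | [pred c | c \notin bulk] c] = ~: bulk by apply/setP => c; rewrite !inE.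
have d0 : 0 <= (1 + eps / 100) * m.
  by rewrite mulr_ge0 ?(ltW m0) //; lra.
apply: (@le_trans _ _ ((1 + eps / 100) * m * (eps / 100 * #|C|%:R))).
  exact: ler_wpM2l.
apply: (@le_trans _ _ (eps / 50 * ((1 - eps / 100) * m * #|C|%:R))); last first.
  by rewrite ler_wpM2l ?cells_card //; lra.
have -> : (1 + eps / 100) * m * (eps / 100 * #|C|%:R) = (1 + eps / 100) * (eps / 100) * (m * #|C|%:R) by ring.
have -> : eps / 50 * ((1 - eps / 100) * m * #|C|%:R) = eps / 50 * (1 - eps / 100) * (m * #|C|%:R) by ring.
by apply: bad_fraction => //; rewrite mulr_ge0 ?(ltW m0).
Qed.

(** [cover_bound] is applied with D a bound for all degrees of G, nearly attained in the bulk; the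
    vertices outside the bulk are the bad set, with z = eps/50. Inserting its bound on the total
    price into [exists_capped_subgraph] gives the factor 1 - (1-a)/(1+a) - 2z. *)
Lemma capped_subgraph (T b : nat) : (2 * T <= b)%N -> b%:R <= eps / 100 * m ->
  exists F : rel V, [/\ symmetric F, subrel F H, forall v, (degree F v <= b.+1)%N &
    (b%:R - 2 * T%:R) * T%:R *
      ((2 * (eta + eps / 2) / (1 + (eta + eps / 2)) - eps / 25) * #|V|%:R)
    <= (T%:R + 1) * \sum_v (degree F v)%:R].
Proof.
move=> Tb bm; have [Hs HG Hd] := GH.
have e0 := eps0; have e1 := eta1; have e2 := eta2; have e3 := eps_le_half; have m0 := m_gt0.
have [F [[Fs FH Fb pT pc] pot]] := exists_capped_subgraph Hs sub_irr Tb.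
exists F; split=> //.
pose p v := price T b (degree F v).
set a := eta + eps / 2.
have a0 : 0 <= a by rewrite /a; lra.
have a1 : a <= 1 by rewrite /a; lra.
have ea0 : 0 <= eta + eps by lra.
have d0 : 0 < 1 + eps / 100 by lra.
have [c0 c0b] := bulk_neq0.
set D := (1 + eps / 100) * m * #|[set x | O c0 x]|%:R.
have D0 : 0 < D.
  rewrite /D mulr_gt0 ?mulr_gt0 // ltr0n; apply/card_gt0P.
  by exists c0; rewrite inE adjO.
have dm0 : 0 <= (1 + eps / 100) * m by rewrite mulr_ge0 ?ltW.
have degU v : (degree G v)%:R <= D.
  apply: (le_trans (degree_le (adjxx _))); rewrite /D ler_wpM2l //.
  by rewrite ler_nat bulk_max.
have degL u : u \notin [set u | cell u \notin bulk] ->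
    a * D <= (degree H u)%:R - (degree F u)%:R.
  rewrite inE negbK => ub.
  have Fu : (degree F u)%:R <= eps / 100 * m + 1 :> R.
    by apply: (@le_trans _ _ b.+1%:R); [rewrite ler_nat|rewrite -natr1 lerD2r].
  have := Hd u; have := degree_ge (adjxx (cell u)).
  set i := #|[set x | I (cell u) x]|%:R : R.
  have i1' : 1 <= i by rewrite ler1n inner_card_gt0.
  move=> gu hu.
  have hu' : (eta + eps) * ((1 - eps / 100) * (m * i) - 1) <= (degree H u)%:R.
    by apply: le_trans hu; rewrite ler_wpM2l // mulrA.
  have Oi : #|[set x | O c0 x]|%:R <= (1 + eps / 100) * i.
    by apply: le_trans (OI (cell u)); rewrite ler_nat bulk_max.
  have Dle : D <= (1 + eps / 100) * ((1 + eps / 100) * (m * i)).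
    rewrite /D -mulrA ler_wpM2l ?(ltW d0) // [leRHS]mulrCA.
    by rewrite ler_wpM2l ?(ltW m0).
  have im : m <= m * i by rewrite ler_peMr // ltW.
  apply: (le_trans (ler_wpM2l a0 Dle)).
  apply: (le_trans (degree_surplus e0 e3 e2 e1 mbig im)).
  exact: lerB.
have a01 : 0 <= a <= 1 by rewrite a0.
have cov := cover_bound (p := p) Gsym HG a01 D0 pT pc degL degU nonbulk_card.
move: pot; rewrite -(ler_int R) !(intrM, intrD, intrN) -!pmulrn.
have -> : (\sum_v Posz (degree F v))%:~R = \sum_v (degree F v)%:R :> R.
  by rewrite rmorph_sum /=; apply: eq_bigr => v _; rewrite -pmulrn.
apply: le_trans; rewrite -mulrA ler_wpM2l //.
  by rewrite subr_ge0 -natrM ler_nat.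
move: cov; rewrite /p; set S := (\sum_v price T b (degree F v))%:~R; set n := (#|V|%:R : R).
have h : 1 + a != 0 by rewrite gt_eqF //; lra.
have -> : 2 * a / (1 + a) = 1 - (1 - a) / (1 + a) by field.
move=> cov; rewrite -subr_ge0; move: cov; rewrite -subr_ge0.
by congr (_ <= _); field.
Qed.

End Cells.

(** Both T/(T+1) and (b-2T)/(b+1) are at least 1 - eps/200. *)
Lemma capped_density (R : realFieldType) (eps b T q n S : R) :
  0 < eps -> eps <= 2^-1 -> 0 <= T -> 0 <= b -> 0 <= q <= 1 -> 0 <= n ->
  200 <= eps * (T + 1) -> 200 * (2 * T + 1) <= eps * (b + 1) ->
  (b - 2 * T) * T * (q * n) <= (T + 1) * S ->
  (q - eps / 100) * n <= S / (b + 1).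
Proof.
move=> e0 e3 T0 b0 /andP[q0 q1] n0 hT hb h.
have T1 : 0 < T + 1 by lra.
have b1 : 0 < b + 1 by lra.
set y := q * n in h *.
have y0 : 0 <= y by rewrite mulr_ge0.
have r1 : (1 - eps / 200) * (T + 1) <= T by lra.
have r2 : (1 - eps / 200) * (b + 1) <= b - 2 * T by lra.
have e4 : 0 <= 1 - eps / 200 by lra.
rewrite ler_pdivlMr // -(ler_pM2l T1); apply: le_trans h.
have r3 : (1 - eps / 200) * (b + 1) * ((1 - eps / 200) * (T + 1)) <= (b - 2 * T) * T.
  by apply: ler_pM r2 r1; rewrite mulr_ge0 ?(ltW b1) ?(ltW T1).
have r4 := ler_wpM2r y0 r3; apply: le_trans r4.
have yn : y <= n by rewrite ler_piMl.
have tb : 0 <= (T + 1) * (b + 1) by rewrite mulr_ge0 ?ltW.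
have -> : (1 - eps / 200) * (b + 1) * ((1 - eps / 200) * (T + 1)) * y =
  ((T + 1) * (b + 1)) * ((1 - eps / 200) ^+ 2 * y) by rewrite expr2; ring.
have -> : (T + 1) * ((q - eps / 100) * n * (b + 1)) =
  ((T + 1) * (b + 1)) * ((q - eps / 100) * n) by ring.
rewrite ler_wpM2l //.
have -> : (q - eps / 100) * n = y - eps / 100 * n by rewrite /y; ring.
have e5 : 1 - eps / 100 <= (1 - eps / 200) ^+ 2.
  by have : 0 <= eps * eps by [rewrite mulr_ge0 ?ltW]; rewrite expr2; lra.
apply: le_trans (ler_wpM2r y0 e5).
have : eps * y <= eps * n by rewrite ler_pM2l.
lra.
Qed.

(** The derivative 2/(1+x)^2 of 2x/(1+x) is at least 1/2 on [0,1], and the arguments differ by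
    eps/2. *)
Lemma ratio_gap (R : realFieldType) (eps eta : R) : 0 < eps -> 2^-1 <= eta -> eta + eps <= 1 ->
  2 * eta / (1 + eta) + eps / 4 <= 2 * (eta + eps / 2) / (1 + (eta + eps / 2)).
Proof.
move=> e0 e2 e1; set a := eta + eps / 2.
have p1 : 0 < 1 + eta by lra.
have p2 : 0 < 1 + a by rewrite /a; lra.
rewrite ler_pdivlMr // mulrDl mulrAC -lerBrDr ler_pdivrMr //.
have a2 : 1 + a <= 2 by rewrite /a; lra.
have h2 : (1 + a) * (1 + eta) <= 2 * 2.
  by apply: ler_pM => //; lra.
have h3 := ler_wpM2l (ltW e0) h2.
have -> : (2 * a - eps / 4 * (1 + a)) * (1 + eta) =
  2 * a * (1 + eta) - eps * ((1 + a) * (1 + eta)) / 4 by field.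
by rewrite /a in h3 *; lra.
Qed.

(** The gap eps/4 pays for all losses: eps/25 + eps/100 in the density of F, eps/40 in [om], eps/50
    for failed paths, and eps/100 for the two paths given up. *)
Lemma coverage_bound (R : realFieldType) (eps eta n om X loss cov q K : R) :
  0 < eps -> eps <= 2^-1 -> 2^-1 <= eta -> eta + eps <= 1 -> 0 <= n ->
  q = 2 * (eta + eps / 2) / (1 + (eta + eps / 2)) - eps / 25 -> q <= 1 ->
  (q - eps / 100) * n <= X -> 1 - eps / 40 <= om -> om <= 1 -> 0 <= X ->
  loss <= eps / 50 * n -> 2 * K <= eps / 100 * n ->
  om * X - loss <= cov -> 2 * eta * n / (1 + eta) + 2 * K <= cov.
Proof.
move=> e0 e3 e2 e1 n0 qE q1 hX om1 om2 X0 hl hK hc.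
have gap := ratio_gap e0 e2 e1.
have g2 : (2 * eta / (1 + eta) + eps / 4 - eps / 25) * n <= q * n.
  by rewrite ler_wpM2r // qE; lra.
have -> : 2 * eta * n / (1 + eta) = 2 * eta / (1 + eta) * n by rewrite mulrAC.
have en : 0 <= eps * n by rewrite mulr_ge0 // ltW.
have o1 : (1 - eps / 40) * X <= om * X by rewrite ler_wpM2r.
have e4 : 0 <= 1 - eps / 40 by lra.
have o2 := ler_wpM2l e4 hX.
have qn : q * n <= n by rewrite ler_piMl.
have eqn : eps * (q * n) <= eps * n by rewrite ler_pM2l.
have een : 0 <= eps * (eps * n) by rewrite mulr_ge0 // ltW.
set z := 2 * eta / (1 + eta) in g2 *.
have o3 : (1 - eps / 40) * ((q - eps / 100) * n) >= q * n - eps / 100 * n - eps / 40 * n.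
  have -> : (1 - eps / 40) * ((q - eps / 100) * n) = q * n - eps / 100 * n - eps * (q * n) / 40 + eps * (eps * n) / 4000 by field.
  by lra.
lra.
Qed.

(* [I] and [O] relate a cell to those whose vertices are certainly, respectively
   possibly, adjacent in [G] to any vertex of an [adj]-nearby cell; [m] is the
   approximate number of vertices of a cell. *)
Record tessellation (R : realType) (V C : finType) (cell : V -> C) (adj I O : rel C)
    (G : rel V) (m eps : R) (M l0 : nat) : Prop := Tessellation {
  tess_adjxx : reflexive adj;
  tess_adjC : symmetric adj;
  tess_conn : forall a b, connect adj a b;
  tess_adjO : subrel adj O;
  tess_OC : symmetric O;
  tess_path : forall a b, O a b -> exists p, [/\ path adj a p, last a p = b & (size p <= l0)%N];
  tess_Gsym : symmetric G;
  tess_Girr : irreflexive G;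
  tess_GO : forall u w c, adj (cell u) c -> G u w -> O c (cell w);
  tess_IG : forall u w c, u != w -> adj (cell u) c -> I c (cell w) -> G u w;
  tess_card : forall c, (1 - eps / 100) * m <= #|[set u | cell u == c]|%:R <= (1 + eps / 100) * m;
  tess_OI : forall c, #|[set a | O c a]|%:R <= (1 + eps / 100) * #|[set a | I c a]|%:R :> R;
  tess_OM : forall c, (#|[set a | O c a]| <= M)%N;
  tess_bulk : exists bulk : {set C}, #|~: bulk|%:R <= eps / 100 * #|C|%:R :> R /\
    (forall c c', c \in bulk -> (#|[set a | O c' a]| <= #|[set a | O c a]|)%N);
  tess_C0 : (0 < #|C|)%N }.

(** The paths see only the pair labels, and thereby avoid both reserves. *)
Definition pair_of (C : finType) (k : nat) (l : label (C := C) k) : option (C * 'I_k.*2.+1) :=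
  if l is inl (inl p) then Some p else None.

Lemma pair_ofE (C : finType) (k : nat) (l : label (C := C) k) c i :
  (l == pair_label c i) = (pair_of l == Some (c, i)).
Proof. by case: l => [[[c' i']|]|]. Qed.

(** [K] is large so that only about 2m/K paths start in a box, few against a reserve of order eps^2
    m from which their links are taken. [mu] is small against 1/K, and [tau] small against [mu];
    every label statistic has error at most tau m. *)
Lemma cycles_from_constants (R : realType) (V C : finType) (cell : V -> C) (adj I O : rel C)
    (G H : rel V) (m eps eta mu tau : R) (M l0 k T : nat) :
  let K := k.*2.+1 in
  tessellation cell adj I O G m eps M l0 -> alpha_subgraph (eta + eps) G H ->
  0 < eps -> 2^-1 <= eta -> eta + eps <= 1 -> (0 < M)%N -> 0 < tau -> 0 < mu ->
  800 * M%:R ^+ 2 <= eps ^+ 2 * K%:R ->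
  mu * (800 * K%:R * M%:R) <= eps ->
  tau * (M%:R ^+ 3 + 1) <= eps ^+ 2 / 400 ->
  tau * (2 * K%:R * M%:R * (1 + 2 * K%:R)) <= eps / 100 - 8 * K%:R * M%:R * mu ->
  tau * (200 * K%:R) <= mu ^+ 2 * eps ->
  200 <= eps * (T%:R + 1) ->
  400 <= eps * m ->
  M%:R ^+ 2 * (l0%:R + M%:R + 2) + 2 < eps ^+ 2 / 400 * m ->
  l0%:R + M%:R + 3 < eps / 200 * m ->
  200 * (2 * T%:R + 1) <= eps * (eps / 100 * m) ->
  400 * K%:R <= eps * m ->
  2 * #|event (V := V) (C := C) k|%:R * expR (- (tau ^+ 2 * m / (16 * M%:R))) < 1 ->
  forall (v : V) (L : nat), (l0.*2 + 4 <= L)%N ->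
    L%:R <= 2 * eta * #|V|%:R / (1 + eta) -> has_cycle_through H L v.
Proof.
move=> K tess GH e0 e2 e1 M0 tau0 mu0 h1 h2 h3 h4 h5 hT m1 m2 m3 m4 m5 small v L Lmin Lmax.
have [Hs HG Hd] := GH.
have [bulk [bulk1 bulk2]] := tess_bulk tess.
have e3 : eps <= 2^-1 by clear -e1 e2; lra.
have m0 : 0 < m by clear -e0 m1; nra.
have K0 : 0 < K%:R :> R by rewrite ltr0n.
have M1 : 1 <= M%:R :> R by rewrite ler1n.
have HO u w : H u w -> O (cell u) (cell w) by move/HG; apply: (tess_GO tess); exact: (tess_adjxx tess).
(* The cap is so small that removing F costs a vertex only a proportion of about eps/100 of its
   degree, yet it grows with m. *)
set b0 := Num.truncn (eps / 100 * m).
have /andP[b0l b0u] : b0%:R <= eps / 100 * m < b0.+1%:R.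
  by apply: Num.Theory.truncn_itv; rewrite mulr_ge0 ?(ltW m0) // divr_ge0 ?(ltW e0).
have hb : 200 * (2 * T%:R + 1) <= eps * (b0%:R + 1) :> R.
  apply: (le_trans m4); rewrite ler_wpM2l ?(ltW e0) // natr1; exact: ltW.
have Tb : (2 * T <= b0)%N.
  rewrite -(ler_nat R) natrM; have T0 : 0 <= T%:R :> R by [].
  have : eps * (b0%:R + 1) <= 2^-1 * (b0%:R + 1) :> R by rewrite ler_wpM2r.
  by move: hb T0; clear; lra.
have [F [Fs FH Fb Fsum]] := capped_subgraph (tess_adjxx tess) (tess_Gsym tess) (tess_Girr tess)
  (tess_GO tess) (tess_IG tess) (tess_card tess) (tess_OI tess) (tess_adjO tess) GH e0 e2 e1
  bulk1 bulk2 (tess_C0 tess) m1 Tb b0l.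
set b := b0.+1 in Fb b0u.
set th := eps / 100.
have th0 : 0 < th by rewrite divr_gt0.
have th1 : 2 * th <= 1 by rewrite /th; clear -e3; lra.
have cellm c : #|[set u | cell u == c]|%:R <= 2 * m.
  have /andP[_] := tess_card tess c; move/le_trans; apply.
  by rewrite ler_wpM2r ?(ltW m0) //; clear -e3; lra.
set t := tau * m.
have t0 : 0 < t by rewrite mulr_gt0.
have tau1 : tau <= eps / 400.
  have M3 : 1 <= M%:R ^+ 3 :> R by rewrite exprn_ege1.
  have q1 : tau * 2 <= tau * (M%:R ^+ 3 + 1) by rewrite ler_wpM2l ?(ltW tau0) //; clear -M3; lra.
  have q2 : eps ^+ 2 <= 2^-1 * eps by rewrite expr2 ler_wpM2r ?(ltW e0).
  by clear -q1 q2 h3 e0; lra.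
have tB : 0 < t <= 4 * m * M%:R.
  rewrite t0 /= /t mulrAC mulrC [leRHS]mulrC ler_wpM2l ?(ltW m0) //.
  by clear -tau1 e3 M1; lra.
have small' : 2 * #|event (V := V) (C := C) k|%:R * expR (- (t ^+ 2 / (16 * m * M%:R))) < 1.
  move: small; congr (_ * expR (- _) < _); rewrite /t; field.
  by rewrite (gt_eqF m0) (gt_eqF (lt_le_trans ltr01 M1)).
have [s0 [E1 E2 E3 E4 E5]] := good_labelling FH (tess_OC tess) HO (ltn0Sn b0) Fb (tess_OM tess) M0
  mu0 th0 th1 cellm m0 tB small'.
set om := omega M mu th in E1 E2 E3.
have om1 : om <= 1 by exact: omega_le1'.
have muM : mu * M%:R <= eps / 800.
  have K1 : 1 <= K%:R :> R by rewrite ler1n.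
  have : mu * M%:R <= mu * M%:R * K%:R by rewrite ler_peMr // mulr_ge0 ?(ltW mu0).
  by move: h2; clear; lra.
have omlow : 1 - eps / 40 <= om.
  have mM0 : 0 <= mu * M%:R by rewrite mulr_ge0 ?(ltW mu0).
  have p : 0 < 1 + mu * M%:R by clear -mM0; lra.
  rewrite /om /omega ler_pdivlMr // /th.
  have : (1 - eps / 40) * (1 + mu * M%:R) <= (1 - eps / 40) + mu * M%:R.
    by have : 0 <= eps / 40 * (mu * M%:R) by [rewrite mulr_ge0 // divr_ge0 ?(ltW e0)]; clear; lra.
  by move: muM e0; clear; lra.
have om2 : 2^-1 <= om by move: omlow e3; clear; lra.
have om0 : 0 < om by move: om2; clear; lra.
pose s v := pair_of (s0 v).
pose A0 := om / K%:R * mu * b%:R.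
have bl : eps / 100 * m <= b%:R by exact: ltW.
have A00 : 0 < A0 by apply: mulr_gt0; [apply: mulr_gt0 => //; exact: divr_gt0|rewrite ltr0n].
have tA0 : t <= A0 * mu.
  have -> : A0 * mu = om * (mu ^+ 2 * b%:R) / K%:R by rewrite /A0 expr2; field; rewrite gt_eqF.
  rewrite ler_pdivlMr // /t.
  apply: (@le_trans _ _ (2^-1 * (mu ^+ 2 * (eps / 100 * m)))); last first.
    have w0 : 0 <= mu ^+ 2 * (eps / 100 * m).
      by apply: mulr_ge0; [exact: sqr_ge0|apply: mulr_ge0; exact: ltW].
    apply: ler_pM w0 om2 _ => //.
    by apply: ler_wpM2l => //; exact: sqr_ge0.
  have := ler_wpM2r (ltW m0) h5.
  have -> : tau * m * K%:R = tau * (200 * K%:R) * m / 200 by field.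
  have -> : 2^-1 * (mu ^+ 2 * (eps / 100 * m)) = mu ^+ 2 * eps * m / 200 by field.
  by apply: ler_wpM2r; rewrite invr_ge0 ler0n.
pose e := om / K%:R * mu * (2 * m) + t.
have [||st [nxt [[ch1 ch2 ch3 ch4 ch5] stbig]]] := exists_chains (cell := cell) O (s := s)
    (sh := share cell F b) (e := e) Fs (share_ge0 cell F b) mu0 A00 tA0.
- move=> u c i; have := E1 u c i; rewrite /A0 mulrA; congr (`|_ - _| <= _).
  by apply: eq_bigl => w; rewrite pair_ofE.
- move=> c c' i; apply: le_trans (le_trans (E2 c c' i) _).
    by rewrite le_eqVlt; apply/orP; left; apply/eqP/eq_bigl => w; rewrite pair_ofE.
  rewrite lerD2r ler_wpM2l // mulr_ge0 ?(ltW mu0) // divr_ge0 // ltW //.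
have zoneE c c' i : zone cell s c c' i = [set w | (cell w == c) && (s0 w == pair_label c' i)].
  by apply/setP => w; rewrite !inE pair_ofE.
pose R1 := [set w | s0 w == reserve k true].
pose R2 := [set w | s0 w == reserve k false].
have t2 : t = tau * m by [].
have nV := cells_card (tess_card tess).
have nV2 : m / 2 * #|C|%:R <= #|V|%:R.
  by apply: le_trans nV; rewrite ler_wpM2r // mulrC ler_wpM2r ?(ltW m0) //; move: e3; clear; lra.
have C1 : 1 <= #|C|%:R :> R by rewrite ler1n (tess_C0 tess).
have nVm : m / 2 <= #|V|%:R.
  by apply: le_trans nV2; rewrite ler_peMr // divr_ge0 ?(ltW m0).
(* Bound on the paths starting in a box: its classes of layer 0 have about 2m/K vertices in all,
   with an error t for each of at most M classes. *)
pose beta := 2 * m / K%:R + M%:R * t.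
have beta0 : 0 <= beta.
  apply: addr_ge0; last by apply: mulr_ge0 => //; exact: ltW.
  by apply: divr_ge0 => //; apply: mulr_ge0 => //; exact: ltW.
have /andP[Bl Bu] := Num.Theory.truncn_itv beta0.
set B1 := Num.truncn beta in Bl Bu.
have st_count c : (#|[set u in st | cell u == c]| <= B1)%N.
  rewrite -ltnS -(ltr_nat R); apply: le_lt_trans Bu.
  apply: (@le_trans _ _ (\sum_(c' in [set c' | O c c']) #|zone cell s c c' ord0|%:R)).
    rewrite -natr_sum ler_nat; apply: leq_trans (leq_card_bigcup _ _).
    apply: subset_leq_card; apply/subsetP => u; rewrite inE => /andP[ust /eqP uc].
    have [c' Oc' su] := ch5 u ust; apply/bigcupP; exists c'; first by rewrite inE -uc.
    by rewrite inE uc su !eqxx.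
  apply: (@le_trans _ _ (\sum_(c' in [set c' | O c c'])
      (om / K%:R * (\sum_(v | cell v == c) (share cell F b v c' + mu)) + t))).
    apply: ler_sum => c'; rewrite inE => Oc'; rewrite zoneE.
    by have := E3 c c' ord0 Oc'; rewrite ler_distl => /andP[_].
  rewrite big_split /= sumr_const; apply: lerD; last first.
    by rewrite -[leLHS]mulr_natl ler_wpM2r ?(ltW t0) // ler_nat (tess_OM tess).
  rewrite -mulr_sumr exchange_big /=.
  apply: (@le_trans _ _ (om / K%:R * \sum_(v | cell v == c) (1 + mu * M%:R))).
    apply: ler_wpM2l; first by apply: divr_ge0; exact: ltW.
    apply: ler_sum => v' /eqP vc.
    apply: le_trans (sum_raw (b := b) FH HO (ltn0Sn b0) Fb (tess_OM tess) mu0 v').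
    rewrite /raw -big_mkcond /= vc le_eqVlt; apply/orP; left; apply/eqP/eq_bigl => c'.
    by rewrite inE.
  rewrite sumr_const -[X in _ * X]mulr_natr; have hc := cellm c; rewrite cardsE in hc.
  move: hc; set N := #|_|%:R => hc.
  have -> : om / K%:R * ((1 + mu * M%:R) * N) = om * (1 + mu * M%:R) * N / K%:R.
    by field; rewrite gt_eqF.
  apply: ler_wpM2r; first by rewrite invr_ge0.
  by apply: le_trans hc; rewrite ler_piMl //; exact: omega_le1.
have R2big c : (l0 + M + 3 < #|[set x in R2 | cell x == c]|)%N.
  rewrite -(ltr_nat R) !natrD.
  have -> : [set x in R2 | cell x == c] = [set w | (cell w == c) && (s0 w == reserve k false)].
    by apply/setP => w; rewrite !inE andbC.
  apply: lt_le_trans (E5 c).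
  have /andP[cl _] := tess_card tess c.
  have := ler_wpM2l (ltW th0) cl; rewrite /th t2.
  have : tau * m <= eps / 400 * m by rewrite ler_wpM2r // ltW.
  have : eps * (eps * m) <= 2^-1 * (eps * m) by rewrite ler_wpM2r // mulr_ge0 ?ltW.
  have : 0 <= eps * m by rewrite mulr_ge0 ?ltW.
  by move: m3; clear; lra.
have R1big u w : adj (cell u) (cell w) ->
    (M * M * (B1 + l0 + M + 2) + 2 < #|[set x in R1 | H u x && H w x]|)%N.
  move=> uw; rewrite -(ltr_nat R) !natrD !natrM !natrD.
  have -> : [set x in R1 | H u x && H w x] = [set v | H u v && H w v && (s0 v == reserve k true)].
    by apply/setP => x; rewrite !inE andbC.
  apply: lt_le_trans (E4 u w).
  have cn := common_neighbours (tess_adjxx tess) (tess_GO tess) (tess_IG tess)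
    (tess_card tess) (tess_OI tess) (tess_adjO tess) GH e0 e2 e1 m1 uw.
  have h := ler_wpM2l (ltW th0) cn.
  apply: (@lt_le_trans _ _ (th * (eps * m) - t)); last by rewrite lerD2r.
  have MM0 : 0 <= M%:R * M%:R :> R by rewrite mulr_ge0.
  have b1 : M%:R * M%:R * B1%:R <= M%:R * M%:R * beta by rewrite ler_wpM2l.
  have b2 : M%:R * M%:R * (2 * m / K%:R) <= eps ^+ 2 / 400 * m.
    rewrite !mulrA ler_pdivrMr //; have := ler_wpM2r (ltW m0) h1.
    by rewrite expr2; clear; lra.
  have b3 := ler_wpM2r (ltW m0) h3.
  have b4 : M%:R * M%:R * beta = M%:R * M%:R * (2 * m / K%:R) + (tau * (M%:R ^+ 3 + 1) * m - t).
    by rewrite /beta /t !exprS expr0; ring.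
  have -> : M%:R * M%:R * (B1%:R + l0%:R + M%:R + 2%:R) + 2%:R =
      M%:R * M%:R * B1%:R + (M%:R ^+ 2 * (l0%:R + M%:R + 2) + 2) :> R by rewrite expr2; ring.
  (* The reserve is split into quarters: one for the path stations, one for the concentration
     errors, one for the other stations, and one to spare. *)
  have -> : th * (eps * m) = 4 * (eps ^+ 2 / 400 * m) by rewrite /th expr2; field.
  have b5 : 0 <= eps ^+ 2 / 400 * m.
    exact: mulr_ge0 (divr_ge0 (sqr_ge0 eps) (ler0n _ 400)) (ltW m0).
  by rewrite b4 in b1; move: b1 b2 b3 b5 m2; clear; lra.
have cover : 2 * eta * #|V|%:R / (1 + eta) + 2 * K%:R <= K%:R * #|st|%:R.
  set q := 2 * (eta + eps / 2) / (1 + (eta + eps / 2)) - eps / 25.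
  set a := eta + eps / 2 in q *.
  have a1 : a <= 1 by rewrite /a; move: e1 e0; clear; lra.
  have a2 : 2^-1 <= a by rewrite /a; move: e2 e0; clear; lra.
  have a3 : 0 < 1 + a by move: a2; clear; lra.
  have q1 : q <= 1.
    have : 2 * a / (1 + a) <= 1 by rewrite ler_pdivrMr //; move: a1; clear; lra.
    by rewrite /q; move: e0; clear; lra.
  have q0 : 0 <= q.
    have : 2^-1 <= 2 * a / (1 + a) by rewrite ler_pdivlMr //; move: a1 a2; clear; lra.
    by rewrite /q; move: e3; clear; lra.
  pose X : R := (\sum_v (degree F v)%:R) / b%:R.
  have X0 : 0 <= X by rewrite divr_ge0 // sumr_ge0.
  have hX : (q - eps / 100) * #|V|%:R <= X.
    have bE : b%:R = b0%:R + 1 :> R by rewrite -natr1.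
    rewrite /X bE; apply: (capped_density (T := T%:R)) => //; first by rewrite q0.
  have hK : 2 * K%:R <= eps / 100 * #|V|%:R.
    have := ler_wpM2l (ltW e0) nVm; move: m5; clear; lra.
  apply: (coverage_bound (loss := eps / 50 * #|V|%:R) e0 e3 e2 e1 (ler0n _ _) (erefl q) q1 hX omlow om1 X0 (lexx _) hK).
  apply: le_trans (ler_wpM2l (ltW K0) stbig).
  (* Vertices lost per class: K times the error t in its size and the 2e failures at each of K
     steps. *)
  pose w : R := K%:R * (t + K%:R * (2 * e)).
  have e_ge0 : 0 <= e.
    apply: addr_ge0; last exact: ltW.
    apply: mulr_ge0; last by apply: mulr_ge0 => //; exact: ltW.
    exact: (mulr_ge0 (divr_ge0 (ltW om0) (ltW K0)) (ltW mu0)).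
  have w0 : 0 <= w.
    apply: mulr_ge0 => //; apply: addr_ge0; first exact: ltW.
    by apply: mulr_ge0 => //; apply: mulr_ge0.
  have s3 : #|C|%:R * (M%:R * w) <= eps / 50 * #|V|%:R.
    have -> : #|C|%:R * (M%:R * w) = m / 2 * #|C|%:R *
        (tau * (2 * K%:R * M%:R * (1 + 2 * K%:R)) + 8 * K%:R * M%:R * mu * om).
      by rewrite /w /e /t; field; rewrite gt_eqF.
    have g0 : 0 <= 8 * K%:R * M%:R * mu by apply: mulr_ge0; [rewrite !mulr_ge0|exact: ltW].
    have g1 : 8 * K%:R * M%:R * mu * om <= 8 * K%:R * M%:R * mu by rewrite ler_piMr.
    have g2 : tau * (2 * K%:R * M%:R * (1 + 2 * K%:R)) + 8 * K%:R * M%:R * mu * om <= eps / 50.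
      by move: g1 h4 e0; clear; lra.
    rewrite mulrC; apply: ler_pM => //; first by apply: addr_ge0;
      [apply: mulr_ge0; [exact: ltW|rewrite !mulr_ge0 ?addr_ge0]|apply: mulr_ge0 => //; exact: ltW].
    by apply: mulr_ge0 => //; apply: divr_ge0; exact: ltW.
  apply: (@le_trans _ _ (om * X - #|C|%:R * (M%:R * w))); first by rewrite lerD2l lerN2.
  have -> : X = \sum_c \sum_(v | cell v == c) \sum_(c' | O c c') share cell F b v c'.
    rewrite /X mulr_suml (partition_big cell xpredT) //=.
    apply: eq_bigr => c _; apply: eq_bigr => v' /eqP <-.
    by rewrite (sum_share b FH HO).
  have -> : #|C|%:R * (M%:R * w) = \sum_(c : C) M%:R * w by rewrite sumr_const -[RHS]mulr_natl.
  rewrite [X in X - _]mulr_sumr -sumrB [leRHS]mulr_sumr; apply: ler_sum => c _.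
  rewrite [leRHS]mulr_sumr.
  apply: (@le_trans _ _ (\sum_(c' | O c c') (om * (\sum_(v | cell v == c) share cell F b v c') - w))).
    have -> : \sum_(c' | O c c') (om * (\sum_(v | cell v == c) share cell F b v c') - w) =
        om * \sum_(v | cell v == c) (\sum_(c' | O c c') share cell F b v c') - \sum_(c' | O c c') w.
      by rewrite sumrB -mulr_sumr exchange_big.
    rewrite lerD2l lerN2.
    rewrite sumr_const -[leLHS]mulr_natl ler_wpM2r // ler_nat.
    by have := tess_OM tess c; rewrite cardsE.
  apply: ler_sum => c' Occ'; rewrite zoneE.
  have := E3 c c' ord0 Occ'; rewrite ler_distl => /andP[z1 _].
  have z2 : om / K%:R * \sum_(v | cell v == c) share cell F b v c' <=
      om / K%:R * \sum_(v | cell v == c) (share cell F b v c' + mu).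
    apply: ler_wpM2l; first by apply: divr_ge0; exact: ltW.
    by apply: ler_sum => v' _; rewrite lerDl ltW.
  have z3 := le_trans (lerB z2 (lexx t)) z1.
  have := ler_wpM2l (ltW K0) z3.
  rewrite /w; set S1 := \sum_(v | _) _; set S2 := #|_|%:R.
  have -> : K%:R * (om / K%:R * S1 - t) = om * S1 - K%:R * t by field; rewrite gt_eqF.
  by rewrite -/K; move: (K%:R : R) => KR; clear; lra.
apply: (cycle_of_length (B1 := B1) (R1 := R1) (R2 := R2) (nxt := nxt) (st := st) (k := k) (M := M) (l0 := l0)
  (tess_adjxx tess) (tess_adjC tess)
  (tess_conn tess) (tess_adjO tess) Hs _ HO (tess_OM tess) _ (tess_path tess)) => //.
- by move=> x; apply/negP => /HG; rewrite (tess_Girr tess).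
- move=> c; rewrite (_ : [set a | O a c] = [set a | O c a]); first exact: (tess_OM tess).
  by apply/setP => a; rewrite !inE (tess_OC tess).
- by move=> u j ust jK; apply: FH; exact: ch1.
- move=> u j ust jK; have := ch4 u j ust jK; rewrite /s !inE.
  by case: (s0 _) => [[p|[]]|].
- rewrite -setI_eq0; apply/eqP/setP => x; rewrite !inE.
  by case: (s0 x) => [[p|[]]|].
- have : (L + 2 * K <= K * #|st|)%N.
    by rewrite -(ler_nat R) natrD !natrM; apply: le_trans cover; rewrite lerD2r.
  by rewrite mulnBr -/K; move: (K * _)%N => q; clear; lia.
Qed.

Lemma exists_nat_ge (R : realType) (x : R) : exists2 k : nat, x <= k%:R & (0 < k)%N.
Proof.
exists (Num.truncn `|x|).+1 => //; apply: (le_trans (ler_norm x)); apply: ltW.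
by have /andP[] := Num.Theory.truncn_itv (normr_ge0 x).
Qed.

(** There are at most 5 K n^2 events, and 48 = 3 * 16 makes the exponential at most n^-3. *)
Lemma label_event_small (R : realType) (V C : finType) (k M : nat) (tau m : R) :
  (0 < M)%N -> 0 < tau -> (#|C| <= #|V|)%N -> (0 < #|V|)%N ->
  10 * (k.*2.+1)%:R < #|V|%:R :> R -> 48 * M%:R / tau ^+ 2 * ln #|V|%:R <= m ->
  2 * #|event (V := V) (C := C) k|%:R * expR (- (tau ^+ 2 * m / (16 * M%:R))) < 1.
Proof.
move=> M0 tau0 CV V0 big hm.
set K := k.*2.+1 in big *; set n := #|V| in big V0 CV hm *.
have n0 : 0 < n%:R :> R by rewrite ltr0n.
have MR : 0 < M%:R :> R by rewrite ltr0n.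
have t2 : 0 < tau ^+ 2 by rewrite exprn_gt0.
have ev : (#|event (V := V) (C := C) k| <= 5 * K * n ^ 2)%N.
  rewrite card_event -/n -/K -mulnn; move: (#|C|) CV => b CV.
  have x1 : (n * b * K <= n * n * K)%N by rewrite leq_mul2r leq_mul2l CV !orbT.
  have x2 : (b * b * K <= n * n * K)%N by rewrite leq_mul2r leq_mul ?orbT.
  have x3 : (n * n <= n * n * K)%N by rewrite leq_pmulr.
  have x4 : (b <= n * n)%N by apply: leq_trans CV _; rewrite leq_pmulr.
  have -> : (5 * K * (n * n) = 5 * (n * n * K))%N by rewrite -mulnA [(K * (n * n))%N]mulnC.
  move: x1 x2 x3 x4.
  move: (n * b * K)%N (b * b * K)%N (n * n * K)%N (n * n)%N => a1 a2 a3 a4; clear; lia.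
have h1 : 3 * ln n%:R <= tau ^+ 2 * m / (16 * M%:R).
  rewrite ler_pdivlMr; last by rewrite mulr_gt0 ?ltr0n.
  have := ler_wpM2l (ltW t2) hm; congr (_ <= _).
  by field; rewrite gt_eqF.
have h2 : expR (- (tau ^+ 2 * m / (16 * M%:R))) <= (n%:R ^+ 3)^-1.
  apply: (@le_trans _ _ (expR (- (3 * ln n%:R)))); first by rewrite ler_expR lerN2.
  by rewrite expRN expRM_natl lnK.
apply: (@le_lt_trans _ _ (2 * (5 * K * n ^ 2)%:R * (n%:R ^+ 3)^-1)).
  apply: ler_pM; [by rewrite mulr_ge0 ?ler0n|exact: expR_ge0| |exact: h2].
  by rewrite ler_wpM2l ?ler0n // ler_nat.
rewrite ltr_pdivrMr ?exprn_gt0 // mul1r !natrM.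
have -> : 2 * (5%:R * K%:R * (n%:R * n%:R)) = 10 * K%:R * n%:R ^+ 2 :> R by rewrite expr2; ring.
by rewrite [ltRHS]exprS ltr_pM2r ?exprn_gt0.
Qed.

Lemma robust_cycles (R : realType) (eps : R) (M l0 : nat) :
  0 < eps -> (0 < M)%N ->
  exists Lam : R, 0 < Lam /\
    forall (V C : finType) (cell : V -> C) (adj I O : rel C) (G H : rel V) (m eta : R),
    tessellation cell adj I O G m eps M l0 -> alpha_subgraph (eta + eps) G H ->
    2^-1 <= eta -> eta + eps <= 1 -> Lam <= m -> Lam * ln #|V|%:R <= m ->
    forall (v : V) (L : nat), (l0.*2 + 4 <= L)%N ->
      L%:R <= 2 * eta * #|V|%:R / (1 + eta) -> has_cycle_through H L v.
Proof.
move=> e0 M0.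
have MR : 0 < M%:R :> R by rewrite ltr0n.
have nat_above := @exists_nat_ge R.
have ee0 : 0 < eps ^+ 2 by rewrite exprn_gt0.
have [k hk k0] := nat_above (800 * M%:R ^+ 2 / eps ^+ 2).
set K := k.*2.+1.
have K0 : 0 < K%:R :> R by rewrite ltr0n.
have h1 : 800 * M%:R ^+ 2 <= eps ^+ 2 * K%:R.
  rewrite [leRHS]mulrC -ler_pdivrMr //; apply: (le_trans hk).
  by rewrite ler_nat /K; clear; lia.
(* This makes 8 K M mu = eps/200, half of the allowance for lost vertices; [tau] has the other
   half. *)
pose mu : R := eps / (1600 * K%:R * M%:R).
have num j : 0 < j.+1%:R :> R by rewrite ltr0n.
have num0 j : 0 <= j%:R :> R by exact: ler0n.
have p1600 := mulr_gt0 (mulr_gt0 (num 1599) K0) MR.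
have mu0 : 0 < mu := divr_gt0 e0 p1600.
have muE : mu * (1600 * K%:R * M%:R) = eps by exact: (divfK (lt0r_neq0 p1600) eps).
have [T hT _] := nat_above (200 / eps).
(* One [tau] serves three conditions: c dominates each coefficient of [tau], and d lies below each
   right-hand side. *)
pose c : R := (M%:R ^+ 3 + 1) + 2 * K%:R * M%:R * (1 + 2 * K%:R) + 200 * K%:R.
pose d : R := Num.min (eps ^+ 2 / 400) (Num.min (eps / 200) (mu ^+ 2 * eps)).
pose tau := d / c.
have c1 : 0 < M%:R ^+ 3 + 1 :> R := addr_gt0 (exprn_gt0 3 MR) ltr01.
have c2 : 0 < 2 * K%:R * M%:R * (1 + 2 * K%:R) :> R :=
  mulr_gt0 (mulr_gt0 (mulr_gt0 (num 1) K0) MR) (addr_gt0 ltr01 (mulr_gt0 (num 1) K0)).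
have c3 : 0 < 200 * K%:R :> R := mulr_gt0 (num 199) K0.
have c0 : 0 < c := addr_gt0 (addr_gt0 c1 c2) c3.
have d0 : 0 < d.
  rewrite !lt_min; apply/and3P; split; [exact: divr_gt0 ee0 (num 399)|exact: divr_gt0 e0 (num 199)|].
  exact: mulr_gt0 (exprn_gt0 2 mu0) e0.
have tau0 : 0 < tau by rewrite divr_gt0.
have tauc x : x <= c -> tau * x <= d.
  move=> xc; apply: (@le_trans _ _ (tau * c)); first by rewrite ler_wpM2l // ltW.
  by rewrite /tau mulfVK // gt_eqF.
have d1 : d <= eps ^+ 2 / 400 by rewrite ge_min lexx.
have d2 : d <= eps / 200 by rewrite !ge_min lexx orbT.
have d3 : d <= mu ^+ 2 * eps by rewrite !ge_min lexx !orbT.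
pose B2 : R := (M%:R ^+ 2 * (l0%:R + M%:R + 2) + 2) * 400 / eps ^+ 2.
pose B3 : R := (l0%:R + M%:R + 3) * 200 / eps.
pose B4 : R := 200 * (2 * T%:R + 1) * 100 / eps ^+ 2.
pose B5 : R := 400 * K%:R / eps.
pose B6 : R := 48 * M%:R / tau ^+ 2.
have b1 : 0 <= 400 / eps := divr_ge0 (num0 400) (ltW e0).
have b2 : 0 <= B2 := divr_ge0 (mulr_ge0 (addr_ge0 (mulr_ge0 (exprn_ge0 2 (num0 M))
  (addr_ge0 (addr_ge0 (num0 l0) (num0 M)) (num0 2))) (num0 2)) (num0 400)) (ltW ee0).
have b3 : 0 <= B3 := divr_ge0 (mulr_ge0 (addr_ge0 (addr_ge0 (num0 l0) (num0 M)) (num0 3))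
  (num0 200)) (ltW e0).
have b4 : 0 <= B4 := divr_ge0 (mulr_ge0 (mulr_ge0 (num0 200) (addr_ge0 (mulr_ge0 (num0 2) (num0 T)) ler01))
  (num0 100)) (ltW ee0).
have b5 : 0 <= B5 := divr_ge0 (mulr_ge0 (num0 400) (num0 K)) (ltW e0).
have b6 : 0 <= B6 := divr_ge0 (mulr_ge0 (num0 48) (num0 M)) (exprn_ge0 2 (ltW tau0)).
have b7 : 0 <= 20 * K%:R :> R := mulr_ge0 (num0 20) (num0 K).
pose Lam := 3 + (400 / eps + B2 + B3 + B4 + B5 + B6 + 20 * K%:R).
exists Lam; split.
  apply: ltr_wpDr (num 2).
  exact: addr_ge0 (addr_ge0 (addr_ge0 (addr_ge0 (addr_ge0 (addr_ge0 b1 b2) b3) b4) b5) b6) b7.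
move=> V C cell adj I O G H m eta tess GH e2 e1 Lm Lln.
have e3 : eps <= 2^-1 by clear -e1 e2; lra.
have mge x : x < Lam -> x < m by move/lt_le_trans; apply.
have sums : [/\ 400 / eps < Lam, B2 < Lam, B3 < Lam & B4 < Lam] /\ [/\ B5 < Lam, B6 < Lam, 20 * K%:R < Lam & 2 < Lam].
  rewrite /Lam; move: b1 b2 b3 b4 b5 b6 b7; set x1 := 400 / eps; set x7 := 20 * K%:R.
  clearbody B2 B3 B4 B5 B6 x1 x7; clear; move=> *; do 2! split; lra.
have [[s1 s2 s3 s4] [s5 s6 s7 s8]] := sums.
have m2' : 2 < m by exact: mge.
have ecast x y : x / eps < m -> x <= eps * m by move=> h; rewrite [leRHS]mulrC -ler_pdivrMr // ltW.
have nV := cells_card (tess_card tess).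
have q1 : 2^-1 * m <= (1 - eps / 100) * m.
  by apply: ler_wpM2r; [apply: ltW; apply: lt_trans m2'; rewrite ltr0n|move: e3; clear; lra].
have q2 : 1 <= (1 - eps / 100) * m by apply: le_trans q1; move: m2'; clear; lra.
have CV : (#|C| <= #|V|)%N.
  by rewrite -(ler_nat R); apply: le_trans nV; rewrite ler_peMl ?ler0n.
have V0 : (0 < #|V|)%N by apply: leq_trans CV; exact: (tess_C0 tess).
have C1 : 1 <= #|C|%:R :> R by rewrite ler1n (tess_C0 tess).
have nVm : 2^-1 * m <= #|V|%:R.
  apply: (le_trans q1); apply: le_trans nV; rewrite ler_peMr //.
  by apply: le_trans q2; rewrite ler01.
apply: (cycles_from_constants (k := k) (T := T) (mu := mu) (tau := tau) tess GH) => //.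
- by rewrite -/K -[leRHS]muE ler_wpM2l ?(ltW mu0) // -!mulrA ler_wpM2r ?mulr_ge0 ?ler0n // ler_nat.
- by apply: le_trans d1; apply: tauc; rewrite /c -addrA lerDl addr_ge0 // ltW.
- rewrite -/K; have -> : eps / 100 - 8 * K%:R * M%:R * mu = eps / 200.
    have -> : 8 * K%:R * M%:R * mu = mu * (1600 * K%:R * M%:R) / 200 by field.
    by rewrite muE; field.
  by apply: le_trans d2; apply: tauc; rewrite /c -addrA addrCA lerDl addr_ge0 // ltW.
- by apply: le_trans d3; apply: tauc; rewrite /c lerDr addr_ge0 // ltW.
- by rewrite [leRHS]mulrC -ler_pdivrMr // (le_trans hT) // lerDl ler01.
- by apply: ecast => //; exact: mge.
- have := mge _ s2; rewrite /B2 ltr_pdivrMr // -ltr_pdivlMr ?ltr0n //.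
  by move/lt_le_trans; apply; rewrite le_eqVlt; apply/orP; left; apply/eqP; field.
- have := mge _ s3; rewrite /B3 ltr_pdivrMr // -ltr_pdivlMr ?ltr0n //.
  by move/lt_le_trans; apply; rewrite le_eqVlt; apply/orP; left; apply/eqP; field.
- have := mge _ s4; rewrite /B4 ltr_pdivrMr // -ltr_pdivlMr ?ltr0n //.
  by move/ltW/le_trans; apply; rewrite le_eqVlt; apply/orP; left; apply/eqP; field.
- by apply: ecast => //; exact: mge.
- apply: label_event_small => //.
    apply: lt_le_trans nVm; have := mge _ s7; rewrite -/K; clear; lra.
  apply: le_trans Lln; rewrite -/B6 ler_wpM2r ?(ltW s6) //.
  by rewrite ln_ge0 // ler1n.
Qed.

(** * The grid of cells *)

Section Grid.
Local Open Scope nat_scope.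
Variables (d k : nat).
Notation C := {ffun 'I_d -> 'I_k.+1}.
Implicit Types (a b c : C) (j : 'I_d).

Definition gap (x y : nat) : nat := (x - y) + (y - x).
Definition sqdist a b : nat := \sum_j gap (a j) (b j) ^ 2.
(** Here q is the square of a radius, in units of the box side, so that the geometry of the grid
    stays in [nat]. *)
Definition close_cells (q : nat) : rel C := fun a b => sqdist a b <= q.
Definition set_coord a j (x : 'I_k.+1) : C := [ffun i => if i == j then x else a i].

Lemma gapC x y : gap x y = gap y x. Proof. by rewrite /gap addnC. Qed.

Lemma sqdistC a b : sqdist a b = sqdist b a.
Proof. by apply: eq_bigr => j _; rewrite gapC. Qed.

Lemma sqdistxx a : sqdist a a = 0.
Proof. by rewrite /sqdist big1 // => j _; rewrite /gap subnn. Qed.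

Lemma sqdist_coord a b j : gap (a j) (b j) ^ 2 <= sqdist a b.
Proof. by rewrite /sqdist (bigD1 j) //= leq_addr. Qed.

Lemma gap_le_sqdist a b j q : close_cells q a b -> gap (a j) (b j) <= q.
Proof.
move=> h; apply: leq_trans (leq_trans (sqdist_coord a b j) h).
by rewrite -mulnn; case: (gap _ _) => // n; rewrite leq_pmulr.
Qed.

Lemma sqdist_set a b j x :
  sqdist a (set_coord b j x) + gap (a j) (b j) ^ 2 = sqdist a b + gap (a j) x ^ 2.
Proof.
rewrite /sqdist [in LHS](bigD1 j) // [in RHS](bigD1 j) //= ffunE eqxx.
rewrite (eq_bigr (fun i => gap (a i) (b i) ^ 2)); last by move=> i /negbTE ij; rewrite ffunE ij.
by rewrite addnAC [RHS]addnAC [X in X + _]addnC.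
Qed.

Lemma grid_path a b : exists p, [/\ path (close_cells 1) a p, last a p = b & size p = \sum_j gap (a j) (b j)].
Proof.
move: {2}(\sum_j _) (erefl (\sum_j gap (a j) (b j))) => n; elim: n a => [|n IH] a.
  move=> h; exists [::]; split=> //=; apply/ffunP => j; apply: val_inj => /=.
  have : gap (a j) (b j) <= 0 by rewrite -h (bigD1 j) //= leq_addr.
  by rewrite /gap; lia.
move=> h; have [j abj] : exists j, a j != b j :> nat.
  apply/existsP; rewrite -negb_forall; apply/negP => /forallP e.
  by move: h; rewrite big1 // => j _; have /eqP -> := e j; rewrite /gap subnn.
pose x : 'I_k.+1 := inord (if a j < b j then (a j).+1 else (a j).-1).
have xE : x = (if a j < b j then (a j).+1 else (a j).-1) :> nat.
  by rewrite inordK //; have := ltn_ord (a j); have := ltn_ord (b j); case: ifP; lia.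
have gx : (gap x (b j)).+1 = gap (a j) (b j) by rewrite xE /gap; case: ifP abj; lia.
have E : \sum_i gap (set_coord a j x i) (b i) = n.
  apply: succn_inj; rewrite -h (bigD1 j) //= [in RHS](bigD1 j) //= ffunE eqxx -gx addSn.
  by congr (_ + _).+1; apply: eq_bigr => i /negbTE ij; rewrite ffunE ij.
have [p [pp lp sp]] := IH (set_coord a j x) E.
exists (set_coord a j x :: p); split=> //=; last by rewrite sp E h.
rewrite pp andbT /close_cells; have := sqdist_set a a j x; rewrite sqdistxx.
have -> : gap (a j) (a j) = 0 by rewrite /gap subnn.
have : gap (a j) x <= 1 by rewrite xE /gap; case: ifP; lia.
by move=> g1; rewrite exp0n // addn0 add0n => ->; case: (gap _ _) g1 => [|[|]].
Qed.

Lemma gap_sum_le a b : \sum_j gap (a j) (b j) <= sqdist a b.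
Proof. by apply: leq_sum => j _; rewrite -mulnn; case: (gap _ _) => // n; rewrite leq_pmulr. Qed.

Lemma card_close_cells q a : #|[set b | close_cells q a b]| <= (2 * q).+1 ^ d.
Proof.
pose f b : {ffun 'I_d -> 'I_(2 * q).+1} := [ffun j => inord (b j + q - a j)].
have fi : {in [set b | close_cells q a b] &, injective f}.
  move=> b b'; rewrite !inE => hb hb' E; apply/ffunP => j; apply: val_inj.
  have := congr1 (fun g : {ffun _ -> _} => val (g j)) E; rewrite !ffunE /=.
  have := gap_le_sqdist j hb; have := gap_le_sqdist j hb'; rewrite /gap => h1 h2.
  by rewrite !inordK; lia.
rewrite -(card_in_imset fi); apply: leq_trans (max_card _) _.
by rewrite card_ffun !card_ord.
Qed.

(** Coordinates of cells at squared distance at most q differ by at most q, so balls around these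
    cells are not cut by the boundary. *)
Definition inner_cells (q : nat) : {set C} := [set c : C | [forall j, (q <= c j) && (c j + q <= k)]].

(** Translation by c - c' maps the ball of c' injectively into that of c. *)
Lemma inner_cells_max q c c' : c \in inner_cells q ->
  #|[set b | close_cells q c' b]| <= #|[set b | close_cells q c b]|.
Proof.
rewrite inE => /forallP hc.
pose f b : C := [ffun j => inord (b j + c j - c' j)].
have fE b j : close_cells q c' b -> f b j = b j + c j - c' j :> nat /\ c' j <= b j + c j.
  move=> hb; have := gap_le_sqdist j hb; have /andP[] := hc j; rewrite /gap ffunE => h1 h2 h3.
  by rewrite inordK; lia.
have fi : {in [set b | close_cells q c' b] &, injective f}.
  move=> b b'; rewrite !inE => hb hb' E; apply/ffunP => j; apply: val_inj.
  have [e1 l1] := fE b j hb; have [e2 l2] := fE b' j hb'.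
  by move: e1; rewrite E e2 /=; lia.
rewrite -(card_in_imset fi); apply: subset_leq_card; apply/subsetP => _ /imsetP[b + ->].
rewrite !inE => hb; apply: (leq_trans _ hb); rewrite leq_eqVlt; apply/orP; left; apply/eqP.
apply: eq_bigr => j _; have [-> h] := fE b j hb.
by congr (_ ^ 2); rewrite /gap; lia.
Qed.

(** Exchanging coordinate j with a free value is injective. *)
Lemma card_coord_in j (X : {set 'I_k.+1}) :
  #|[set c : C | c j \in X]| * k.+1 <= #|X| * #|{: C}|.
Proof.
pose f (p : C * 'I_k.+1) : 'I_k.+1 * C := (p.1 j, set_coord p.1 j p.2).
have fi : {in setX [set c : C | c j \in X] setT &, injective f}.
  move=> [c x] [c' x'] _ _ [e1 e2]; congr (_, _); last first.
    by have := congr1 (fun g : {ffun _ -> _} => g j) e2; rewrite !ffunE eqxx.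
  apply/ffunP => i; have := congr1 (fun g : {ffun _ -> _} => g i) e2.
  by rewrite !ffunE; case: eqP => [->|].
rewrite -[X in _ * X <= _]card_ord -[X in _ * X <= _]cardsT -cardsX -(card_in_imset fi).
rewrite -[X in _ <= _ * X]cardsT -cardsX.
apply: subset_leq_card; apply/subsetP => _ /imsetP[[c x] + ->].
by rewrite !inE /= andbT => ->.
Qed.

Lemma card_boundary_values q : #|[set x : 'I_k.+1 | ~~ ((q <= x) && (x + q <= k))]| <= 2 * q.
Proof.
have low : #|[set x : 'I_k.+1 | x < q]| <= q.
  pose f (x : 'I_k.+1) : 'I_q.+1 := inord x.
  have fi : {in [set x : 'I_k.+1 | x < q] &, injective f}.
    move=> x y; rewrite !inE => hx hy /(congr1 (@nat_of_ord _)).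
    have hx1 : x < q.+1 := ltnW hx; have hy1 : y < q.+1 := ltnW hy.
    by rewrite /f !inordK // => e; exact: val_inj.
  rewrite -(card_in_imset fi) -ltnS; apply: (@leq_ltn_trans #|[set x : 'I_q.+1 | x < q]|).
    apply: subset_leq_card; apply/subsetP => _ /imsetP[x + ->]; rewrite !inE => hx.
    by have hx1 : x < q.+1 := ltnW hx; rewrite inordK.
  rewrite -[X in _ < X]card_ord -[X in _ < X]cardsT; apply: proper_card.
  rewrite properE subsetT; apply/subsetPn; exists ord_max; rewrite !inE //= ltnn //.
have high : #|[set x : 'I_k.+1 | k < x + q]| <= q.
  apply: leq_trans low; rewrite -(card_imset _ (@rev_ord_inj k.+1)).
  apply: subset_leq_card; apply/subsetP => _ /imsetP[x + ->]; rewrite !inE /=.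
  by have := ltn_ord x; lia.
apply: (@leq_trans #|[set x : 'I_k.+1 | x < q] :|: [set x : 'I_k.+1 | k < x + q]|).
  by apply: subset_leq_card; apply/subsetP => x; rewrite !inE; lia.
by apply: (leq_trans (leq_card_setU _ _).1); rewrite mul2n -addnn leq_add.
Qed.

Lemma card_boundary q : #|~: inner_cells q| * k.+1 <= d * (2 * q) * #|{: C}|.
Proof.
pose X := [set x : 'I_k.+1 | ~~ ((q <= x) && (x + q <= k))].
have sub : ~: inner_cells q \subset \bigcup_(j in [set: 'I_d]) [set c : C | c j \in X].
  apply/subsetP => c; rewrite !inE negb_forall => /existsP[j hj].
  by apply/bigcupP; exists j; rewrite ?inE.
apply: (@leq_trans (\sum_(j in [set: 'I_d]) #|[set c : C | c j \in X]| * k.+1)).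
  rewrite -big_distrl leq_mul2r; apply/orP; right.
  exact: leq_trans (subset_leq_card sub) (leq_card_bigcup _ _).
apply: (@leq_trans (\sum_(j in [set: 'I_d]) (2 * q) * #|{: C}|)); last first.
  by rewrite sum_nat_const cardsT card_ord mulnA.
apply: leq_sum => j _; apply: leq_trans (card_coord_in j X) _.
by rewrite leq_mul2r card_boundary_values orbT.
Qed.

End Grid.

(** * Slow growth of balls in the grid *)

Section Shell.
Local Open Scope nat_scope.
Variables (d k T q : nat).
Notation C := {ffun 'I_d -> 'I_k.+1}.
Hypothesis (q0 : 0 < q).
Let Q1 := d * (T * q) ^ 2.
Let Q2 := Q1 + T * q ^ 2.

Definition shell_part (a : C) (j : 'I_d) : {set C} :=
  [set b | [&& ~~ close_cells Q1 a b, close_cells Q2 a b & T * q < gap (a j) (b j)]].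

Lemma shell_cover (a b : C) : ~~ close_cells Q1 a b -> exists j, T * q < gap (a j) (b j).
Proof.
rewrite -ltnNge => h; apply/existsP; rewrite -[[exists _, _]]negbK negb_exists.
apply: contraTN h => /forallP h; rewrite -leqNgt /sqdist.
apply: (@leq_trans (\sum_(j < d) (T * q) ^ 2)); last by rewrite sum_nat_const card_ord.
by apply: leq_sum => j _; rewrite leq_exp2r // leqNgt.
Qed.

(* Moving the large coordinate towards [a] by [q], ..., [T * q] sends [T] copies of
   a part of the shell injectively into the ball of squared radius [Q1]. *)
Definition pull (a : C) (j : 'I_d) (p : C * 'I_T) : C :=
  set_coord p.1 j (inord (if a j <= p.1 j then p.1 j - p.2.+1 * q else p.1 j + p.2.+1 * q)).

Lemma pull_spec (a : C) j (b : C) (t : 'I_T) : T * q < gap (a j) (b j) ->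
  [/\ gap (a j) (pull a j (b, t) j) + t.+1 * q = gap (a j) (b j),
      (a j <= pull a j (b, t) j) = (a j <= b j) & t.+1 * q <= T * q].
Proof.
move=> h; have tT : t.+1 * q <= T * q by rewrite leq_mul2r ltn_ord orbT.
rewrite /pull ffunE eqxx /=; move: h tT; set s := t.+1 * q; set u := T * q => h tT.
have := ltn_ord (b j); have := ltn_ord (a j) => ha hb.
by case: (leqP (a j) (b j)) h => hab; rewrite /gap => h; (rewrite inordK; [by split; lia|by lia]).
Qed.

(** Shortening a gap above T q by at least q lowers the squared distance by at least T q^2, the
    width of the shell. *)
Lemma pull_within (a : C) j (b : C) (t : 'I_T) : b \in shell_part a j ->
  close_cells Q1 a (pull a j (b, t)).
Proof.
rewrite inE => /and3P[_ h2 h3]; have [e _ tT] := pull_spec t h3.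
have := sqdist_set a b j (inord (if a j <= b j then b j - t.+1 * q else b j + t.+1 * q)).
move: h2; rewrite /close_cells -/(pull a j (b, t)) /Q2.
have -> : inord (if a j <= b j then b j - t.+1 * q else b j + t.+1 * q) = pull a j (b, t) j.
  by rewrite ffunE eqxx.
rewrite -e; have q1 : q <= t.+1 * q by rewrite mulSn leq_addr.
move: q1 h3 tT; rewrite -e -!mulnn.
move: (gap _ _) (t.+1 * q) => g s.
rewrite mulnA; move: (T * q) => u q1 h3 tT h2 e2.
have : u * q + g * g <= (g + s) * (g + s).
  have : u * q <= (g + s) * s by apply: leq_mul; [exact: ltnW|].
  by clear; nia.
by move: h2 e2; move: (sqdist _ _) (sqdist _ _) Q1 (u * q) (g * g) ((g + s) * (g + s)); clear; lia.
Qed.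

(** Two shell cells with the same image under different shifts would differ only in coordinate j,
    with gaps at least q apart and above T q. Their squared distances would then differ by at least
    T q^2, taking the farther one out of the shell. *)
Lemma pull_inj (a : C) j : {in setX (shell_part a j) setT &, injective (pull a j)}.
Proof.
have key b b' (t t' : 'I_T) : b \in shell_part a j -> b' \in shell_part a j ->
    (forall i, i != j -> b i = b' i) -> gap (a j) (b j) + t'.+1 * q = gap (a j) (b' j) + t.+1 * q ->
    t' <= t.
  rewrite !inE => /and3P[h1 h2 h3] /and3P[h1' h2' h3'] ij e.
  rewrite leqNgt; apply/negP => tt.
  have s1 : sqdist a b + gap (a j) (b' j) ^ 2 = sqdist a b' + gap (a j) (b j) ^ 2.
    rewrite /sqdist (bigD1 j) //= [in RHS](bigD1 j) //= addnAC [RHS]addnAC.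
    congr (_ + _); first by rewrite addnC.
    by apply: eq_bigr => i /ij ->.
  have g : gap (a j) (b j) + q <= gap (a j) (b' j).
    have : t.+1 * q + q <= t'.+1 * q by rewrite addnC -mulSn leq_mul2r ltnS tt orbT.
    by move: e; clear; move: (t.+1 * q) (t'.+1 * q); lia.
  move: h1 h2' s1 g h3; rewrite /close_cells /Q2 -!mulnn mulnA -ltnNge; move: (T * q) => u.
  move: (gap _ _) (gap _ _) => x y.
  move=> h1 h2' s1 g h3.
  have h4 : u * q + x * x <= x * q + x * x by rewrite leq_add2r leq_mul2r ltnW ?orbT.
  have h5 : x * q + x * x <= y * y by rewrite -mulnDr addnC leq_mul // (leq_trans _ g) // leq_addr.
  have := leq_trans h4 h5; move: h1 h2' s1.
  by move: (sqdist a b) (sqdist a b') (u * q) (x * x) (y * y); clear; lia.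
move=> [b t] [b' t']; rewrite !in_setX !in_setT !andbT => hb hb' E.
have [_ _ g] := and3P (etrans (esym (in_set _ _)) hb).
have [_ _ g'] := and3P (etrans (esym (in_set _ _)) hb').
have [e1 s1 _] := pull_spec t g; have [e2 s2 _] := pull_spec t' g'.
rewrite E in e1 s1.
have ij i : i != j -> b i = b' i.
  move=> /negbTE ij; have := congr1 (fun f : C => f i) E.
  by rewrite !ffunE ij.
have tt : t = t'.
  apply: val_inj; apply/eqP; rewrite eqn_leq (key b' b t' t) ?(key b b' t t') //.
  - by rewrite -e1 -e2 addnAC.
  - by move=> i hi; rewrite ij.
  - by rewrite -e1 -e2 addnAC.
subst t'; congr (_, _); apply/ffunP => i; case: (eqVneq i j) => [->|]; last exact: ij.
apply: val_inj; have := etrans (esym e1) e2; move: (etrans (esym s1) s2); clear; rewrite /gap /=.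
move: (nat_of_ord (a j)) (nat_of_ord (b j)) (nat_of_ord (b' j)) => x y z.
by case: (leqP x y); case: (leqP x z) => h1 h2 // _; lia.
Qed.

(** Each of the d parts of the shell is at most 1/T of the ball. Since cells move only towards [a],
    the count is valid near the boundary of the grid too. *)
Lemma shell_le (a : C) : T * #|[set b | close_cells Q2 a b]| <= (T + d) * #|[set b | close_cells Q1 a b]|.
Proof.
have part j : #|shell_part a j| * T <= #|[set b | close_cells Q1 a b]|.
  rewrite -[X in _ * X]card_ord -[X in _ * X]cardsT -cardsX -(card_in_imset (@pull_inj a j)).
  apply: subset_leq_card; apply/subsetP => _ /imsetP[[b t] + ->].
  by rewrite in_setX => /andP[hb _]; rewrite inE; exact: pull_within.
have sub : [set b | close_cells Q2 a b] \subset
    [set b | close_cells Q1 a b] :|: \bigcup_(j in [set: 'I_d]) shell_part a j.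
  apply/subsetP => b; rewrite !inE => h2; case: (boolP (close_cells Q1 a b)) => //= h1.
  have [j hj] := shell_cover h1; apply/bigcupP; exists j; first by rewrite in_setT.
  by rewrite in_set; apply/and3P; split.
apply: leq_trans (leq_mul (leqnn T) (subset_leq_card sub)) _.
apply: leq_trans (leq_mul (leqnn T) (leq_card_setU _ _).1) _.
rewrite mulnDr mulnDl leq_add2l.
apply: leq_trans (leq_mul (leqnn T) (leq_card_bigcup _ _)) _.
rewrite big_distrr /=; apply: (@leq_trans (\sum_(j in [set: 'I_d]) #|[set b | close_cells Q1 a b]|)).
  by apply: leq_sum => j _; rewrite mulnC.
by rewrite sum_nat_const cardsT card_ord.
Qed.

End Shell.

(** * Geometric graphs as tessellated graphs *)

Lemma young_sq (R : realFieldType) (s u v c : R) : 0 < s -> v ^+ 2 <= c ->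
  (u + v) ^+ 2 <= (1 + s) * u ^+ 2 + (1 + s^-1) * c.
Proof.
move=> s0 vc.
have si0 : 0 < s^-1 by rewrite invr_gt0.
apply: (@le_trans _ _ ((1 + s) * u ^+ 2 + (1 + s^-1) * v ^+ 2)); last first.
  by rewrite lerD2l ler_wpM2l // addr_ge0 ?ltW.
have : 0 <= s^-1 * (s * u - v) ^+ 2 by rewrite mulr_ge0 ?sqr_ge0 ?ltW.
have -> : s^-1 * (s * u - v) ^+ 2 = s * u ^+ 2 - 2 * (u * v) + s^-1 * v ^+ 2.
  by field; rewrite gt_eqF.
rewrite !expr2; lra.
Qed.

Lemma natr_gap_sq (R : realDomainType) (x y : nat) : ((gap x y) ^ 2)%:R = (x%:R - y%:R) ^+ 2 :> R.
Proof.
rewrite /gap natrX; case: (leqP x y) => xy.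
  by rewrite (eqP xy) add0n natrB // -sqrrN opprB.
by rewrite (eqP (ltnW xy)) addn0 natrB // ltnW.
Qed.

Lemma gap_le1 (R : realDomainType) (x y : nat) : (gap x y <= 1)%N ->
  x%:R <= y%:R + 1 :> R /\ y%:R <= x%:R + 1 :> R.
Proof. by rewrite /gap => h; rewrite !natr1 !ler_nat; split; lia. Qed.

Lemma euclidean_dist_le (R : realType) (d : nat) (x y : d.-tuple R) (r : R) : 0 <= r ->
  (euclidean_dist x y <= r) = (\sum_(j < d) (tnth x j - tnth y j) ^+ 2 <= r ^+ 2).
Proof.
move=> r0; rewrite /euclidean_dist.
have S0 : 0 <= \sum_(j < d) (tnth x j - tnth y j) ^+ 2 by apply: sumr_ge0 => j _; exact: sqr_ge0.
by rewrite -[in LHS](@ler_pXn2r _ 2) ?nnegrE ?sqrtr_ge0 // sqr_sqrtr.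
Qed.

Section GridTessellation.
Variables (R : realType) (d k T q n : nat).
Notation C := {ffun 'I_d -> 'I_k.+1}.
Variables (x : 'I_n -> d.-tuple R) (pos : 'I_n -> C) (r m eps s : R).
Let Q1 := (d * (T * q) ^ 2)%N.
Let Q2 := (Q1 + T * q ^ 2)%N.
Hypotheses (q0 : (0 < q)%N) (T0 : (0 < T)%N) (s0 : 0 < s) (r0 : 0 <= r).
Hypothesis (dT : 100 * d%:R <= eps * T%:R).
Hypothesis posP : forall i j,
  ((pos i j)%:R : R) <= k.+1%:R * tnth (x i) j <= (pos i j)%:R + 1.
Hypothesis upper_window : (1 + s) * (k.+1%:R * r) ^+ 2 + d%:R * ((1 + s^-1) * 4) <= Q2%:R.
Hypothesis lower_window : (1 + s) * Q1%:R + d%:R * ((1 + s^-1) * 4) <= (k.+1%:R * r) ^+ 2.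
Hypothesis boundary : 100 * (d * (2 * Q2))%:R <= eps * k.+1%:R.
Hypothesis counts : forall c, (1 - eps / 100) * m <= #|[set u | pos u == c]|%:R <= (1 + eps / 100) * m.

(** Replacing [x w] by its box costs at most 1 in one direction; for [x u] the move to the adjacent
    cell [c] costs 1 more, and the total stays within [-2, 2]. *)
Lemma offset_bound u w c j : close_cells 1 (pos u) c ->
  ((c j)%:R - (pos w j)%:R - k.+1%:R * (tnth (x u) j - tnth (x w) j)) ^+ 2 <= 4.
Proof.
move=> uc; set a := k.+1%:R * _; set b := (c j)%:R - _.
have [h1 h2] := gap_le1 R (gap_le_sqdist j uc).
have /andP[h3 h4] := posP u j; have /andP[h5 h6] := posP w j.
have b1 : b - a <= 2 by rewrite /b /a mulrBr; lra.
have b2 : - 2 <= b - a by rewrite /b /a mulrBr; lra.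
have : 0 <= (2 - (b - a)) * (2 + (b - a)) by apply: mulr_ge0; lra.
by rewrite expr2; nra.
Qed.

Lemma natr_sqdist (c c' : C) : (sqdist c c')%:R = \sum_j ((c j)%:R - (c' j)%:R) ^+ 2 :> R.
Proof. by rewrite natr_sum; apply: eq_bigr => j _; exact: natr_gap_sq. Qed.

Lemma scaled_dist u w :
  \sum_j (k.+1%:R * (tnth (x u) j - tnth (x w) j)) ^+ 2 =
  k.+1%:R ^+ 2 * \sum_j (tnth (x u) j - tnth (x w) j) ^+ 2.
Proof. by rewrite mulr_sumr; apply: eq_bigr => j _; rewrite exprMn. Qed.

Lemma sum_young (a b : 'I_d -> R) : (forall j, (b j - a j) ^+ 2 <= 4) ->
  \sum_j b j ^+ 2 <= (1 + s) * \sum_j a j ^+ 2 + d%:R * ((1 + s^-1) * 4).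
Proof.
move=> h; rewrite mulr_sumr [X in _ + X]mulr_natl -[X in _ *+ X](card_ord d) -sumr_const -big_split /=.
by apply: ler_sum => j _; rewrite -[b j](subrKC (a j)); apply: young_sq.
Qed.

(** After rounding, [upper_window] puts every edge within squared radius Q2, and [lower_window]
    makes Q1 sufficient for an edge; [shell_le] compares the two balls. Grid paths are no longer
    than the squared distance, whence l0 = Q2. *)
Lemma grid_tessellation : tessellation pos (@close_cells d k 1) (close_cells Q1)
  (close_cells Q2) (geometric_graph x r) m eps ((2 * Q2).+1 ^ d) Q2.
Proof.
have K0 : 0 < k.+1%:R :> R by rewrite ltr0n.
have Q21 : (1 <= Q2)%N by rewrite /Q2 addn_gt0 muln_gt0 T0 expn_gt0 q0 orbT.
have gridp (a b : C) : exists p, [/\ path (close_cells 1) a p, last a p = b & (size p <= sqdist a b)%N].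
  by have [p [pp lp sp]] := grid_path a b; exists p; split=> //; rewrite sp gap_sum_le.
split.
- by move=> a; rewrite /close_cells sqdistxx.
- by move=> a b; rewrite /close_cells sqdistC.
- by move=> a b; have [p [pp lp _]] := gridp a b; apply/connectP; exists p.
- by move=> a b; rewrite /close_cells => /leq_trans; apply.
- by move=> a b; rewrite /close_cells sqdistC.
- by move=> a b Oab; have [p [pp lp sp]] := gridp a b; exists p; split=> //; exact: leq_trans sp Oab.
- move=> u w; rewrite /geometric_graph /= eq_sym; congr (_ && (_ <= _)).
  by rewrite /euclidean_dist; congr Num.sqrt; apply: eq_bigr => j _; rewrite -sqrrN opprB.
- by move=> u; rewrite /geometric_graph /= eqxx.
- move=> u w c uc; rewrite /geometric_graph /= euclidean_dist_le // => /andP[_ duw].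
  rewrite /close_cells -(ler_nat R) natr_sqdist; apply: le_trans upper_window.
  apply: le_trans (sum_young (a := fun j => k.+1%:R * (tnth (x u) j - tnth (x w) j)) _) _.
    by move=> j; exact: offset_bound.
  rewrite lerD2r ler_wpM2l //; first by rewrite addr_ge0 ?ltW.
  by rewrite scaled_dist exprMn ler_wpM2l ?sqr_ge0.
- move=> u w c uw uc Icw; rewrite /geometric_graph /= uw euclidean_dist_le //=.
  rewrite -(ler_pM2l (exprn_gt0 2 K0)) -scaled_dist -exprMn.
  apply: le_trans lower_window.
  apply: le_trans (sum_young (b := fun j => k.+1%:R * (tnth (x u) j - tnth (x w) j))
    (a := fun j => (c j)%:R - (pos w j)%:R) _) _.
    by move=> j; rewrite -sqrrN opprB; exact: offset_bound.
  rewrite lerD2r ler_wpM2l //; first by rewrite addr_ge0 ?ltW.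
  by rewrite -natr_sqdist ler_nat.
- exact: counts.
- move=> c; have := shell_le T q0 c; rewrite -(ler_nat R) !natrM natrD -/Q1 -/Q2.
  set o := #|_|%:R; set i := #|_|%:R => h.
  have TR : 0 < T%:R :> R by rewrite ltr0n.
  rewrite -(ler_pM2l TR); apply: (le_trans h).
  rewrite mulrA ler_wpM2r ?ler0n //.
  by have := dT; lra.
- by move=> c; exact: card_close_cells.
- exists (inner_cells d k Q2); split; last by move=> c c'; exact: inner_cells_max.
  have := card_boundary d k Q2; rewrite -(ler_nat R) !natrM => h.
  rewrite -(ler_pM2r K0); apply: (le_trans h).
  rewrite [leRHS]mulrAC ler_wpM2r ?ler0n //.
  by have := boundary; rewrite !natrM; lra.
- by apply/card_gt0P; exists [ffun=> ord0].
Qed.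

End GridTessellation.

(** Let Q = d (T q)^2 and W = T q^2. Then s = 1/(8 d T) gives s Q = W/8, and q is so large that the
    rounding term is at most W/16; both inequalities hold for rho^2 between Q + W/4 and Q + W/2. A
    whole interval is needed since the number of boxes per side is an integer. *)
Lemma exists_window (R : realType) (eps : R) (d : nat) : 0 < eps -> (0 < d)%N ->
  exists (T q : nat) (s lo hi : R), [/\ (0 < T)%N, (0 < q)%N, 0 < s, 100 * d%:R <= eps * T%:R &
    [/\ 0 < lo, lo < hi & forall rho, lo <= rho <= hi ->
      (1 + s) * rho ^+ 2 + d%:R * ((1 + s^-1) * 4) <= (d * (T * q) ^ 2 + T * q ^ 2)%N%:R /\
      (1 + s) * (d * (T * q) ^ 2)%N%:R + d%:R * ((1 + s^-1) * 4) <= rho ^+ 2]].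
Proof.
move=> e0 d0.
have dR : 1 <= d%:R :> R by rewrite ler1n.
have [T hT T0] : exists2 T : nat, 100 * d%:R <= eps * T%:R & (0 < T)%N.
  have [T hT T0] := exists_nat_ge (100 * d%:R / eps); exists T => //.
  by rewrite [leRHS]mulrC -ler_pdivrMr.
have TR : 1 <= T%:R :> R by rewrite ler1n.
pose q := (64 * d * (1 + 8 * d * T))%N.
have q0 : (0 < q)%N by rewrite /q !muln_gt0 d0.
pose u : R := d%:R * T%:R.
have u1 : 1 <= u by rewrite /u -natrM ler1n muln_gt0 d0.
pose s : R := (8 * u)^-1.
have u8 : 0 < 8 * u by rewrite mulr_gt0 ?ltr0n // (lt_le_trans ltr01).
have s0 : 0 < s by rewrite invr_gt0.
pose W : R := (T * q ^ 2)%N%:R.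
pose Q : R := (d * (T * q) ^ 2)%N%:R.
have QW : Q = u * W by rewrite /Q /W /u !(natrM, natrX) exprMn; ring.
pose E : R := d%:R * ((1 + s^-1) * 4).
have EW : 16 * E <= W.
  have -> : 16 * E = q%:R by rewrite /E /s invrK /q /u !(natrM, natrD); ring.
  rewrite ler_nat -mulnn; apply: (@leq_trans (1 * (q * 1))); first by rewrite mul1n muln1.
  by rewrite leq_mul // leq_mul.
have E0 : 0 <= E by rewrite /E !mulr_ge0 ?addr_ge0 ?invr_ge0 ?(ltW u8).
have W1 : 0 < W by rewrite ltr0n muln_gt0 T0 expn_gt0 q0.
have su : s * u = 8^-1 by rewrite /s; field; rewrite gt_eqF // (lt_le_trans ltr01).
have sQ : s * Q = W / 8 by rewrite QW mulrA su mulrC.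
have s8 : s * W <= W / 8.
  rewrite -su mulrA [W * s]mulrC ler_peMr // mulr_ge0 //; exact: ltW.
have Q0 : 0 <= Q by [].
exists T, q, s, (Num.sqrt (Q + W / 4)), (Num.sqrt (Q + W / 2)); split=> //.
have p1 : 0 < Q + W / 4 by lra.
have p2 : 0 < Q + W / 2 by lra.
split; first by rewrite sqrtr_gt0.
  by rewrite ltr_sqrt //; lra.
move=> rho /andP[h1 h2].
have rho0 : 0 <= rho by apply: le_trans h1; exact: sqrtr_ge0.
have r1 : Q + W / 4 <= rho ^+ 2.
  by rewrite -(sqr_sqrtr (ltW p1)) ler_pXn2r ?nnegrE ?sqrtr_ge0.
have r2 : rho ^+ 2 <= Q + W / 2.
  by rewrite -(sqr_sqrtr (ltW p2)) ler_pXn2r ?nnegrE ?sqrtr_ge0.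
rewrite natrD -/Q -/W -/E; split.
  have : (1 + s) * rho ^+ 2 <= (1 + s) * (Q + W / 2) by rewrite ler_wpM2l // addr_ge0 // ltW.
  have -> : (1 + s) * (Q + W / 2) = Q + W / 2 + s * Q + s * W / 2 by field.
  by rewrite sQ; lra.
have -> : (1 + s) * Q = Q + s * Q by ring.
by rewrite sQ; lra.
Qed.

(** * Random positions *)

From mathcomp Require Import all_classical all_reals all_analysis measurable_realfun.
Import Order.TTheory GRing.Theory Num.Theory.
Import numFieldNormedType.Exports.

Local Open Scope classical_set_scope.
Local Open Scope ring_scope.

Section Measurability.
Variables (R : realType) (disp : measure_display) (T : measurableType disp).

Lemma measurable_edge d n (X : 'I_n -> T -> d.-tuple R) (r : R) (i j : 'I_n) :
  (forall i, measurable_fun setT (X i)) ->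
  measurable [set w | geometric_graph (fun i => X i w) r i j].
Proof.
move=> mX; rewrite /geometric_graph /=.
have [_|ij] := boolP (i == j).
  by rewrite [X in measurable X](_ : _ = set0)//; apply/seteqP; split=> w.
have [r0|r0] := ltP r 0.
  rewrite [X in measurable X](_ : _ = set0)//; apply/seteqP; split=> w //=.
  by move=> /le_lt_trans/(_ r0); rewrite ltNge sqrtr_ge0.
pose f w := \sum_(l < d) (tnth (X i w) l - tnth (X j w) l) ^+ 2.
have mf : measurable_fun setT f.
  apply: measurable_sum => l; apply: measurable_funX; apply: measurable_funB.
    exact: (measurableT_comp (measurable_tnth l) (mX i)).
  exact: (measurableT_comp (measurable_tnth l) (mX j)).
rewrite [X in measurable X](_ : _ = setT `&` f @^-1` `]-oo, r ^+ 2]%classic).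
  by apply: mf => //; exact: measurable_itv.
by apply/seteqP; split=> w; rewrite /= in_itv /= euclidean_dist_le //; case.
Qed.

(** There are finitely many graphs on n vertices, and each is determined by finitely many edge
    events and their complements. *)
Lemma measurable_rel_event n (G : T -> rel 'I_n) (Phi : rel 'I_n -> Prop) :
  (forall i j, measurable [set w | G w i j]) -> measurable [set w | Phi (G w)].
Proof.
move=> mG.
pose rel_of (g : {set 'I_n * 'I_n}) : rel 'I_n := fun i j => (i, j) \in g.
rewrite [X in measurable X](_ : _ = \bigcup_(g in [set g | Phi (rel_of g)])
    \bigcap_(p in [set: 'I_n * 'I_n]) [set w | G w p.1 p.2 = (p \in g)]).
  apply: fin_bigcup_measurable; first exact: finite_finset.
  move=> g _; apply: fin_bigcap_measurable; first exact: finite_finset.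
  move=> p _; have [pg|pg] := boolP (p \in g); first exact: mG.
  rewrite [X in measurable X](_ : _ = ~` [set w | G w p.1 p.2]).
    by apply: measurableC; exact: mG.
  by apply/seteqP; split=> w /=; [move=> ->|move/negP/negbTE].
apply/seteqP; split=> w /=.
  move=> PG; exists (finset (fun p => G w p.1 p.2)) => /=.
    suff -> : rel_of (finset (fun p => G w p.1 p.2)) = G w by [].
    by apply/funext => i; apply/funext => j; rewrite /rel_of finset.inE.
  by move=> p _ /=; rewrite finset.inE.
move=> [g /= Pg h]; suff -> : G w = rel_of g by [].
by apply/funext => i; apply/funext => j; exact: (h (i, j)).
Qed.

End Measurability.

Lemma prob_disjoint_union (R : realType) disp (T : measurableType disp)
    (P : probability T R) (I : finType) (E : I -> set T) (good : pred I) (F : set T) :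
  (forall i, measurable (E i)) -> measurable F ->
  (forall i j w, E i w -> E j w -> i = j) ->
  (forall i, good i -> E i `<=` F) -> (\sum_(i | good i) P (E i) <= P F)%E.
Proof.
move=> mE mF tE EF.
have -> : (\sum_(i | good i) P (E i) = P (\bigcup_(i in [set i | good i]) E i))%E.
  rewrite measure_fin_bigcup //; [|exact: finite_finset|by move=> i j _ _ [w [Ei Ej]]; exact: tE Ei Ej].
  rewrite (fsbigE (enum good)) ?enum_uniq //.
  - by rewrite big_enum_cond /=; apply: eq_bigl => i; apply/idP/andP => [gi|[]//]; rewrite inE.
  - by move=> i /=; rewrite mem_enum.
  - by move=> i /= gi; rewrite mem_enum => /negP[].
apply: le_measure; rewrite ?inE //.
  by apply: fin_bigcup_measurable => //; exact: finite_finset.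
by move=> w [i gi Eiw]; exact: EF gi _ Eiw.
Qed.

(** * Numbers of random points in the boxes *)

Section GridPositions.
Context (R : realType) (d k : nat).
Notation C := {ffun 'I_d -> 'I_k.+1}.
Local Notation K := (k.+1%:R : R).

Let K0 : 0 < K. Proof. exact: ltr0Sn. Qed.

(* Half-open boxes miss only points of the upper faces of the cube, a null set. *)
Definition cell_box (c : C) : set (d.-tuple R) :=
  [set y | forall j, `[(c j)%:R / K, (c j).+1%:R / K[%classic (tnth y j)].

Lemma cell_boxP c y j : cell_box c y -> ((c j)%:R : R) <= K * tnth y j < (c j)%:R + 1.
Proof.
move=> /(_ j) /=; rewrite in_itv /= => /andP[h1 h2].
by rewrite mulrC -ler_pdivrMr // h1 /= natr1 -ltr_pdivlMr.
Qed.

Lemma cell_box_inj c c' y : cell_box c y -> cell_box c' y -> c = c'.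
Proof.
move=> hc hc'; apply/ffunP => j; apply: val_inj => /=.
have /andP[h1 h2] := cell_boxP j hc; have /andP[h3 h4] := cell_boxP j hc'.
have := le_lt_trans h1 h4; have := le_lt_trans h3 h2.
by rewrite !natr1 !ltr_nat; lia.
Qed.

Lemma measurable_cell_box c : measurable (cell_box c).
Proof.
rewrite [X in measurable X](_ : _ = \bigcap_(j in [set: 'I_d])
   (fun y : d.-tuple R => tnth y j) @^-1` `[(c j)%:R / K, (c j).+1%:R / K[%classic).
  apply: fin_bigcap_measurable; first exact: finite_finset.
  move=> j _; rewrite -[X in measurable X]setTI.
  exact: (measurable_tnth j measurableT (measurable_itv _)).
by apply/seteqP; split=> y h j; [move=> _|]; exact: h.
Qed.

Lemma lebesgue_measure_cell (a : 'I_k.+1) :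
  lebesgue_measure (`[(a%:R / K), (a.+1%:R / K)[%classic `&` `[0, 1]%classic) = (K^-1)%:E.
Proof.
rewrite (setIidl (B := `[0, 1]%classic)).
  rewrite lebesgue_measure_itv /= lte_fin ltr_pM2r ?invr_gt0 // ltr_nat ltnSn.
  by rewrite -EFinB -mulrBl -natr1 addrAC subrr add0r mul1r.
move=> y /=; rewrite !in_itv /= => /andP[h1 h2]; apply/andP; split.
  by apply: le_trans h1; rewrite divr_ge0.
by apply: ltW; apply: (lt_le_trans h2); rewrite ler_pdivrMr // mul1r ler_nat.
Qed.

Context disp (T : measurableType disp) (P : probability T R) (n : nat).
Variable X : 'I_n -> {RV P >-> (d.-tuple R)}.
Hypotheses (uX : forall i, uniform_on_cube (X i)) (iX : mutually_independent X).

Lemma prob_cell_box i c : P (X i @^-1` cell_box c) = (K^-1 ^+ d)%:E.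
Proof.
have := uX i (A := fun j => `[(c j)%:R / K, (c j).+1%:R / K[%classic)
  (fun j => measurable_itv _).
rewrite (eq_bigr (fun=> (K^-1)%:E)) => [->|j _]; last exact: lebesgue_measure_cell.
by rewrite prodEFin prodr_const card_ord.
Qed.

Definition position_event (pos : {ffun 'I_n -> C}) : set T :=
  [set w | forall i, cell_box (pos i) (X i w)].

Lemma measurable_position_event pos : measurable (position_event pos).
Proof.
rewrite [X in measurable X](_ : _ = \bigcap_(i in [set: 'I_n])
   X i @^-1` cell_box (pos i)).
  apply: fin_bigcap_measurable; first exact: finite_finset.
  by move=> i _; apply: measurable_funPTI; exact: measurable_cell_box.
by apply/seteqP; split=> w h i; [move=> _|]; exact: h.
Qed.

Lemma prob_position_event pos :
  P (position_event pos) = (weight (fun _ _ => K^-1 ^+ d) pos)%:E.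
Proof.
rewrite /weight.
have := iX (finset.setTfor 'I_n) (fun i => measurable_cell_box (pos i)).
rewrite (eq_bigr (fun=> (K^-1 ^+ d)%:E)) => [|i _]; last exact: prob_cell_box.
rewrite prodEFin [in X in _ = X%:E](eq_bigl xpredT) => [<-|i]; last by rewrite finset.inE.
by congr (P _); apply/seteqP; split=> w h i; [move=> _|]; apply: h; rewrite // finset.inE.
Qed.

(** The position events are disjoint and their probabilities are the weights of a uniform product
    measure on assignments of boxes, so [concentration] for the box counts bounds the probability of
    F from below. *)
Lemma prob_balanced_positions (delta : R) (F : set T) (m := n%:R * K^-1 ^+ d) :
  measurable F -> (0 < n)%N -> 0 < delta <= 2 ->
  (forall pos : {ffun 'I_n -> C}, (forall c, `|#|finset (fun u => pos u == c)|%:R - m| <= delta * m) ->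
    position_event pos `<=` F) ->
  ((1 - 2 * (k.+1 ^ d)%:R * expR (- (delta ^+ 2 * m / 8)))%:E <= P F)%E.
Proof.
move=> mF n0 /andP[dl0 dl2] hF.
have p0 : 0 < K^-1 ^+ d by rewrite exprn_gt0 // invr_gt0.
have m0 : 0 < m by rewrite mulr_gt0 // ltr0n.
have cardC : #|{: C}| = (k.+1 ^ d)%N by rewrite card_ffun !card_ord.
pose w (_ : 'I_n) (_ : C) := K^-1 ^+ d.
pose a (c : C) := on_label (R := R) (xpredT : pred 'I_n) c (fun=> 1).
have meana c : mean w (a c) = m.
  rewrite mean_on_label /m mulr_natl -[X in _ *+ X]card_ord -sumr_const.
  by apply: eq_bigr => v _; rewrite mulr1.
have suma c (s : {ffun 'I_n -> C}) : label_sum (a c) s = #|finset (fun u => s u == c)|%:R.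
  by rewrite label_sum_on_label sumr_const cardsE.
have w1 v : \sum_l w v l = 1.
  rewrite sumr_const cardC -[LHS]mulr_natl natrX -exprMn mulfV ?expr1n //; exact: lt0r_neq0.
have := concentration (J := C) (w := w) (a := a) (B := m) (t := delta * m)
  (fun _ _ => ltW p0) w1 _ _ _.
rewrite cardC; have -> : (delta * m) ^+ 2 / (8 * m) = delta ^+ 2 * m / 8.
  by field; exact: lt0r_neq0.
pose good s := [forall c, `|label_sum (a c) s - mean w (a c)| <= delta * m].
move=> h; apply: (@le_trans _ _ (\sum_(s | good s) P (position_event s))%E).
  rewrite (eq_bigr (fun s => (weight w s)%:E)) => [|s _]; last exact: prob_position_event.
  rewrite sumEFin lee_fin; apply: h.
  - by move=> c v l; apply: on_label_01 => _; rewrite ler01 lexx.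
  - by rewrite mulr_gt0 //= ler_wpM2r // ltW.
  - by move=> c; rewrite meana.
apply: prob_disjoint_union => //.
- exact: measurable_position_event.
- by move=> s s' x hs hs'; apply/ffunP => i; exact: cell_box_inj (hs i) (hs' i).
move=> s /forallP hs; apply: hF => c.
by have := hs c; rewrite meana suma.
Qed.

End GridPositions.

(** Stated for an arbitrary relation, so that the event is visibly determined by the graph, which
    makes it measurable. *)
Definition cycle_property (R : realType) (c alpha eta : R) n (G : rel 'I_n) : Prop :=
  forall (L : nat) (v : 'I_n) (H : rel 'I_n),
    c^-1 <= L%:R <= 2 * eta * n%:R / (1 + eta) ->
    alpha_subgraph alpha G H -> has_cycle_through H L v.

Lemma cycle_property_prob (R : realType) (d : nat) (eps : R) : (0 < d)%N -> 0 < eps ->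
  exists c A : R, [/\ 0 < c, 0 < A &
    forall (eta : R) disp (T : measurableType disp) (P : probability T R) (n : nat)
      (X : 'I_n -> {RV P >-> (d.-tuple R)}) (r : R),
    2^-1 <= eta -> eps <= 1 - eta -> mutually_independent X ->
    (forall i, uniform_on_cube (X i)) -> (0 < n)%N -> 0 < r <= c ->
    A <= n%:R * r ^+ d -> A * ln n%:R <= n%:R * r ^+ d ->
    ((1 - 2 / n%:R)%:E <=
      P [set w | cycle_property c (eta + eps) eta (geometric_graph (fun i => X i w) r)] <= 1)%E].
Proof.
move=> d0 e0.
have [Tn [q [s [lo [hi [T0 q0 s0 dT [lo0 lohi win]]]]]]] := exists_window e0 d0.
set Q1 := (d * (Tn * q) ^ 2)%N in win; set Q2 := (Q1 + Tn * q ^ 2)%N in win.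
have [Lam [Lam0 cyc]] := robust_cycles (M := ((2 * Q2).+1 ^ d)%N) Q2 e0
  (expn_gt0 _ _).
have hi0 : 0 < hi := lt_trans lo0 lohi.
set B := (100 * (d * (2 * Q2)))%N.
(* The three terms let (k+1) r land in the window, make the boundary boxes few, and force L >= 2 l0
   + 4 with l0 = Q2. *)
pose c := Num.min (hi - lo) (Num.min (lo * eps / B.+1%:R) (Q2.*2 + 4)%:R^-1).
pose delta := eps / 100.
have h100 : 0 < 100%:R :> R := ltr0Sn _ _.
have dl0 : 0 < delta by rewrite divr_gt0.
pose W := Lam + 16 / delta ^+ 2 + 1.
have W0 : 16 / delta ^+ 2 > 0 by rewrite divr_gt0 ?exprn_gt0 ?ltr0Sn.
have WW : 0 < W by rewrite /W; move: W0 Lam0; clear; lra.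
have c0 : 0 < c.
  rewrite !lt_min subr_gt0 lohi divr_gt0 ?mulr_gt0 ?ltr0Sn // invr_gt0 ltr0n addnS ltn0Sn.
  by [].
have ncp1 : c <= hi - lo by rewrite ge_min lexx.
have ncp2 : c <= lo * eps / B.+1%:R by rewrite ge_min [X in _ || X]ge_min lexx orbT.
have ncp3 : c <= (Q2.*2 + 4)%:R^-1 by rewrite ge_min [X in _ || X]ge_min lexx !orbT.
(* Since (k+1) r <= hi, the mean m of a box count is at least n r^d / hi^d, so this constant gives m
   >= W and m >= W ln n. *)
exists c, (hi ^+ d * W); split=> //; first by rewrite mulr_gt0 ?exprn_gt0.
move=> eta disp T P n X r eta2 epseta iX uX n0 /andP[r0 rc] An Aln.
set F := [set w | _].
have mF : measurable F.
  apply: measurable_rel_event => i j; apply: measurable_edge => l.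
  exact: measurable_funPT.
apply/andP; split; last exact: probability_le1.
pose k := Num.truncn (lo / r).
have [k1 k2] : k%:R <= lo / r /\ lo / r < k.+1%:R.
  by apply/andP; apply: Num.Theory.truncn_itv; rewrite divr_ge0 ?ltW.
have K0 : 0 < k.+1%:R :> R := ltr0Sn _ _.
have Klo : lo <= k.+1%:R * r by rewrite -ler_pdivrMr // ltW.
have Khi : k.+1%:R * r <= hi.
  move: k1; rewrite ler_pdivlMr // -natr1 mulrDl mul1r => k1.
  by apply: le_trans (lerD k1 rc) _; rewrite -lerBrDl.
pose m := n%:R * k.+1%:R^-1 ^+ d : R.
have nR : 0 < n%:R :> R by rewrite ltr0n.
have m_ge x : hi ^+ d * x <= n%:R * r ^+ d -> 0 <= x -> x <= m.
  move=> hx x0; rewrite /m exprVn ler_pdivlMr ?exprn_gt0 //.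
  rewrite -(ler_pM2r (exprn_gt0 d r0)) -mulrA -exprMn; apply: le_trans hx.
  rewrite mulrC ler_wpM2r //; apply: lerXn2r; rewrite ?nnegrE ?(ltW hi0) //.
  exact: le_trans (ltW lo0) Klo.
have ln0 : 0 <= ln n%:R :> R by rewrite ln_ge0 // ler1n.
have Wm : W <= m by apply: m_ge => //; exact: ltW.
have Wlnm : W * ln n%:R <= m by apply: m_ge; rewrite ?mulrA // mulr_ge0 // ltW.
have mL : Lam <= m by apply: le_trans Wm; rewrite /W; move: W0; clear; lra.
have mLl : Lam * ln n%:R <= m.
  by apply: le_trans Wlnm; rewrite ler_wpM2r // /W; move: W0; clear; lra.
have m1 : 1 <= m by apply: le_trans Wm; rewrite /W; move: W0 Lam0; clear; lra.
have Kn : (k.+1 ^ d)%:R <= n%:R :> R.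
  by move: m1; rewrite /m exprVn ler_pdivlMr ?exprn_gt0 // mul1r natrX.
(* Each box then fails with probability at most 2 n^-2, and there are at most n boxes. *)
have md : 2 * ln n%:R <= delta ^+ 2 * m / 8.
  have : 16 / delta ^+ 2 * ln n%:R <= m.
    by apply: le_trans Wlnm; rewrite ler_wpM2r // /W; move: Lam0; clear; lra.
  rewrite mulrAC ler_pdivrMr ?exprn_gt0 // [m * _]mulrC; clear; lra.
have := @prob_balanced_positions R d k disp T P n X uX iX delta F mF n0.
move=> /(_ _ _)/(le_trans _); apply.
- rewrite lee_fin lerD2l lerN2.
  have le1 : expR (- (delta ^+ 2 * m / 8)) <= n%:R^-1 ^+ 2.
    rewrite -[n%:R^-1 ^+ 2]lnK ?posrE ?exprn_gt0 ?invr_gt0 // ler_expR.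
    by rewrite lnXn ?invr_gt0 // lnV ?posrE // mulNrn -[ln _ *+ 2]mulr_natl lerN2.
  rewrite -mulrA ler_pM2l ?ltr0Sn //.
  have -> : n%:R^-1 = n%:R * n%:R^-1 ^+ 2 :> R by field; rewrite gt_eqF.
  by apply: ler_pM => //; exact: expR_ge0.
- by rewrite dl0 /delta; move: e0 epseta eta2; clear; lra.
move=> pos balanced w posw L v H /andP[cL Leta] aH.
have Q2L : (Q2.*2 + 4 <= L)%N.
  rewrite -(ler_nat R); apply: le_trans cL.
  by rewrite -[leLHS]invrK lef_pV2 ?posrE // invr_gt0 ltr0n addnS ltn0Sn.
have [w1 w2] := win (k.+1%:R * r) (introT andP (conj Klo Khi)).
have tess := @grid_tessellation R d k Tn q n (fun i => X i w) pos r m eps s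
  q0 T0 s0 (ltW r0) dT _ w1 w2 _ _.
apply: (cyc _ _ _ _ _ _ _ _ _ _ (tess _ _ _) aH) => //.
- move=> i j; have /andP[-> /ltW->] := cell_boxP j (posw i); exact: isT.
- rewrite -/Q1 -/Q2 -natrM -/B -(ler_pM2r r0); apply: (@le_trans _ _ (lo * eps)).
    have : B.+1%:R * r <= lo * eps.
      by rewrite mulrC -ler_pdivlMr ?ltr0Sn //; exact: le_trans rc ncp2.
    by apply: le_trans; rewrite ler_wpM2r ?ler_nat // ltW.
  by rewrite mulrC -mulrA ler_wpM2l // ltW.
- move=> c'; have := balanced c'; rewrite ler_distl -/m -/delta => /andP[h1 h2].
  by apply/andP; split; move: h1 h2; clear; lra.
- by move: epseta; clear; lra.
- by rewrite card_ord.
- by rewrite card_ord.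
Qed.

Theorem theorem4p1 (R : realType) (d : nat) (hd : (1 <= d)%N)
    (eps : R) (heps : 0 < eps) :
  exists c3 C3 : R, [/\ 0 < c3, 0 < C3 &
    forall eta : R, 2^-1 <= eta < 1 -> eps <= 1 - eta ->
    forall (r : nat -> R)
      (disp : nat -> measure_display)
      (T : forall n, measurableType (disp n))
      (P : forall n, probability (T n) R)
      (X : forall n, 'I_n -> {RV (P n) >-> (d.-tuple R)}),
    (\forall n \near \oo,
       C3 * (ln n%:R / n%:R) `^ (d%:R^-1) <= r n <= c3) ->
    (forall n, mutually_independent (X n)) ->
    (forall n (i : 'I_n), uniform_on_cube (X n i)) ->
    P n [set w | forall (L : nat) (v : 'I_n) (H : rel 'I_n),
           c3^-1 <= L%:R <= 2 * eta * n%:R / (1 + eta) ->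
           alpha_subgraph (eta + eps)
             (geometric_graph (fun i => X n i w) (r n)) H ->
           has_cycle_through H L v] @[n --> \oo] --> 1%E].
Proof.
have [c [A [c0 A0 prob]]] := cycle_property_prob hd heps.
(* For n >= k one has ln n >= 1, so the bound A ln n <= n r^d yields A <= n r^d as well. *)
have [k ek k0] := exists_nat_ge (expR 1 : R).
have dR : d%:R != 0 :> R by rewrite pnatr_eq0 -lt0n.
(* Raised to the power d, the lower bound on r then says n r^d >= A ln n. *)
exists c, (A `^ d%:R^-1); split=> //; first by rewrite powR_gt0.
move=> eta /andP[eta2 _] epseta r disp T P X [N _ hr] iX uX.
apply: (@squeeze_cvge _ _ _ _ (fun n : nat => (1 - 2 / n%:R)%:E) _ (cst 1%E)); last exact: cvg_cst.
  exists (maxn N k) => // n /=; rewrite geq_max => /andP[Nn kn].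
  have n0 : (0 < n)%N by apply: leq_trans kn.
  have nR : 0 < n%:R :> R by rewrite ltr0n.
  have ln1 : 1 <= ln n%:R :> R.
    rewrite -[leLHS](@expRK R) ler_ln ?posrE ?expR_gt0 //.
    by apply: le_trans ek _; rewrite ler_nat.
  have ln0 : 0 < ln n%:R :> R by apply: lt_le_trans ln1.
  have /andP[rlo rc] := hr n Nn.
  have ratio0 : 0 < ln n%:R / n%:R :> R by rewrite divr_gt0.
  have r0 : 0 < r n by apply: lt_le_trans rlo; rewrite mulr_gt0 ?powR_gt0.
  have Aln : A * ln n%:R <= n%:R * r n ^+ d.
    rewrite mulrC [leRHS]mulrC -ler_pdivrMr // mulrAC mulrC.
    rewrite -powRM ?(ltW A0) ?(ltW ratio0) // in rlo.
    have : (A * (ln n%:R / n%:R)) `^ d%:R^-1 ^+ d <= r n ^+ d.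
      by apply: lerXn2r rlo; rewrite nnegrE ?powR_ge0 // ltW.
    by rewrite -powR_mulrn ?powR_ge0 // -powRrM mulVf // powRr1 // mulr_ge0 ?ltW.
  apply: prob => //; first by rewrite r0.
  by apply: le_trans Aln; rewrite ler_peMr // ltW.
rewrite -[X in _ --> X%:E]subr0 -[X in _ - X](mulr0 2).
apply: cvg_EFin; first by apply: nearW.
apply: cvgB; first exact: cvg_cst.
apply: cvgM; first exact: cvg_cst.
rewrite -cvg_shiftS; exact: cvg_harmonic.
Qed.
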